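(* Let $u_0\in\mathcal{M}$. There exist constants $C_u>0$, $C_g>0$ and $0<C_\alpha\le 1$, depending only on $\Omega$, $d$, $\beta$, $V$ and $\|u_0\|_{H_0^1(\Omega)}$, such that whenever $0<\alpha_{\min}\le\alpha_n\le\alpha_{\max}\le C_\alpha$ for all $n\ge 0$, the iterates $\{u_n\}_{n=0}^\infty\subset\mathcal{M}$ of the $a_0$-scheme $u_{n+1}=R\big(u_n-\alpha_n\nabla^{\mathcal{R}}_{a_0}E(u_n)\big)$, $n\ge 0$, started at $u_0$ satisfy, for every $n\ge 0$: (i) $\|u_n\|_{a_0(\Omega)}\le C_u$; (ii) $\|\nabla^{\mathcal{R}}_{a_0}E(u_n)\|_{a_0(\Omega)}\le\|\nabla_{a_0}E(u_n)\|_{a_0(\Omega)}\le C_g$; (iii) $E(u_n)-E(u_{n+1})\ge\frac{\alpha_{\min}}{2}\|\nabla^{\mathcal{R}}_{a_0}E(u_n)\|_{a_0(\Omega)}^2$.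
   Context: Standing assumptions: $d\in\{1,2,3\}$, $\Omega\subset\mathbb{R}^d$ is a bounded Lipschitz domain, $V\in L^\infty(\Omega)$ with $0\le V\le V_{\max}<\infty$, $\beta\ge 0$; functions are real-valued. $\|u\|_{H_0^1(\Omega)}=\|\nabla u\|_{L^2(\Omega)}$. The $a_0$-inner product on $H_0^1(\Omega)$ is $(z,w)_{a_0(\Omega)}=\int_\Omega\nabla z\cdot\nabla w+Vzw$, with induced norm $\|\cdot\|_{a_0(\Omega)}$. Energy: $E(u)=\int_\Omega\frac12|\nabla u|^2+\frac12V|u|^2+\frac{\beta}{4}|u|^4$ for $u\in H_0^1(\Omega)$. Manifold: $\mathcal{M}=\{u\in H_0^1(\Omega):\|u\|_{L^2(\Omega)}=1\}$. Retraction: $R(u)=u/\|u\|_{L^2(\Omega)}$ for $u\in H_0^1(\Omega)\setminus\{0\}$. Green's operator: for $w\in L^2(\Omega)$, $\mathcal{G}_{a_0}w\in H_0^1(\Omega)$ is the unique element with $(z,\mathcal{G}_{a_0}w)_{a_0(\Omega)}=(z,w)_{L^2(\Omega)}$ for all $z\in H_0^1(\Omega)$. (For $u\in H_0^1(\Omega)$ and $d\le3$, $|u|^2u\in L^2(\Omega)$.) $a_0$-gradient: $\nabla_{a_0}E(u)=u+\beta\mathcal{G}_{a_0}(|u|^2u)$. Riemannian $a_0$-gradient at $u\in\mathcal{M}$: $$\nabla^{\mathcal{R}}_{a_0}E(u)=u+\beta\mathcal{G}_{a_0}(|u|^2u)-\frac{1+\beta(\mathcal{G}_{a_0}(|u|^2u),u)_{L^2(\Omega)}}{\|\mathcal{G}_{a_0}u\|_{a_0(\Omega)}^2}\,\mathcal{G}_{a_0}u.$$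 *)

(* Defs.v *)
From HB Require Import structures.
From mathcomp Require Import all_boot all_order all_algebra.
From mathcomp Require Import all_classical all_reals all_analysis.

Set Implicit Arguments.
Unset Strict Implicit.
Unset Printing Implicit Defensive.

Import Order.TTheory GRing.Theory Num.Theory.
Import numFieldNormedType.Exports.

Local Open Scope classical_set_scope.
Local Open Scope ring_scope.

(* R^d is 'rV[R]_d, with the sigma-algebra generated by the coordinates (the
   Borel sigma-algebra). A class of functions modulo a.e. equality, such as an
   element of L^2, H^1_0 or L^oo, is handled through a Borel representative. *)

Definition rV_display : measure_display.
Proof. exact: default_measure_display. Qed.

Section measurable_rV.
Context (R : realType) (n : nat).

Let coors : 'I_n -> 'rV[R]_n -> R := fun i x => x ord0 i.

Let rV_set0 : g_sigma_preimage coors set0.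
Proof. exact: sigma_algebra0. Qed.

Let rV_setC A : g_sigma_preimage coors A -> g_sigma_preimage coors (~` A).
Proof. exact: sigma_algebraC. Qed.

Let rV_bigcup (F : _^nat) : (forall i, g_sigma_preimage coors (F i)) ->
  g_sigma_preimage coors (\bigcup_i (F i)).
Proof. exact: sigma_algebra_bigcup. Qed.

HB.instance Definition _ := @isMeasurable.Build rV_display
  'rV[R]_n (g_sigma_preimage coors) rV_set0 rV_setC rV_bigcup.

End measurable_rV.

Definition rV_cons (R : realType) (n : nat) (p : R * 'rV[R]_n) : 'rV[R]_n.+1 :=
  row_mx (const_mx p.1 : 'rV_1) p.2.

Lemma rV_cons0 (R : realType) (n : nat) (p : R * 'rV[R]_n) :
  rV_cons p ord0 ord0 = p.1.
Proof.
have -> : @ord0 n = lshift n (@ord0 0) by exact: val_inj.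
by apply: etrans (row_mxEl _ _ _ _) _; rewrite mxE.
Qed.

Lemma rV_consS (R : realType) (n : nat) (p : R * 'rV[R]_n) (i : 'I_n) :
  rV_cons p ord0 (lift ord0 i) = p.2 ord0 i.
Proof.
have -> : lift ord0 i = rshift 1 i by exact: val_inj.
exact: row_mxEr.
Qed.

Lemma measurable_coord (R : realType) (n : nat) (i : 'I_n) :
  measurable_fun [set: 'rV[R]_n] (fun x : 'rV[R]_n => x ord0 i).
Proof.
move=> _ Y mY; rewrite setTI; apply: sub_sigma_algebra => /=.
rewrite -bigcup_seq/=; exists i => /=; first by rewrite mem_index_enum.
by exists Y => //; rewrite setTI.
Qed.

Lemma measurable_fun_rV d (T : measurableType d) (R : realType) (n : nat)
    (f : T -> 'rV[R]_n) :
  (forall i, measurable_fun [set: T] (fun x => f x ord0 i)) ->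
  measurable_fun [set: T] f.
Proof.
move=> mf _ A mA; rewrite setTI.
move: A mA; apply: (@smallest_sub _ _ _ [set B | d.-measurable (f @^-1` B)]).
  split=> [|B mB|F mF] /=.
  - by rewrite preimage_set0.
  - by rewrite setTD preimage_setC; exact: measurableC.
  - by rewrite preimage_bigcup; exact: bigcupT_measurable.
move=> B; rewrite -bigcup_seq/= => -[i _ [C mC <-]].
by rewrite setTI; have := mf i measurableT _ mC; rewrite setTI.
Qed.

Lemma measurable_rV_cons (R : realType) (n : nat) :
  measurable_fun [set: R * 'rV[R]_n] (@rV_cons R n).
Proof.
apply: measurable_fun_rV => i; have [j ->|->] := unliftP ord0 i.
- under eq_fun do rewrite rV_consS.
  apply: (@measurableT_comp _ _ _ _ _ _ (fun x : 'rV[R]_n => x ord0 j)) => //.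
  exact: measurable_coord.
- by under eq_fun do rewrite rV_cons0; exact: measurable_fst.
Qed.

Definition leb_cons (R : realType) (n : nat)
    (m : {measure set 'rV[R]_n -> \bar R}) : set 'rV[R]_n.+1 -> \bar R :=
  pushforward ((@lebesgue_measure R) \x^ m)%E (@rV_cons R n).

HB.instance Definition _ (R : realType) (n : nat)
    (m : {measure set 'rV[R]_n -> \bar R}) :=
  Measure.copy (leb_cons m)
    (measure_function_pushforward__canonical__measure_function_Measure
      ((@lebesgue_measure R) \x^ m)%E (@measurable_rV_cons R n)).

(* d-dimensional Lebesgue measure on the Borel sets, see leb_box. *)
Fixpoint leb (R : realType) (n : nat) : {measure set 'rV[R]_n -> \bar R} :=
  match n return {measure set 'rV[R]_n -> \bar R} with
  | 0 => dirac (0 : 'rV[R]_0)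
  | m.+1 => leb_cons (leb R m)
  end.

Lemma leb_box (R : realType) (n : nat) (A : 'I_n -> set R) :
  (forall i, measurable (A i)) ->
  leb R n [set x | forall i, A i (x ord0 i)] =
  (\prod_(i < n) lebesgue_measure (A i))%E.
Proof.
elim: n A => [|n IH] A mA.
  by rewrite big_ord0 /= diracE mem_set//= => -[].
rewrite big_ord_recl /= /leb_cons /pushforward.
pose B := [set x : 'rV[R]_n | forall i, A (lift ord0 i) (x ord0 i)].
have mB : measurable B.
  rewrite (_ : B = \bigcap_(i in [set: 'I_n])
      ((fun x : 'rV[R]_n => x ord0 i) @^-1` A (lift ord0 i))).
    apply: fin_bigcap_measurable => // i _.
    by rewrite -[X in measurable X]setTI; exact: measurable_coord.
  by apply/seteqP; split => [x Bx i _|x Bx i]; [exact: Bx|exact: (Bx i)].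
rewrite (_ : _ @^-1` _ = A ord0 `*` B); last first.
  apply/seteqP; split => -[a x] /=.
    move=> H; split => [|i]; first by have := H ord0; rewrite rV_cons0.
    by have := H (lift ord0 i); rewrite rV_consS.
  move=> [Aa Bx] i; have [j ->|->] := unliftP ord0 i.
    by rewrite rV_consS; exact: Bx.
  by rewrite rV_cons0.
rewrite product_measure2E; [|exact: mA|exact: mB]; congr (_ * _)%E.
exact: (IH (fun j => A (lift ord0 j)) (fun j => mA (lift ord0 j))).
Qed.

Definition partial (R : realType) (d : nat) (i : 'I_d) (f : 'rV[R]_d -> R) :
    'rV[R]_d -> R :=
  fun x => 'D_(delta_mx ord0 i) f x.

Fixpoint continuously_differentiable (R : realType) (d k : nat)
    (f : 'rV[R]_d -> R) : Prop :=
  match k with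
  | 0 => continuous f
  | k'.+1 => continuous f /\
      forall i : 'I_d, (forall x, derivable f x (delta_mx ord0 i)) /\
        continuously_differentiable k' (partial i f)
  end.

Section function_spaces.
Context (R : realType) (d : nat).
Implicit Types (Omega : set 'rV[R]_d) (u v w z phi : 'rV[R]_d -> R).

(* Near each boundary point, in orthonormal coordinates y = (p - x) Q centred
   at that point, Omega is the strict epigraph over the hyperplane y_j = 0 of a
   Lipschitz function. Balls are those of the sup norm. *)
Definition lipschitz_domain Omega : Prop :=
  [/\ Omega !=set0, open Omega, connected Omega &
    forall x, (closure Omega `\` Omega) x ->
      exists (Q : 'M[R]_d) (j : 'I_d) (psi : 'rV[R]_d.-1 -> R) (r : R),
        [/\ Q *m Q^T = 1%:M, lipschitz psi, 0 < r &
          forall p, ball x r p ->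
            let y := (p - x) *m Q in
            Omega p <-> psi (col' j y) < y ord0 j]].

(* C_c^oo(Omega), each function being extended by zero to R^d. *)
Definition test_function Omega phi : Prop :=
  (forall k, continuously_differentiable k phi) /\
  let supp := closure [set x | phi x != 0] in
  compact supp /\ supp `<=` Omega.

Definition L2 Omega u : Prop := (u \_ Omega) \in Lfun (leb R d) 2%:E.

Definition L2_ip Omega u v : R := \int[leb R d]_(x in Omega) (u x * v x).

Definition L2_norm Omega u : R := Num.sqrt (L2_ip Omega u u).

Definition weak_gradient Omega u (g : 'rV[R]_d -> 'rV[R]_d) : Prop :=
  (forall i, L2 Omega (fun x => g x ord0 i)) /\
  forall phi, test_function Omega phi -> forall i,
    L2_ip Omega u (partial i phi) = - L2_ip Omega (fun x => g x ord0 i) phi.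

(* The weak gradient is unique only up to a.e. equality on Omega; one is chosen. *)
Definition grad Omega u : 'rV[R]_d -> 'rV[R]_d :=
  xget (cst 0) [set g | weak_gradient Omega u g].

Definition dot (a b : 'rV[R]_d) : R := \sum_(i < d) a ord0 i * b ord0 i.

Definition H1 Omega u : Prop := L2 Omega u /\ exists g, weak_gradient Omega u g.

Definition H1_norm Omega u : R :=
  Num.sqrt (\int[leb R d]_(x in Omega)
    (u x ^+ 2 + dot (grad Omega u x) (grad Omega u x))).

(* H^1_0(Omega) is the closure of C_c^oo(Omega) in H^1(Omega). *)
Definition H10 Omega u : Prop :=
  H1 Omega u /\
  exists phi : nat -> 'rV[R]_d -> R,
    (forall k, test_function Omega (phi k)) /\
    (fun k => H1_norm Omega (fun x => u x - phi k x)) @ \oo --> (0 : R).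

Definition H10_norm Omega u : R :=
  Num.sqrt (\int[leb R d]_(x in Omega) dot (grad Omega u x) (grad Omega u x)).

Definition manifold Omega u : Prop := H10 Omega u /\ L2_norm Omega u = 1.

(* Since y / 0 = 0, manifold Omega (retraction Omega u) entails u != 0 in L^2. *)
Definition retraction Omega u : 'rV[R]_d -> R := fun x => u x / L2_norm Omega u.

(* V is in L^oo(Omega) with 0 <= V <= Vmax for some finite Vmax. *)
Definition potential Omega (V : 'rV[R]_d -> R) : Prop :=
  measurable_fun Omega V /\
  exists Vmax : R, {ae leb R d, forall x, Omega x -> 0 <= V x <= Vmax}.

Definition a0_ip Omega V z w : R :=
  \int[leb R d]_(x in Omega)
    (dot (grad Omega z x) (grad Omega w x) + V x * z x * w x).

Definition a0_norm Omega V u : R := Num.sqrt (a0_ip Omega V u u).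

(* As for grad, a representative is chosen; it is shared by all w in the same
   class, since the set below only depends on the class of w. *)
Definition green Omega V w : 'rV[R]_d -> R :=
  xget (cst 0) [set g | H10 Omega g /\
    forall z, H10 Omega z -> a0_ip Omega V z g = L2_ip Omega z w].

Definition energy Omega V (beta : R) u : R :=
  \int[leb R d]_(x in Omega)
    (2^-1 * dot (grad Omega u x) (grad Omega u x) +
     2^-1 * V x * `|u x| ^+ 2 + beta / 4 * `|u x| ^+ 4).

Definition green_cubic Omega V u : 'rV[R]_d -> R :=
  green Omega V (fun x => `|u x| ^+ 2 * u x).

Definition a0_gradient Omega V (beta : R) u : 'rV[R]_d -> R :=
  fun x => u x + beta * green_cubic Omega V u x.

Definition riemannian_gradient Omega V (beta : R) u : 'rV[R]_d -> R :=
  fun x => u x + beta * green_cubic Omega V u x -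
    (1 + beta * L2_ip Omega (green_cubic Omega V u) u) /
      a0_norm Omega V (green Omega V u) ^+ 2 * green Omega V u x.

Fixpoint a0_scheme Omega V (beta : R) (alpha : nat -> R) u0 (n : nat) :
    'rV[R]_d -> R :=
  match n with
  | 0 => u0
  | m.+1 =>
    let um := a0_scheme Omega V beta alpha u0 m in
    retraction Omega
      (fun x => um x - alpha m * riemannian_gradient Omega V beta um x)
  end.

End function_spaces.

(* Main.v *)
From HB Require Import structures.
Require Import Defs.
From mathcomp Require Import all_boot all_order all_algebra.
From mathcomp Require Import all_classical all_reals all_analysis.
From mathcomp Require Import measurable_realfun ring lra.
Set Implicit Arguments.
Unset Strict Implicit.
Unset Printing Implicit Defensive.
Import Order.TTheory GRing.Theory Num.Theory.
Import numFieldNormedType.Exports.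
Local Open Scope classical_set_scope.
Local Open Scope ring_scope.


(** Write [A] for the a0 inner product, [G] for Green's operator, [u] for an
    iterate, [F] for its a0-gradient and [g] for its Riemannian gradient.

    Two facts about the Hilbert space H^1_0 with inner product [A] carry the
    proof: the quartic bound int u^4 <= K A(u,u)^2 ([sobolev_embedding]), and
    the existence of [G u] and [G (u^3)] ([green_L2_spec],
    [green_cubic_spec]).  The second uses the first: the functional
    z |-> int z u^3 is bounded on H^1_0 because
    (int z u^3)^2 <= (int z^2 u^2) (int u^4), so an L^4 bound suffices.

    Given these, the a0-gradient satisfies A(F, G u) = 1 + beta (G(u^3), u),
    so that [g] is the [A]-orthogonal projection of [F] on the complement of
    [G u].  Hence A(g,g) <= A(F,F), A(g,F) = A(g,g), and [g] is orthogonal to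
    [u] in L^2 because (g, u) = A(g, G u).  By Pythagoras the L^2 norm of
    u - t g is then at least 1, so the retraction shrinks it and does not
    increase the energy.  Expanding,

      E(u - t g) <= E(u) - t A(g,g) + t^2/2 A(g,g)
                    + beta/4 t^2 int (8 u^2 g^2 + 3 g^4)    for 0 <= t <= 1,

    and the quartic bound turns the last integral into a multiple of A(g,g)
    whose factor depends only on bounds of A(u,u) and A(F,F).  A small [t]
    leaves a decrease of at least t/2 A(g,g) ([retraction_descent]).  The
    energy therefore decreases along the scheme; it controls A(u,u), which in
    turn controls A(F,F) ([a0_gradient_le]), so that one bound on the step
    size serves all steps.

    The rest of the file builds the analysis.  Weak gradients are unique and
    linear because test functions separate integrable functions
    ([ae_eq0_test]): smooth bumps converge to indicators of boxes, and boxes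
    generate the Borel sets.  Smooth functions have weak gradients by
    Fubini and the fundamental theorem of calculus ([integral_partial],
    [test_ibp]).  The quartic bound is Ladyzhenskaya's: the square of a
    function at one point of a line is bounded by an integral over that line
    ([line_sup]), so the L^2 norm of a slice is bounded uniformly in the slice
    ([slice_sup]), and integrating the bound for slices raises the dimension
    by one ([sobolev_step]).  The same slice bound gives the Poincare
    inequality.  L^2 is complete ([riesz_fischer]), hence so is H^1_0
    ([H10_complete]), and minimizing a quadratic functional gives the Riesz
    representation ([riesz]) from which [G] is obtained ([green_spec]). *)

(** * Borel sets, Lebesgue measure and Fubini on R^n *)

Section euclidean_borel.
Context (R : realType).

Definition obox (n : nat) (a b : 'rV[R]_n) : set 'rV[R]_n :=
  [set x | forall i, a ord0 i < x ord0 i < b ord0 i].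

Definition cbox (n : nat) (a b : 'rV[R]_n) : set 'rV[R]_n :=
  [set x | forall i, a ord0 i <= x ord0 i <= b ord0 i].

Lemma measurable_coord_box (n : nat) (A : 'I_n -> set R) :
  (forall i, measurable (A i)) ->
  measurable [set x : 'rV[R]_n | forall i, A i (x ord0 i)].
Proof.
move=> mA; rewrite (_ : [set x | _] = \bigcap_(i in [set: 'I_n])
    ((fun x : 'rV[R]_n => x ord0 i) @^-1` A i)).
  apply: fin_bigcap_measurable => // i _.
  by rewrite -[X in measurable X]setTI; exact: measurable_coord.
by apply/seteqP; split => [x Bx i _|x Bx i]; [exact: Bx|exact: (Bx i)].
Qed.

Lemma oboxE (n : nat) (a b : 'rV[R]_n) :
  obox a b = [set x | forall i, `]a ord0 i, b ord0 i[%classic (x ord0 i)].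
Proof.
by apply/seteqP; split => x /= xab i; have := xab i; rewrite /= in_itv.
Qed.

Lemma measurable_obox (n : nat) (a b : 'rV[R]_n) : measurable (obox a b).
Proof.
rewrite oboxE.
apply: (@measurable_coord_box n (fun i => `]a ord0 i, b ord0 i[%classic)) => i.
exact: measurable_itv.
Qed.

Lemma leb_obox_lty (n : nat) (a b : 'rV[R]_n) : (leb R n (obox a b) < +oo)%E.
Proof.
rewrite oboxE (leb_box (A := fun i => `]a ord0 i, b ord0 i[%classic))//.
suff : (\prod_(i < n) lebesgue_measure `]a ord0 i, b ord0 i[%classic)%E
    \is a fin_num.
  by rewrite fin_numElt => /andP[].
apply: prode_fin_num => i _; rewrite lebesgue_measure_itv/= lte_fin.
by case: ifPn.
Qed.

Lemma rV_ballP (n : nat) (x y : 'rV[R]_n) (e : R) : 0 < e ->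
  ball x e y <-> forall i, `|x ord0 i - y ord0 i| < e.
Proof.
move=> e0; split => [[_ xy] i|xy]; first exact: xy.
by split=> // i j; rewrite (ord1 i); exact: xy.
Qed.

(** Boxes with rational vertices are countable and fit between a point and
    any neighbourhood of it. That the closed boxes stay inside [U] is what
    later allows bumps supported in them as test functions on [U]. *)
Lemma open_box_cover (n : nat) (U : set 'rV[R]_n) : open U ->
  exists (I : set nat) (a b : nat -> 'rV[R]_n),
    (forall k, I k -> cbox (a k) (b k) `<=` U) /\
    U = \bigcup_(k in I) obox (a k) (b k).
Proof.
move=> oU.
pose c (k : nat) : option ('rV[rat]_n * 'rV[rat]_n) := unpickle k.
pose a (k : nat) : 'rV[R]_n := if c k is Some p then map_mx ratr p.1 else 0.
pose b (k : nat) : 'rV[R]_n := if c k is Some p then map_mx ratr p.2 else 0.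
pose I := [set k | cbox (a k) (b k) `<=` U].
exists I, a, b; split => //; apply/seteqP; split => x; last first.
  move=> [k Ik xk]; apply: Ik => i; have /andP[/ltW -> /ltW ->] := xk i.
  by [].
move=> Ux; have /nbhs_ballP[e /= e0 xeU] : nbhs x U by exact: open_nbhs_nbhs.
have aP i : exists q : rat, x ord0 i - e < ratr q < x ord0 i.
  have [|q] := @rat_in_itvoo R (x ord0 i - e) (x ord0 i).
    by rewrite ltrBlDr ltrDl.
  by rewrite in_itv/= => qx; exists q.
have bP i : exists q : rat, x ord0 i < ratr q < x ord0 i + e.
  have [|q] := @rat_in_itvoo R (x ord0 i) (x ord0 i + e).
    by rewrite ltrDl.
  by rewrite in_itv/= => qx; exists q.
have /choice[p pP] := aP; have /choice[q qP] := bP.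
pose k := pickle (\row_i p i : 'rV[rat]_n, \row_i q i : 'rV[rat]_n).
have ak i : a k ord0 i = ratr (p i) by rewrite /a /c pickleK !mxE.
have bk i : b k ord0 i = ratr (q i) by rewrite /b /c pickleK !mxE.
exists k => [|i].
  move=> y yab; apply: xeU; apply/rV_ballP => // i.
  have := yab i; rewrite ak bk => /andP[py yq].
  have /andP[xp _] := pP i; have /andP[_ xq] := qP i.
  by rewrite ltr_norml; apply/andP; split; lra.
by rewrite ak bk; have /andP[_ ->] := pP i; have /andP[-> _] := qP i.
Qed.

Lemma open_measurable_rV (n : nat) (U : set 'rV[R]_n) : open U -> measurable U.
Proof.
move=> /open_box_cover[I [a [b [_ ->]]]].
by apply: bigcup_measurable => k _; exact: measurable_obox.
Qed.

Lemma continuous_measurable_rV (n : nat) (f : 'rV[R]_n -> R) :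
  continuous f -> measurable_fun [set: 'rV[R]_n] f.
Proof.
move=> /continuousP cf.
apply: (measurability _ (RGenOpens.measurableE R)).
move=> _ [_ [a [b ->] <-]]; rewrite setTI; apply: open_measurable_rV.
exact/cf/interval_open.
Qed.

Lemma leb_sigma_finite (n : nat) : sigma_finite [set: 'rV[R]_n] (leb R n).
Proof.
exists (fun k => obox (const_mx (- k%:R)) (const_mx k%:R)).
  apply/seteqP; split => // x _.
  pose k := (Num.truncn `|x|).+1; exists k => // i.
  rewrite !mxE -ltr_norml (le_lt_trans (y := `|x|))//; last exact: truncnS_gt.
  rewrite [X in _ <= X]mx_normrE (le_bigmax _ (fun j => `|x j.1 j.2|) (ord0, i))//.
move=> k; split; first exact: measurable_obox.
exact: leb_obox_lty.
Qed.

(** The measure [leb R n] is the value of a fixpoint, to which canonical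
    structures cannot be attached; this constant carries its sigma-
    finiteness. *)
Definition leb_sfin (n : nat) : set 'rV[R]_n -> \bar R := leb R n.

HB.instance Definition _ (n : nat) := Measure.copy (@leb_sfin n) (leb R n).

HB.instance Definition _ (n : nat) :=
  @Measure_isSigmaFinite.Build _ _ _ (@leb_sfin n) (leb_sigma_finite n).

Local Open Scope ereal_scope.

(** By construction [leb R n.+1] is the image of a product measure under the
    map that prepends a coordinate. *)
Lemma leb_tonelli (n : nat) (f : 'rV[R]_n.+1 -> \bar R) :
  measurable_fun setT f -> (forall x, 0 <= f x) ->
  \int[leb R n.+1]_x f x =
  \int[lebesgue_measure]_t \int[leb R n]_y f (rV_cons (t, y)).
Proof.
move=> mf f0.
have mc := @measurable_rV_cons R n.
have mfc : measurable_fun setT (f \o @rV_cons R n) by exact: measurableT_comp.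
transitivity (\int[lebesgue_measure \x^ @leb_sfin n]_z f (rV_cons z)).
  by rewrite /= ge0_integral_pushforward.
transitivity (\int[lebesgue_measure \x @leb_sfin n]_z f (rV_cons z)).
  apply: eq_measure_integral => //= A mA _.
  by apply/esym; apply: product_measure_unique => // B C mB mC/=; rewrite product_measure2E.
by apply: (@fubini_tonelli1 _ _ _ _ _ lebesgue_measure (@leb_sfin n) (f \o @rV_cons R n)) => // x; exact: f0.
Qed.

Lemma leb_tonelli_swap (n : nat) (f : 'rV[R]_n.+1 -> \bar R) :
  measurable_fun setT f -> (forall x, 0 <= f x) ->
  \int[leb R n.+1]_x f x =
  \int[leb R n]_y \int[lebesgue_measure]_t f (rV_cons (t, y)).
Proof.
move=> mf f0; rewrite leb_tonelli//.
have mc := @measurable_rV_cons R n.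
have mfc : measurable_fun setT (f \o @rV_cons R n) by exact: measurableT_comp.
by apply: (@fubini_tonelli _ _ _ _ _ lebesgue_measure (@leb_sfin n) (f \o @rV_cons R n)) => // x; exact: f0.
Qed.

Lemma measurable_slice_integral (n : nat) (f : 'rV[R]_n.+1 -> \bar R) :
  measurable_fun setT f -> (forall x, 0 <= f x) ->
  measurable_fun setT (fun t => \int[leb R n]_y f (rV_cons (t, y))).
Proof.
move=> mf f0; have mc := @measurable_rV_cons R n.
have mfc : measurable_fun setT (f \o @rV_cons R n) by exact: measurableT_comp.
by apply: (@measurable_fun_fubini_tonelli_F _ _ _ _ _ (@leb_sfin n) (f \o @rV_cons R n)) => // x; exact: f0.
Qed.

Lemma measurable_line_integral (n : nat) (f : 'rV[R]_n.+1 -> \bar R) :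
  measurable_fun setT f -> (forall x, 0 <= f x) ->
  measurable_fun setT (fun y => \int[lebesgue_measure]_t f (rV_cons (t, y))).
Proof.
move=> mf f0; have mc := @measurable_rV_cons R n.
have mfc : measurable_fun setT (f \o @rV_cons R n) by exact: measurableT_comp.
by apply: (@measurable_fun_fubini_tonelli_G _ _ _ _ _ lebesgue_measure (f \o @rV_cons R n)) => // x; exact: f0.
Qed.

Lemma leb_fubini (n : nat) (f : 'rV[R]_n.+1 -> R) :
  (leb R n.+1).-integrable setT (EFin \o f) ->
  \int[leb R n.+1]_x (f x)%:E =
    \int[lebesgue_measure]_t \int[leb R n]_y (f (rV_cons (t, y)))%:E /\
  \int[leb R n.+1]_x (f x)%:E =
    \int[leb R n]_y \int[lebesgue_measure]_t (f (rV_cons (t, y)))%:E.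
Proof.
move=> intf.
have mf := measurable_int _ intf.
have mc := @measurable_rV_cons R n.
have mfc : measurable_fun setT ((EFin \o f) \o @rV_cons R n).
  exact: measurableT_comp.
have ifc : (lebesgue_measure \x @leb_sfin n).-integrable setT
    ((EFin \o f) \o @rV_cons R n).
  apply: (@integrable12ltyP _ _ _ _ _ lebesgue_measure (@leb_sfin n) _ mfc).2.
  have /integrableP[_] := intf; rewrite leb_tonelli//.
  exact: measurableT_comp.
have pE : \int[leb R n.+1]_x (f x)%:E =
    \int[lebesgue_measure \x^ @leb_sfin n]_z (f (rV_cons z))%:E.
  rewrite /= integral_pushforward//.
  apply/integrableP; split => //.
  have /integrableP[_] := intf.
  rewrite /= ge0_integral_pushforward//.
  exact: (measurable_int _ (integrable_abse intf)).
by rewrite pE; split; [rewrite -(integral12_prod_meas2 ifc)|rewrite -(integral21_prod_meas2 ifc)].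
Qed.

End euclidean_borel.

(** * Smooth functions of one variable *)

Section smooth_real.
Context (R : realType).
Implicit Types (f g : R -> R).

Fixpoint smooth (n : nat) f : Prop :=
  match n with
  | 0 => continuous f
  | m.+1 => exists2 g : R -> R, (forall x : R, is_derive x 1 f (g x)) & smooth m g
  end.

Lemma is_derive_continuous f (g : R -> R) :
  (forall x : R, is_derive x 1 f (g x)) -> continuous f.
Proof.
move=> fg x; apply/differentiable_continuous/derivable1_diffP.
exact: (@ex_derive _ _ _ _ _ _ _ (fg x)).
Qed.

Lemma smoothS n f : smooth n.+1 f -> smooth n f.
Proof.
elim: n f => [|n IH] f [g fg sg]; first exact: (is_derive_continuous fg).
by exists g => //; exact: IH.
Qed.

Lemma smooth_continuous n f : smooth n f -> continuous f.
Proof. by elim: n f => // n IH f /smoothS/IH. Qed.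

Lemma smoothD n f g : smooth n f -> smooth n g -> smooth n (f + g).
Proof.
elim: n f g => [|n IH] f g /=; first by move=> cf cg x; apply: continuousD; [exact: cf|exact: cg].
move=> [f' ff' sf'] [g' gg' sg']; exists (f' + g'); last exact: IH.
by move=> x; exact: is_deriveD.
Qed.

Lemma smoothZ n f (c : R) : smooth n f -> smooth n (c \*: f).
Proof.
elim: n f => [|n IH] f /=; first by move=> cf x; apply: continuousZl_tmp; exact: cf.
move=> [f' ff' sf']; exists (c \*: f'); last exact: IH.
by move=> x; exact: is_deriveZ.
Qed.

Lemma smoothM n f g : smooth n f -> smooth n g -> smooth n (f * g).
Proof.
elim: n f g => [|n IH] f g /=; first by move=> cf cg x; apply: continuousM; [exact: cf|exact: cg].
move=> sf sg; have := sf; have := sg.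
move=> [g' gg' sg'] [f' ff' sf']; exists (f * g' + g * f').
  by move=> x; exact: is_deriveM.
by apply: smoothD; apply: IH => //; exact: smoothS.
Qed.

Lemma smooth_affine n f (c d : R) : smooth n f ->
  smooth n (fun x => f (c * x + d)).
Proof.
have ca (x : R) : is_derive x 1 (fun x => c * x + d) c.
  apply: is_derive_eq.
  by rewrite addr0 /GRing.scale/= mulr1.
elim: n f => [|n IH] f /=.
  move=> cf x; apply: continuous_comp; last exact: cf.
  exact: (is_derive_continuous ca).
move=> [f' ff' sf']; exists (c \*: (fun x => f' (c * x + d))).
  move=> x; apply: (is_derive_eq (@is_derive1_comp _ f _ x _ _ (ff' _) (ca x))).
  by rewrite mulrC.
by apply: smoothZ; exact: IH.
Qed.

(** The case k = 0 is the classical smooth function that vanishes on the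
    negative axis. The powers of 1/x are there because the derivative of the
    k-th function is a combination of the (k+1)-st and the (k+2)-nd, so that
    all derivatives stay in the family. *)
Definition flat (k : nat) (x : R) : R :=
  if 0 < x then x ^- k * expR (- x^-1) else 0.

Lemma flat_ge0 k x : 0 <= flat k x.
Proof.
by rewrite /flat; case: ifP => // x0; rewrite mulr_ge0 ?expR_ge0// invr_ge0 exprn_ge0 ?ltW.
Qed.

(** At x = 1/y this is y^(k+2) <= (k+2)! exp y, a term of the exponential
    series. The factor x^2 is what makes the derivative at 0 exist and
    vanish. *)
Lemma flat_le k x : flat k x <= (k.+2)`!%:R * x ^+ 2.
Proof.
rewrite /flat; case: ifP => [x0|_]; last by rewrite mulr_ge0 ?sqr_ge0.
have y0 : 0 < x^-1 by rewrite invr_gt0.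
have := expR_ge1Dxn k.+1 (ltW y0) => h.
have h2 : x ^- k.+2 <= (k.+2)`!%:R * expR (x^-1).
  rewrite -ler_pdivrMl ?ltr0n ?fact_gt0// mulrC -exprVn.
  by apply: le_trans h; rewrite lerDr.
rewrite expRN ler_pdivrMr ?expR_gt0//.
rewrite -mulrA [x ^+ 2 * _]mulrC mulrA -ler_pdivrMr ?exprn_gt0//.
apply: le_trans h2.
by rewrite -invfM -exprD addn2.
Qed.

Lemma is_derive_flat k (x : R) :
  is_derive x 1 (flat k) (flat k.+2 x - k%:R * flat k.+1 x).
Proof.
have [x0|x0|->] := ltgtP x 0.
- have -> : flat k.+2 x - k%:R * flat k.+1 x = 0.
    by rewrite /flat ltNge ltW// mulr0 subr0.
  apply: (@near_eq_is_derive _ _ _ (cst 0)) => //.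
  near=> y; rewrite /flat ltNge; have -> : y <= 0; last by [].
  by apply/ltW; near: y; exact: lt_nbhsl.
- have ix : x != 0 by rewrite gt_eqF.
  pose h : R -> R := (fun y => (y ^+ k)^-1) * (fun y => expR (- y^-1)).
  apply: (@near_eq_is_derive _ _ _ h) => //.
    near=> y; rewrite /flat /h; have -> : 0 < y; last by [].
    by near: y; exact: lt_nbhsr.
  rewrite /flat x0.
  have d1 : is_derive x 1 (fun y : R => y^-1) (- x ^- 2).
    by apply: is_derive_eq; [exact: is_deriveV|rewrite /GRing.scale/= mulr1].
  have d2 : is_derive x 1 (fun y : R => expR (- y^-1)) (expR (- x^-1) * x ^- 2).
    apply: (is_derive_eq (@is_derive1_comp _ expR _ x _ _ (is_derive_expR _) (is_deriveN d1))).
    by rewrite opprK.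
  have d3 : is_derive x 1 (fun y : R => (y ^+ k)^-1) (- (x ^+ k) ^- 2 * (k%:R * x ^+ k.-1)).
    have dk : is_derive x 1 (fun y : R => y ^+ k) (k%:R * x ^+ k.-1).
      split; first exact: exprn_derivable.
      by rewrite exp_derive /GRing.scale/= mulr1.
    have xk : (fun y : R => y ^+ k) x != 0 by rewrite /= expf_neq0.
    exact: (@is_deriveV _ (fun y : R => y ^+ k) x _ 1 xk dk).
  have d4 := @is_deriveM _ _ _ _ _ _ _ _ d3 d2. apply: is_derive_eq.
  rewrite /GRing.scale/=; case: k {h d3 d4} => [|k] /=.
    by rewrite !mul0r subr0 !expr0 mulr0 mulr0 addr0 invr1 !mul1r mulrC.
  rewrite !exprS; field.
  by rewrite ix expf_neq0.
- have -> : flat k.+2 0 - k%:R * flat k.+1 0 = 0.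
    by rewrite /flat ltxx mulr0 subr0.
  suff H : (fun h : R => h^-1 *: ((flat k \o shift 0) (h *: 1) - flat k 0)) @ 0^' --> (0 : R).
    by apply: DeriveDef; [apply/cvg_ex; exists 0|exact: cvg_lim].
  rewrite (_ : (fun _ => _) = fun h : R => h^-1 * flat k h); last first.
    apply/funext => h /=; rewrite /GRing.scale/= mulr1 addr0.
    by rewrite [flat k 0]/flat ltxx subr0.
  have n0 : (fun h : R => `|h|) @ 0^' --> (0 : R).
    apply/cvgrPdist_lt => e e0; near=> h; rewrite sub0r normrN normr_id.
    by near: h; apply: nbhs_dnbhs; exists e => //= y /=; rewrite sub0r normrN.
  apply: (@squeeze_cvgr _ _ _ _ (fun h : R => - ((k.+2)`!%:R * `|h|))
    (fun h : R => (k.+2)`!%:R * `|h|)).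
  + near=> h; rewrite -ler_norml normrM normfV (ger0_norm (flat_ge0 _ _)).
    have h0 : 0 < `|h| by rewrite normr_gt0; near: h; exact: nbhs_dnbhs_neq.
    rewrite ler_pdivrMl// mulrC -mulrA.
    by rewrite -expr2 -normrX ger0_norm ?sqr_ge0// flat_le.
  + have := @cvgN _ _ _ _ _ _ _ (@cvgMl_tmp _ _ _ _ _ (k.+2)`!%:R _ n0).
    by rewrite mulr0 oppr0; exact.
  + by have := @cvgMl_tmp _ _ _ _ _ (k.+2)`!%:R _ n0; rewrite mulr0; exact.
Unshelve. all: by end_near. Qed.

Lemma smooth_flat n k : smooth n (flat k).
Proof.
elim: n k => [|n IH] k /=.
  exact: (is_derive_continuous (is_derive_flat k)).
exists (flat k.+2 + (- k%:R) \*: flat k.+1) => [x|].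
  by apply: is_derive_eq; [exact: is_derive_flat|rewrite -mulNr].
by apply: smoothD => //; exact: smoothZ.
Qed.

End smooth_real.

(** * Smooth bumps on boxes *)

Section test_functions.
Context (R : realType).

(** A directional derivative only sees the restriction to a line; the two
    lemmas transfer derivatives between a function of several variables and
    its restriction. *)
Section derivative_along_a_line.
Context (d : nat) (i : 'I_d) (f : 'rV[R]_d -> R) (x : 'rV[R]_d) (g : R -> R) (s : R).
Hypothesis fg : forall t, f (t *: delta_mx ord0 i + x) = g (t + s).

Let growth_rateE :
  (fun h : R => h^-1 *: ((f \o shift x) (h *: delta_mx ord0 i) - f x)) =
  (fun h : R => h^-1 *: ((g \o shift s) (h *: 1) - g s)).
Proof.
apply/funext => h /=; rewrite fg.
have -> : f x = g s by have := fg 0; rewrite scale0r !add0r.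
by rewrite /GRing.scale/= mulr1.
Qed.

Lemma is_derive_line (l : R) : is_derive s 1 g l -> is_derive x (delta_mx ord0 i) f l.
Proof.
by move=> [dg gl]; split; [rewrite /derivable growth_rateE|rewrite /derive growth_rateE -gl].
Qed.

Lemma line_is_derive (l : R) : is_derive x (delta_mx ord0 i) f l -> is_derive s 1 g l.
Proof.
by move=> [dg gl]; split; [rewrite /derivable -growth_rateE|rewrite /derive -growth_rateE -gl].
Qed.

End derivative_along_a_line.

Definition tensor (d : nat) (h : 'I_d -> R -> R) (x : 'rV[R]_d) : R :=
  \prod_(j < d) h j (x ord0 j).

Lemma tensor_continuous (d : nat) (h : 'I_d -> R -> R) :
  (forall j, continuous (h j)) -> continuous (tensor h).
Proof.
move=> ch; rewrite (_ : tensor h = \prod_(j < d) (fun x : 'rV[R]_d => h j (x ord0 j))).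
  elim/big_ind : _ => [|f g cf cg x|j _ x].
  - by move=> x; exact: (@cst_continuous _ _ (1 : R)).
  - by apply: continuousM; [exact: cf|exact: cg].
  - apply: (@continuous_comp _ _ _ (fun x : 'rV[R]_d => x ord0 j) (h j)).
      exact: coord_continuous.
    exact: ch.
by apply/funext => x; rewrite /tensor fct_prodE.
Qed.

Lemma is_derive_tensor (d : nat) (h : 'I_d -> R -> R) (i : 'I_d) (dh : R -> R)
    (x : 'rV[R]_d) :
  (forall t : R, is_derive t 1 (h i) (dh t)) ->
  is_derive x (delta_mx ord0 i) (tensor h)
    (tensor (fun j => if j == i then dh else h j) x).
Proof.
move=> hi; pose c := \prod_(j < d | j != i) h j (x ord0 j).
apply: (@is_derive_line _ i _ x (c \*: h i) (x ord0 i)).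
  move=> t; rewrite /tensor (bigD1 i)//= !mxE !eqxx mulr1 mulrC; congr (_ * _).
  apply: eq_bigr => j ji; rewrite !mxE (negbTE ji) andbF mulr0 add0r//.
apply: (is_derive_eq (is_deriveZ c (hi (x ord0 i)))).
rewrite /tensor (bigD1 i)//= eqxx mulrC; congr (_ * _).
by apply: eq_bigr => j ji; rewrite (negbTE ji).
Qed.

(** Differentiating a product of functions of one variable each along a
    coordinate replaces one factor by its derivative, so products of this
    form are closed under partial derivatives. *)
Lemma tensor_continuously_differentiable (d k : nat) (h : 'I_d -> R -> R) :
  (forall j, smooth k (h j)) -> continuously_differentiable k (tensor h).
Proof.
elim: k h => [|k IH] h sh /=.
  by apply: tensor_continuous => j; exact: smooth_continuous (sh j).
split; first by apply: tensor_continuous => j; exact: smooth_continuous (sh j).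
move=> i; have [dh hdh sdh] := sh i; split.
  by move=> x; apply: (@ex_derive _ _ _ _ _ _ _ (is_derive_tensor x hdh)).
rewrite (_ : partial i _ = tensor (fun j => if j == i then dh else h j)).
  by apply: IH => j; case: ifPn => // _; exact: smoothS.
apply/funext => x; rewrite /partial.
exact: (@derive_val _ _ _ _ _ _ _ (is_derive_tensor x hdh)).
Qed.

(** Scaling the argument of [flat 0] by k+1 makes it tend to 1 at each
    positive point, so that the bumps increase to the indicator of the open
    interval. *)
Definition bump (k : nat) (a b t : R) : R :=
  flat 0 (k.+1%:R * t - k.+1%:R * a) * flat 0 (k.+1%:R * b - k.+1%:R * t).

Lemma smooth_bump n k a b : smooth n (bump k a b).
Proof.
rewrite (_ : bump k a b = (fun t => flat 0 (k.+1%:R * t + - (k.+1%:R * a))) *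
   (fun t => flat 0 (- k.+1%:R * t + (k.+1%:R * b)))).
  by apply: smoothM; apply: smooth_affine; exact: smooth_flat.
apply/funext => t; rewrite /bump.
by have -> : k.+1%:R * b - k.+1%:R * t = - k.+1%:R * t + k.+1%:R * b by ring.
Qed.

Lemma flat01 (x : R) : 0 <= flat 0 x <= 1.
Proof.
rewrite flat_ge0 /flat; case: ifP => [x0|_]; last by rewrite ler01.
by rewrite expr0 invr1 mul1r -expR0 ler_expR oppr_le0 invr_ge0 ltW.
Qed.

Lemma bump01 k a b t : 0 <= bump k a b t <= 1.
Proof.
rewrite /bump; have /andP[u0 u1] := flat01 (k.+1%:R * t - k.+1%:R * a).
have /andP[v0 v1] := flat01 (k.+1%:R * b - k.+1%:R * t).
by rewrite mulr_ge0//= mulr_ile1.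
Qed.

Lemma bump_neq0 k a b t : bump k a b t != 0 -> a < t < b.
Proof.
rewrite /bump mulf_eq0 negb_or /flat => /andP[].
case: ifP; rewrite ?eqxx// subr_gt0 ltr_pM2l// => -> _.
by case: ifP; rewrite ?eqxx// subr_gt0 ltr_pM2l// => -> _.
Qed.

Lemma flat_cvg (s : R) : 0 < s -> (fun k => flat 0 (k.+1%:R * s)) @ \oo --> (1 : R).
Proof.
move=> s0.
rewrite (_ : (fun _ => _) = (fun k : nat => expR (- (k.+1%:R^-1 * s^-1)))); last first.
  by apply/funext => k; rewrite /flat mulr_gt0// expr0 invr1 mul1r invfM.
suff : (fun k : nat => expR (- (k.+1%:R^-1 * s^-1))) @ \oo --> expR (0 : R).
  by rewrite expR0.
apply: continuous_cvg; first exact: continuous_expR.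
have h : (fun k : nat => - (k.+1%:R^-1 * s^-1)) @ \oo --> - (0 * s^-1 : R).
  by apply: cvgN; apply: cvgMr_tmp; exact: cvg_harmonic.
by move: h; rewrite mul0r oppr0; exact.
Qed.

Lemma bump_cvg (a b t : R) :
  (fun k => bump k a b t) @ \oo --> ((a < t < b)%R%:R : R).
Proof.
have [/andP[ta tb]|tab] := boolP (a < t < b).
  rewrite -[1%:R]mulr1; apply: cvgM.
    under eq_fun do rewrite -mulrBr.
    by apply: flat_cvg; rewrite subr_gt0.
  under eq_fun do rewrite -mulrBr.
  by apply: flat_cvg; rewrite subr_gt0.
rewrite (_ : (fun _ => _) = cst 0); first exact: cvg_cst.
apply/funext => k /=; apply/eqP; apply: contraNT tab; exact: bump_neq0.
Qed.

Definition box_bump (d k : nat) (a b : 'rV[R]_d) : 'rV[R]_d -> R :=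
  tensor (fun j => bump k (a ord0 j) (b ord0 j)).

Lemma cbox_compact (d : nat) (a b : 'rV[R]_d) : compact (cbox a b).
Proof.
rewrite (_ : cbox a b = [set v | forall i, `[a ord0 i, b ord0 i]%classic (v ord0 i)]).
  by apply: (@rV_compact _ _ (fun i => `[a ord0 i, b ord0 i]%classic)) => i; exact: segment_compact.
by apply/seteqP; split => x /= xab i; have := xab i; rewrite in_itv.
Qed.

Lemma cbox_closed (d : nat) (a b : 'rV[R]_d) : closed (cbox a b).
Proof. by apply: compact_closed; [exact: norm_hausdorff|exact: cbox_compact]. Qed.

Lemma box_bump_test (d k : nat) (Omega : set 'rV[R]_d) (a b : 'rV[R]_d) :
  cbox a b `<=` Omega -> test_function Omega (box_bump k a b).
Proof.
move=> abO; split => [n|].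
  by apply: tensor_continuously_differentiable => j; exact: smooth_bump.
have sab : closure [set x | box_bump k a b x != 0] `<=` cbox a b.
  have /closure_id -> := @cbox_closed _ a b.
  apply: closureS => x /= /prodf_neq0 x0 i.
  by have /bump_neq0/andP[/ltW -> /ltW ->] := x0 i isT.
split; last exact: subset_trans sab abO.
by apply: subclosed_compact sab; [exact: closed_closure|exact: cbox_compact].
Qed.

Lemma box_bump01 (d k : nat) (a b x : 'rV[R]_d) : 0 <= box_bump k a b x <= 1.
Proof.
rewrite /box_bump /tensor; apply/andP; split.
  by apply: prodr_ge0 => j _; case/andP : (bump01 k (a ord0 j) (b ord0 j) (x ord0 j)).
by apply: prodr_ile1 => j _; exact: bump01.
Qed.

Lemma box_bump_cvg (d : nat) (a b x : 'rV[R]_d) :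
  (fun k => box_bump k a b x) @ \oo --> (\1_(obox a b) x : R).
Proof.
have -> : \1_(obox a b) x = \prod_(j < d) (a ord0 j < x ord0 j < b ord0 j)%R%:R :> R.
  rewrite indicE; have [xab|xab] := pselect (obox a b x).
    by rewrite mem_set// big1// => j _; rewrite (xab j).
  rewrite memNset//; move/existsNP : xab => [j /negP jN].
  by rewrite (bigD1 j)//= (negbTE jN) mul0r.
apply: cvg_big => // [|j _]; last exact: bump_cvg.
exact: mul_continuous.
Qed.

End test_functions.

(** * The fundamental lemma of the calculus of variations *)

Section fundamental_lemma.
Context (R : realType) (d : nat).
Notation mu := (leb R d).

Lemma obox_setI (a b p q : 'rV[R]_d) :
  obox p q `&` obox a b =
  obox (\row_i Num.max (p ord0 i) (a ord0 i)) (\row_i Num.min (q ord0 i) (b ord0 i)).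
Proof.
apply/seteqP; split => x.
  move=> [xpq xab] i; rewrite !mxE gt_max lt_min.
  by have /andP[-> ->] := xpq i; have /andP[-> ->] := xab i.
move=> xI; split=> i; have := xI i; rewrite !mxE gt_max lt_min.
  by move=> /andP[/andP[-> _] /andP[-> _]].
by move=> /andP[/andP[_ ->] /andP[_ ->]].
Qed.

Definition oboxes : set_system 'rV[R]_d := [set A | exists a b, A = obox a b].

Lemma setI_closed_oboxes : setI_closed oboxes.
Proof.
by move=> _ _ [p [q ->]] [a [b ->]]; rewrite obox_setI; eexists; eexists.
Qed.

Lemma measurable_oboxes : @measurable _ 'rV[R]_d = <<s oboxes >>.
Proof.
apply/seteqP; split; last first.
  apply: smallest_sub; first exact: sigma_algebra_measurable.
  by move=> _ [a [b ->]]; exact: measurable_obox.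
apply: smallest_sub; first exact: smallest_sigma_algebra.
move=> A; rewrite -bigcup_seq/= => -[i _ [B mB <-]]; rewrite setTI.
have sO : sigma_algebra setT <<s oboxes >> by exact: smallest_sigma_algebra.
have : (@RGenOpens.G R).-sigma.-measurable B by rewrite -RGenOpens.measurableE.
apply: (@smallest_sub _ _ _
  [set B | <<s oboxes >> ((fun x : 'rV[R]_d => x ord0 i) @^-1` B)]).
  split => [|C /= mC|F mF] /=.
  - by rewrite preimage_set0; exact: sigma_algebra0.
  - by rewrite setTD preimage_setC -setTD; exact: sigma_algebraCD.
  - by rewrite preimage_bigcup; exact: sigma_algebra_bigcup.
move=> _ [s [t ->]] /=.
have /open_box_cover[I [a [b [_ ->]]]] :
    open ((fun x : 'rV[R]_d => x ord0 i) @^-1` `]s, t[%classic).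
  have /continuousP : continuous (fun x : 'rV[R]_d => x ord0 i) by exact: coord_continuous.
  by apply; exact: interval_open.
rewrite bigcup_mkcond; apply: sigma_algebra_bigcup => k.
case: ifP => _; last exact: sigma_algebra0.
by apply: sub_sigma_algebra; eexists; eexists.
Qed.

(** Test [h] against bumps that converge to the indicator of the box,
    dominated by 1; the closed box must lie in [Omega] for the bumps to be
    supported there. *)
Lemma integral_obox_eq0 (Omega : set 'rV[R]_d) (h : 'rV[R]_d -> R) (a b : 'rV[R]_d) :
  open Omega -> mu.-integrable Omega (EFin \o h) ->
  (forall phi, test_function Omega phi -> L2_ip Omega h phi = 0) ->
  cbox a b `<=` Omega ->
  (\int[mu]_(x in obox a b) (h x)%:E = 0)%E.
Proof.
move=> oO ih h0 abO.
have mO : measurable Omega by exact: open_measurable_rV.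
have mh : measurable_fun Omega h.
  by apply/measurable_EFinP; exact: measurable_int ih.
have mb k : measurable_fun Omega (box_bump k a b).
  apply: measurable_funTS; apply: continuous_measurable_rV.
  by apply: tensor_continuous => j; exact: smooth_continuous (smooth_bump 0 _ _ _).
have oab : obox a b `<=` Omega.
  by move=> x xab; apply: abO => i; have /andP[/ltW -> /ltW ->] := xab i.
pose f (k : nat) x := (h x * box_bump k a b x)%:E.
have f0 k : (\int[mu]_(x in Omega) f k x = 0)%E.
  have := h0 _ (box_bump_test k abO); rewrite /L2_ip /Rintegral => H.
  rewrite -[LHS]fineK ?H//.
  apply: integrable_fin_num => //; apply: (le_integrable mO _ _ ih).
    by apply/measurable_EFinP; exact: measurable_funM.
  move=> x Ox; rewrite /f /= lee_fin normrM ler_piMr//.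
  by have /andP[u0 u1] := box_bump01 k a b x; rewrite ger0_norm.
have [_ _ cvf] : [/\ mu.-integrable Omega (fun x => (h x * \1_(obox a b) x)%:E),
    [sequence \int[mu]_(x in Omega) `|f n x - (h x * \1_(obox a b) x)%:E|]_n @ \oo --> 0 &
    [sequence \int[mu]_(x in Omega) f n x]_n @ \oo -->
      \int[mu]_(x in Omega) (h x * \1_(obox a b) x)%:E]%E.
  apply: (@dominated_convergence _ _ _ mu Omega mO f _ (fun x => `|h x|%:E)) => //.
  - by move=> k; apply/measurable_EFinP; exact: measurable_funM.
  - apply/measurable_EFinP; apply: measurable_funM => //.
    by apply: measurable_indic; exact: measurable_obox.
  - apply/aeW => x Ox; apply: cvg_EFin.
      by apply/nearW => k.
    by apply: cvgMl_tmp; exact: box_bump_cvg.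
  - exact: integrable_norm.
  - apply/aeW => x k Ox; rewrite /f /= lee_fin normrM ler_piMr//.
    by have /andP[u0 u1] := box_bump01 k a b x; rewrite ger0_norm.
have -> : (\int[mu]_(x in obox a b) (h x)%:E =
          \int[mu]_(x in Omega) (h x * \1_(obox a b) x)%:E)%E.
  rewrite -{1}(setIidr oab) integral_mkcondr; apply: eq_integral => x _.
  by rewrite patchE indicE; case: ifPn => _; rewrite ?mulr1 ?mulr0.
rewrite -(cvg_lim _ cvf)//.
by rewrite (_ : (fun _ => _) = cst 0%E); [exact: lim_cst|apply/funext => k /=; rewrite f0].
Qed.

(** Inside a fixed box with closure in [Omega], the integral of [h] vanishes
    on all smaller boxes, hence on all Borel sets by Dynkin's theorem; so
    [h] vanishes there almost everywhere, and countably many such boxes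
    cover [Omega]. *)
Lemma ae_eq0_test (Omega : set 'rV[R]_d) (h : 'rV[R]_d -> R) :
  open Omega -> mu.-integrable Omega (EFin \o h) ->
  (forall phi, test_function Omega phi -> L2_ip Omega h phi = 0) ->
  {ae mu, forall x, Omega x -> h x = 0}.
Proof.
move=> oO ih h0; have mO : measurable Omega by exact: open_measurable_rV.
have [I [a [b [abO OE]]]] := open_box_cover oO.
rewrite OE.
suff H k : I k -> {ae mu, forall x, obox (a k) (b k) x -> h x = 0}.
  have : {ae mu, forall x, forall k, I k -> obox (a k) (b k) x -> h x = 0}.
    apply/ae_foralln => k; have [Ik|nIk] := pselect (I k).
      by apply: filterS (H _ Ik) => x Hx _.
    by apply/aeW => x /nIk.
  by apply: filterS => x Hx [k Ik xk]; exact: Hx xk.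
move=> Ik; set B := obox _ _.
have mB : measurable B by exact: measurable_obox.
have BO : B `<=` Omega by rewrite OE => x xk; exists k.
have ihB : mu.-integrable B (EFin \o h) by exact: integrableS ih.
have iA A : measurable A -> (\int[mu]_(x in A `&` B) (h x)%:E = 0)%E.
  rewrite measurable_oboxes; apply: (@dynkin_induction _ _ oboxes
    [set A | (\int[mu]_(x in A `&` B) (h x)%:E = 0)%E]).
  - exact: measurable_oboxes.
  - exact: setI_closed_oboxes.
  - by rewrite /= setTI; apply: (integral_obox_eq0 oO ih h0); exact: abO.
  - move=> _ [p [q ->]] /=; rewrite /B obox_setI; apply: (integral_obox_eq0 oO ih h0).
    apply: subset_trans (abO _ Ik) => x xI i; have := xI i; rewrite !mxE ge_max le_min.
    by move=> /andP[/andP[_ ->] /andP[_ ->]].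
  - move=> S mS /= S0.
    have := integral_obox_eq0 oO ih h0 (abO _ Ik); rewrite -/B.
    have {1}-> : B = (S `&` B) `|` (~` S `&` B) by rewrite -setIUl setUv setTI.
    rewrite integral_setU//=; last 4 first.
    - exact: measurableI.
    - by apply: measurableI => //; exact: measurableC.
    - rewrite -setIUl setUv setTI; exact: measurable_int ihB.
    - by rewrite disj_set2E setIACA setICr set0I.
    by rewrite S0 add0e.
  - move=> F mF tF F0 /=; rewrite setI_bigcupl integral_bigcup//.
    + by apply: eseries0 => i _ _; exact: F0.
    + by apply: trivIset_setIr.
    + by move=> n; exact: measurableI.
    + by apply: integrableS ihB => //; [apply: bigcupT_measurable => n; exact: measurableI|rewrite -setI_bigcupl; exact: subIsetr].
have := @integral_ae_eq _ _ _ mu B mB (cst 0%E) (EFin \o h) ihB (measurable_cst _) _.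
move=> /(_ _)/wrap[].
  move=> E EB mE; rewrite integral0; have := iA E mE; by rewrite setIidl.
by apply: filterS => x Hx /Hx/= [].
Qed.

End fundamental_lemma.

(** * Square integrable functions and their completeness *)

Section square_integrable.
Context d (T : measurableType d) (R : realType) (mu : {measure set T -> \bar R}).
Context (D : set T).
Hypothesis mD : measurable D.
Hypothesis finD : (mu D < +oo)%E.
Implicit Types f g : T -> R.

Definition sqint f :=
  measurable_fun D f /\ mu.-integrable D (fun x => (f x ^+ 2)%:E).

Definition intble f := mu.-integrable D (fun x => (f x)%:E).

Notation I f := (Rintegral mu D f).

Lemma intble_measurable f : intble f -> measurable_fun D f.
Proof. by move=> /measurable_int /measurable_EFinP. Qed.

Lemma intble_le f g : measurable_fun D f -> intble g ->
  (forall x, D x -> `|f x| <= g x) -> intble f.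
Proof.
move=> mf ig fg; apply: (le_integrable mD _ _ ig); first exact/measurable_EFinP.
by move=> x Dx; rewrite /= lee_fin (le_trans (fg _ Dx))// ler_norm.
Qed.

Lemma intbleD f g : intble f -> intble g -> intble (fun x => f x + g x).
Proof. by move=> If Ig; exact: (integrableD mD If Ig). Qed.

Lemma intbleZ c f : intble f -> intble (fun x => c * f x).
Proof. by move=> If; exact: (integrableZl mD c If). Qed.

Lemma intble_cst c : intble (cst c).
Proof.
apply/integrableP; split; first exact/measurable_EFinP.
by rewrite /= integral_cst//= lte_mul_pinfty.
Qed.

Lemma sqintM f g : sqint f -> sqint g -> intble (fun x => f x * g x).
Proof.
move=> [mf If] [mg Ig]; apply: (@intble_le _ (fun x => f x ^+ 2 + g x ^+ 2)).
- exact: measurable_funM.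
- exact: intbleD.
- move=> x _; rewrite normrM -(real_normK (num_real (f x))) -(real_normK (num_real (g x))).
  have := sqr_ge0 (`|f x| - `|g x|); have := sqr_ge0 (`|f x|); have := sqr_ge0 (`|g x|).
  by rewrite sqrrB; lra.
Qed.

Lemma sqint_intble f : sqint f -> intble f.
Proof.
move=> sf; have /sqintM/(_ sf) : sqint (cst 1).
  by split => //=; under eq_fun do rewrite expr1n; exact: (intble_cst 1).
by under eq_fun do rewrite mul1r.
Qed.

Lemma sqint_le f g : measurable_fun D f -> sqint g ->
  (forall x, D x -> `|f x| <= `|g x|) -> sqint f.
Proof.
move=> mf [mg Ig] fg; split => //.
apply: (@intble_le _ (fun x => g x ^+ 2)) => //; first exact: measurable_funX.
move=> x Dx; rewrite normrX -[g x ^+ 2](real_normK (num_real (g x))).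
by rewrite ler_sqr ?nnegrE// fg.
Qed.

Lemma sqintD f g : sqint f -> sqint g -> sqint (fun x => f x + g x).
Proof.
move=> sf sg; have [mf If] := sf; have [mg Ig] := sg; split.
  exact: measurable_funD.
apply: (@intble_le _ (fun x => 2 * f x ^+ 2 + 2 * g x ^+ 2)).
- by apply: measurable_funX; exact: measurable_funD.
- by apply: intbleD; exact: intbleZ.
- by move=> x _; rewrite ger0_norm ?sqr_ge0//; have := sqr_ge0 (f x - g x); rewrite sqrrB sqrrD; lra.
Qed.

Lemma sqintZ c f : sqint f -> sqint (fun x => c * f x).
Proof.
move=> [mf If]; split; first exact: measurable_funM.
by under eq_fun do rewrite exprMn; exact: intbleZ.
Qed.

Lemma sqintB f g : sqint f -> sqint g -> sqint (fun x => f x - g x).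
Proof.
move=> sf sg; have := sqintD sf (sqintZ (-1) sg).
by under eq_fun do rewrite mulN1r.
Qed.

Lemma Rintegral_fineK f : intble f -> ((I f)%:E = \int[mu]_(x in D) (f x)%:E)%E.
Proof. by move=> If; rewrite /Rintegral fineK//; exact: integrable_fin_num. Qed.

(** The sum of the series has finite integral, hence is finite almost
    everywhere. *)
Lemma ae_summable (a : nat -> T -> R) (C : R) :
  (forall k, measurable_fun D (a k)) -> (forall k x, 0 <= a k x) ->
  (forall k, \int[mu]_(x in D) (a k x)%:E <= (C * 2^-1 ^+ k)%:E)%E ->
  {ae mu, forall x, D x -> cvgn (series (fun k => a k x))}.
Proof.
move=> ma a0 ia.
have C0 : 0 <= C.
  have := ia 0; rewrite expr0 mulr1 -lee_fin; apply: le_trans.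
  by apply: integral_ge0 => x _; rewrite lee_fin.
pose S x := (\sum_(k <oo) (a k x)%:E)%E.
have mS : measurable_fun D S.
  by apply: ge0_emeasurable_sum => [k x _ _|k _]; [rewrite lee_fin|exact/measurable_EFinP].
have S0 x : (0 <= S x)%E by apply: nneseries_ge0 => k _ _; rewrite lee_fin.
have iS : mu.-integrable D S.
  apply/integrableP; split => //.
  under eq_integral do rewrite gee0_abs//.
  rewrite integral_nneseries//; last 2 first.
  - by move=> k; exact/measurable_EFinP.
  - by move=> k x _; rewrite lee_fin.
  apply: (@le_lt_trans _ _ (C * 2)%:E); last exact: ltry.
  apply: lime_le.
    by apply: is_cvg_nneseries => k _ _; apply: integral_ge0 => x _; rewrite lee_fin.
  apply: nearW => n; apply: (@le_trans _ _ (\sum_(0 <= k < n) (C * 2^-1 ^+ k)%:E)%E).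
    by apply: lee_sum => k _; exact: ia.
  rewrite sumEFin lee_fin -mulr_sumr ler_wpM2l//.
  have := @geometric_seriesE R 1 2^-1; rewrite /series/= => /(_ _)/funeqP/(_ n)/=.
  under eq_bigr do rewrite mul1r.
  move=> ->; last by rewrite lt_eqF// invf_lt1// ltr1n.
  rewrite mul1r ler_pdivrMr; last lra.
  have : 0 <= (2^-1 : R) ^+ n by rewrite exprn_ge0.
  lra.
apply: filterS (integrable_ae mD iS) => x Sx Dx.
apply: nondecreasing_is_cvgn.
  by apply/nondecreasing_seqP => n; rewrite /series/= big_nat_recr//= lerDl.
exists (fine (S x)) => _ [n _ <-].
rewrite -lee_fin fineK; last exact: Sx.
rewrite /series/= -sumEFin; apply: nneseries_lim_ge => k _ _.
by rewrite lee_fin.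
Qed.

(** The squared distances to the limit are summable almost everywhere, so
    they tend to 0 there. *)
Lemma fast_ae_cvg (h : nat -> T -> R) g :
  (forall k, sqint (h k)) -> sqint g ->
  (forall k, I (fun x => (h k x - g x) ^+ 2) <= 2^-1 ^+ k) ->
  {ae mu, forall x, D x -> (fun k => h k x) @ \oo --> g x}.
Proof.
move=> sh sg hg; have sb k := sqintB (sh k) sg.
have := @ae_summable (fun k x => (h k x - g x) ^+ 2) 1.
move=> /(_ _ _ _)/wrap[].
- by move=> k; apply: measurable_funX; case: (sb k).
- by move=> k x; exact: sqr_ge0.
- move=> k; rewrite -Rintegral_fineK; last by case: (sb k).
  by rewrite lee_fin mul1r; exact: hg.
apply: filterS => x Hx Dx; have /cvg_series_cvg_0/= h0 := Hx Dx.
have K : (fun k => Num.sqrt ((h k x - g x) ^+ 2)) @ \oo --> Num.sqrt (0 : R).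
  by apply: continuous_cvg => //; exact: sqrt_continuous.
rewrite sqrtr0 in K; apply/subr_cvg0/norm_cvg0P; apply: cvg_trans K.
by apply: near_eq_cvg; apply: nearW => k /=; rewrite sqrtr_sqr.
Qed.

(** Even powers are nonnegative, so Fatou's lemma applies to functions of
    any sign. *)
Lemma sq_fatou (h : nat -> T -> R) g (C : R) (p : nat) :
  (forall k, measurable_fun D (h k)) -> measurable_fun D g ->
  {ae mu, forall x, D x -> (fun k => h k x) @ \oo --> g x} ->
  (forall k, intble (fun x => h k x ^+ p.*2)) ->
  (exists N, forall k, (N <= k)%N -> I (fun x => h k x ^+ p.*2) <= C) ->
  intble (fun x => g x ^+ p.*2) /\ I (fun x => g x ^+ p.*2) <= C.
Proof.
move=> mh mg hg ih [N hC].
have e0 (x : R) : 0 <= x ^+ p.*2 by rewrite exprn_even_ge0// odd_double.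
have mhp k : measurable_fun D (fun x => (h k x ^+ p.*2)%:E).
  by apply/measurable_EFinP; exact: measurable_funX.
have mgp : measurable_fun D (fun x => (g x ^+ p.*2)%:E).
  by apply/measurable_EFinP; exact: measurable_funX.
have le : (\int[mu]_(x in D) (g x ^+ p.*2)%:E <= C%:E)%E.
  have := @fatou _ _ _ mu D mD (fun k x => (h k x ^+ p.*2)%:E) mhp
    (fun k x _ => e0 (h k x)).
  have -> : (\int[mu]_(x in D) limn_einf ((fun k x => (h k x ^+ p.*2)%:E)^~ x) =
      \int[mu]_(x in D) (g x ^+ p.*2)%:E)%E.
    apply: ae_eq_integral => //.
      rewrite (_ : (fun x => _) = (fun x => - limn_esup (fun k => - (h k x ^+ p.*2)%:E))%E).
        apply: measurableT_comp => //; apply: measurable_fun_limn_esup => k.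
        exact: measurableT_comp.
      apply/funext => x; have := limn_esupN (fun k => (h k x ^+ p.*2)%:E).
      by rewrite /comp => ->; rewrite oppeK.
    apply: filterS hg => x hx Dx.
    rewrite is_cvg_limn_einfE.
      apply/cvg_lim => //; apply: cvg_EFin; first exact: nearW.
      exact: (cvg_comp _ _ (hx Dx) (@exprn_continuous R p.*2 (g x))).
    apply/cvg_ex; exists (g x ^+ p.*2)%:E; apply: cvg_EFin; first exact: nearW.
    exact: (cvg_comp _ _ (hx Dx) (@exprn_continuous R p.*2 (g x))).
  move=> /le_trans; apply; rewrite limn_einf_lim; apply: lime_le.
    exact: is_cvg_einfs.
  apply: nearW => n; apply: (@le_trans _ _ (\int[mu]_(x in D) (h (maxn n N) x ^+ p.*2)%:E)%E).
    by apply: ereal_inf_lbound; exists (maxn n N) => //=; exact: leq_maxl.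
  by rewrite -Rintegral_fineK// lee_fin hC// leq_maxr.
have ig : intble (fun x => g x ^+ p.*2).
  apply/integrableP; split => //.
  under eq_integral do rewrite gee0_abs ?lee_fin//.
  by apply: le_lt_trans le _; exact: ltry.
by split => //; rewrite -lee_fin Rintegral_fineK.
Qed.

Lemma Rintegral_intble_le f g : intble f -> intble g -> (forall x, D x -> f x <= g x) -> I f <= I g.
Proof. by move=> *; exact: le_Rintegral. Qed.

Lemma Rintegral_intbleD f g : intble f -> intble g -> I (fun x => f x + g x) = I f + I g.
Proof. by move=> *; exact: RintegralD. Qed.

Lemma Rintegral_intbleZ c f : intble f -> I (fun x => c * f x) = c * I f.
Proof. by move=> *; exact: RintegralZl. Qed.

Lemma Rintegral_ae_eq f g : measurable_fun D f -> measurable_fun D g ->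
  {ae mu, forall x, D x -> f x = g x} -> I f = I g.
Proof.
move=> mf mg fg; rewrite /Rintegral; congr fine; apply: ae_eq_integral => //;
  [exact/measurable_EFinP..|].
by apply: filterS fg => x fgx Dx; rewrite fgx.
Qed.

(** A subsequence with squared increments at most 4^-k converges almost
    everywhere, because its increments are summable there; Fatou's lemma
    then bounds the distance of the whole sequence to the limit. *)
Lemma riesz_fischer (f : nat -> T -> R) :
  (forall n, sqint (f n)) ->
  (forall e, 0 < e -> exists N, forall m n, (N <= m)%N -> (N <= n)%N ->
     I (fun x => (f m x - f n x) ^+ 2) <= e) ->
  exists2 g, sqint g & forall e, 0 < e -> exists N, forall n, (N <= n)%N ->
     I (fun x => (f n x - g x) ^+ 2) <= e.
Proof.
move=> sf cau.
have e0 k : 0 < (4^-1 ^+ k : R) by rewrite exprn_gt0.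
have /choice[N0 N0P] : forall k : nat, exists N, forall m n, (N <= m)%N -> (N <= n)%N ->
     I (fun x => (f m x - f n x) ^+ 2) <= 4^-1 ^+ k.
  by move=> k; exact: cau.
pose N k := (\max_(i < k.+1) N0 i + k)%N.
have NN k : (N k <= N k.+1)%N by rewrite /N leq_add// [in leqRHS]big_ord_recr/= leq_maxl.
have N0N k : (N0 k <= N k)%N.
  by rewrite /N (leq_trans _ (leq_addr _ _))// big_ord_recr/= leq_maxr.
pose h k := f (N k).
pose a k x := `|h k.+1 x - h k x|.
have sd k : sqint (fun x => h k.+1 x - h k x) by exact: (sqintB (sf (N k.+1)) (sf (N k))).
have ma k : measurable_fun D (a k).
  by apply: measurableT_comp => //; case: (sd k).
have [E [mE E0 EP]] : {ae mu, forall x, D x -> cvgn (series (fun k => a k x))}.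
  (* The arithmetic-geometric inequality a <= 2^-k + 2^k a^2 trades the bound
     4^-k on the squared increment for a bound of order 2^-k on the increment
     itself; the measure of [D] enters through the integral of the constant. *)
  apply: (@ae_summable a (1 + I (cst 1))) => // [k x|k]; first exact: normr_ge0.
  have ia : intble (a k).
    by apply: (@intble_le _ (fun x => 1 + (h k.+1 x - h k x) ^+ 2)) => //;
      [apply: intbleD; [exact: (intble_cst 1)|by case: (sd k)]|
       move=> x _; rewrite normr_id; have := sqr_ge0 (`|h k.+1 x - h k x| - 1);
       rewrite sqrrB real_normK ?num_real//; have := normr_ge0 (h k.+1 x - h k x); lra].
  rewrite -Rintegral_fineK// lee_fin.
  have p0 : 0 < (2^-1 ^+ k : R) by rewrite exprn_gt0.
  apply: (@le_trans _ _ (I (fun x => 2^-1 ^+ k * 1 + (2^-1 ^+ k)^-1 * (h k.+1 x - h k x) ^+ 2))).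
    apply: Rintegral_intble_le => //.
      by apply: intbleD; apply: intbleZ; [exact: (intble_cst 1)|case: (sd k)].
    move=> x _; rewrite /a mulr1 -(ler_pM2l p0) mulrDr mulrA mulfV ?gt_eqF// mul1r.
    rewrite -(real_normK (num_real (h k.+1 x - h k x))).
    have := sqr_ge0 (2^-1 ^+ k - `|h k.+1 x - h k x|); rewrite sqrrB -expr2.
    have := mulr_ge0 (ltW p0) (normr_ge0 (h k.+1 x - h k x)); lra.
  rewrite Rintegral_intbleD; [|apply: intbleZ; exact: (intble_cst 1)|by apply: intbleZ; case: (sd k)].
  rewrite Rintegral_intbleZ; last exact: (intble_cst 1).
  rewrite Rintegral_intbleZ; last by case: (sd k).
  rewrite mulrDl mul1r addrC [I (cst 1) * _]mulrC lerD2r.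
  rewrite ler_pdivrMl// -exprMn -invfM -natrM.
  by apply: N0P; [exact: leq_trans (N0N k) (NN k)|exact: N0N].
(* Setting the subsequence to 0 on the exceptional null set makes it
   converge at every point of [D], so that its limit is measurable. *)
pose h' k x := h k x * \1_(~` E) x.
have ch' x : D x -> cvgn (fun k => h' k x).
  move=> Dx; rewrite /h' indicE; have [xE|xE] := boolP (x \in ~` E); last first.
    by under eq_fun do rewrite mulr0; exact: is_cvg_cst.
  under eq_fun do rewrite mulr1.
  have cx : cvgn (series (fun k => a k x)).
    by apply: contrapT => ncx; move: xE; rewrite inE; apply; apply: EP => /(_ Dx).
  have cT : cvgn (series (telescope (fun k => h k x))) by exact: normed_cvg.
  rewrite telescopeK in cT.
  have := is_cvgD cT (is_cvg_cst (h 0%N x)).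
  rewrite (_ : _ + _ = (fun k => h k x)); first by exact.
  by apply/funext => k /=; rewrite /GRing.add/= /cst subrK.
pose g x := limn (fun k => h' k x).
have mh' k : measurable_fun D (h' k).
  apply: measurable_funM; first by case: (sf (N k)).
  by apply: measurable_indic; exact: measurableC.
have mg : measurable_fun D g.
  by apply: (measurable_fun_cvg mh') => x Dx; exact: ch'.
have h'h k : {ae mu, forall x, D x -> h k x = h' k x}.
  exists E; split => // x /= /not_implyP[Dx]; rewrite /h' indicE.
  by apply: contra_notP => xE; rewrite mem_set// mulr1.
have fat e : 0 < e -> exists N, forall n, (N <= n)%N ->
     sqint (fun x => f n x - g x) /\ I (fun x => (f n x - g x) ^+ 2) <= e.
  move=> e_gt0; have [M MP] := cau _ e_gt0; exists M => n Mn.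
  have mfh k : measurable_fun D (fun x => f n x - h' k x).
    by apply: measurable_funB => //; case: (sf n).
  have mfg : measurable_fun D (fun x => f n x - g x).
    by apply: measurable_funB => //; case: (sf n).
  have sfh k : sqint (fun x => f n x - h' k x).
    apply: sqintB => //; apply: sqint_le (sf (N k)) _ => // x _.
    by rewrite /h' normrM ler_piMr// indicE; case: (_ \in _); rewrite ?normr1 ?normr0.
  have := @sq_fatou (fun k x => f n x - h' k x) (fun x => f n x - g x) e 1 mfh mfg.
  move=> /(_ _ _ _)/wrap[].
  - by apply/aeW => x Dx; apply: cvgB; [exact: cvg_cst|exact: ch'].
  - by move=> k; case: (sfh k).
  - exists M => k Mk; rewrite (@Rintegral_ae_eq _ (fun x => (f n x - h k x) ^+ 2)).
    + by apply: MP => //; exact: leq_trans Mk (leq_addl _ _).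
    + by apply: measurable_funX; exact: mfh.
    + by apply: measurable_funX; apply: measurable_funB; [case: (sf n)|case: (sf (N k))].
    + by apply: filterS (h'h k) => x Hx Dx; rewrite Hx.
  by move=> [ig le]; split => //; split.
have sg : sqint g.
  have [M MP] := fat _ (@ltr01 R); have [sfg _] := MP _ (leqnn M).
  have := sqintB (sf M) sfg; congr sqint; apply/funext => x.
  by rewrite opprB addrC subrK.
by exists g => // e /fat[M MP]; exists M => n /MP[].
Qed.

End square_integrable.

Section integral_complements.
Context d (T : measurableType d) (R : realType) (mu : {measure set T -> \bar R}).
Context (D : set T).
Hypothesis mD : measurable D.
Implicit Types f g : T -> R.
Notation I f := (Rintegral mu D f).

Lemma intble_ae f g : measurable_fun D f -> intble mu D g ->
  {ae mu, forall x, D x -> f x = g x} -> intble mu D f.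
Proof.
move=> mf Ig fg; apply/integrableP; split; first exact/measurable_EFinP.
have /integrableP[mg] := Ig; apply: le_lt_trans.
rewrite le_eqVlt; apply/orP; left; apply/eqP.
apply: ae_eq_integral => //.
- by apply: measurableT_comp => //; exact/measurable_EFinP.
- exact: measurableT_comp mg.
- by apply: filterS fg => x fgx Dx; rewrite fgx.
Qed.

Lemma intble_sum (m : nat) (f : 'I_m -> T -> R) :
  (forall i, intble mu D (f i)) -> intble mu D (fun x => \sum_(i < m) f i x).
Proof.
elim: m f => [|m IH] f If.
  rewrite /intble; under eq_fun do rewrite big_ord0; exact: integrable0.
rewrite /intble; under eq_fun do rewrite big_ord_recl.
by apply: (intbleD mD) => //; exact: IH.
Qed.

Lemma Rintegral_intble_sum (m : nat) (f : 'I_m -> T -> R) : (forall i, intble mu D (f i)) ->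
  I (fun x => \sum_(i < m) f i x) = \sum_(i < m) I (f i).
Proof.
elim: m f => [|m IH] f If.
  rewrite big_ord0; under eq_Rintegral do rewrite big_ord0.
  by rewrite Rintegral_cst ?mul0r.
rewrite big_ord_recl; under eq_Rintegral do rewrite big_ord_recl.
by rewrite (Rintegral_intbleD mD)// ?IH//; exact: intble_sum.
Qed.

Lemma Rintegral_le_ae f g : intble mu D f -> intble mu D g ->
  {ae mu, forall x, D x -> f x <= g x} -> I f <= I g.
Proof.
move=> If Ig fg.
have mf := intble_measurable If; have mg := intble_measurable Ig.
have mm : measurable_fun D (fun x => Num.max (f x) (g x)) by exact: measurable_maxr.
have E : {ae mu, forall x, D x -> Num.max (f x) (g x) = g x}.
  by apply: filterS fg => x fgx /fgx fg'; apply/max_idPr.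
rewrite -(Rintegral_ae_eq mD mm mg E); apply: (Rintegral_intble_le mD) => //; first exact: intble_ae mm Ig E.
by move=> x _; rewrite le_max lexx.
Qed.

End integral_complements.

(** * Calculus on the line *)

Section line_calculus.
Context (R : realType) (f g : R -> R) (M : R).
Hypothesis fg : forall s : R, is_derive s 1 f (g s).
Hypothesis cg : continuous g.
Hypothesis f_supp : forall s, f s != 0 -> `|s| <= M.
Notation leb1 := (@lebesgue_measure R).

Let cf : continuous f. Proof. exact: is_derive_continuous fg. Qed.

Lemma ftc_segment (F G : R -> R) (a b : R) : a < b ->
  (forall s : R, is_derive s 1 F (G s)) -> continuous G ->
  (\int[leb1]_(s in `[a, b]) (G s)%:E = (F b - F a)%:E)%E.
Proof.
move=> ab FG cG; have cF := is_derive_continuous FG.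
rewrite (@continuous_FTC2 _ G F a b)//.
- exact: continuous_subspaceT.
- split => [x _||].
  + exact: (@ex_derive _ _ _ _ _ _ _ (FG x)).
  + by apply: cvg_at_right_filter; exact: cF.
  + by apply: cvg_at_left_filter; exact: cF.
- by move=> x _; rewrite derive1E; exact: (@derive_val _ _ _ _ _ _ _ (FG x)).
Qed.

Lemma derive_out_supp s : M < `|s| -> g s = 0.
Proof.
move=> Ms; rewrite -(@derive_val _ _ _ _ _ _ _ (fg s)).
rewrite (@near_eq_derive _ _ _ _ (cst 0)) ?derive_cst//.
suff : \near s, M < `|s| by apply: filterS => y My; have [//|/f_supp] := eqVneq (f y) 0; lra.
have /cvgrPdist_lt := @norm_continuous _ R s.
move=> /(_ (`|s| - M)); rewrite subr_gt0 => /(_ Ms); apply: filterS => y.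
move=> /(le_lt_trans (ler_norm _)); lra.
Qed.

Lemma line_integral_derive : (\int[leb1]_s (g s)%:E = 0)%E.
Proof.
pose K : R := `|M| + 1; have K0 : 0 < K by rewrite ltr_wpDl.
transitivity (\int[leb1]_(s in `[(- K)%R, K]) (g s)%:E)%E.
  rewrite [RHS]integral_mkcond; apply: eq_integral => s _.
  rewrite patchE; case: ifPn => //.
  rewrite notin_setE/= in_itv/= => /negP; rewrite -ler_norml -ltNge => h.
  by rewrite derive_out_supp//; rewrite /K in h; have := ler_norm M; lra.
rewrite (ftc_segment _ fg cg); last lra.
have out s : K = `|s| -> f s = 0.
  rewrite /K => h; have := ler_norm M; have [//|/f_supp] := eqVneq (f s) 0; lra.
by rewrite !out ?subr0// ?normrN ger0_norm// ltW.
Qed.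

(** Integrating the derivative 2 f g of f^2 from outside the support up to
    [t] gives f(t)^2 <= int |2 f g|, and |2 f g| <= lam f^2 + g^2 / lam. The
    free parameter [lam] keeps the bound linear in the two integrals, so
    that it can be integrated over further variables. *)
Lemma line_sup (lam t : R) : 0 < lam ->
  ((f t ^+ 2)%:E <= \int[leb1]_s (lam * f s ^+ 2 + lam^-1 * g s ^+ 2)%:E)%E.
Proof.
move=> l0.
have Q0 s : 0 <= lam * f s ^+ 2 + lam^-1 * g s ^+ 2.
  by rewrite addr_ge0// mulr_ge0 ?sqr_ge0// ?invr_ge0 ltW.
have [->|/f_supp] := eqVneq (f t) 0.
  by rewrite expr0n; apply: integral_ge0 => s _; rewrite lee_fin.
rewrite ler_norml => /andP[Mt _].
pose G : R -> R := f * g + f * g.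
have FG (s : R) : is_derive s 1 (f * f) (G s).
  exact: is_deriveM.
have cG : continuous G.
  by move=> s; apply: continuousD; apply: continuousM; [exact: cf|exact: cg|exact: cf|exact: cg].
have at_ : - M - 1 < t by lra.
have f0 : f (- M - 1) = 0.
  have [//|/f_supp] := eqVneq (f (- M - 1)) 0; rewrite ler_norml; lra.
have := ftc_segment at_ FG cG.
rewrite [(f * f) t]/GRing.mul/= [(f * f) (- M - 1)]/GRing.mul/= f0 mul0r subr0 -expr2 => <-.
have mG : measurable_fun `[- M - 1, t] (EFin \o G).
  apply/measurable_EFinP; apply: measurable_funTS; exact: continuous_measurable_fun.
have mQ : measurable_fun setT (fun s => (lam * f s ^+ 2 + lam^-1 * g s ^+ 2)%:E).
  apply/measurable_EFinP; apply: continuous_measurable_fun => s.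
  apply: cvgD; apply: cvgMl_tmp; rewrite expr2; under eq_fun do rewrite expr2.
    by apply: cvgM; exact: cf.
  by apply: cvgM; exact: cg.
apply: (@le_trans _ _ (\int[leb1]_(s in `[(- M - 1)%R, t]) `|G s|%:E)%E).
  apply: le_trans (lee_abs _) _; exact: le_abse_integral.
apply: (@le_trans _ _ (\int[leb1]_(s in `[(- M - 1)%R, t]) (lam * f s ^+ 2 + lam^-1 * g s ^+ 2)%:E)%E).
  apply: ge0_le_integral => //.
  - apply/measurable_EFinP; apply: measurable_funTS; apply: continuous_measurable_fun => s.
    by apply: cvg_norm; exact: cG.
  - exact: measurable_funTS.
  - move=> s _; rewrite lee_fin.
    have -> : G s = 2 * (f s * g s) by rewrite mulr_natl mulr2n.
    rewrite !normrM [`|2|]ger0_norm//.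
    rewrite -(ler_pM2l l0) mulrDr [lam * (lam^-1 * _)]mulrA mulfV ?gt_eqF// mul1r.
    rewrite -(real_normK (num_real (f s))) -(real_normK (num_real (g s))).
    have := sqr_ge0 (lam * `|f s| - `|g s|); nra.
apply: ge0_subset_integral => //; by move=> s _; rewrite lee_fin.
Qed.

End line_calculus.

(** * Continuously differentiable functions with bounded support *)

Section compactly_supported.
Context (R : realType).

Definition bounded_support (n : nat) (f : 'rV[R]_n -> R) :=
  exists M : R, forall x, f x != 0 -> forall i, `|x ord0 i| <= M.

Definition C0c (n : nat) (f : 'rV[R]_n -> R) := continuous f /\ bounded_support f.

Definition C1c (n : nat) (f : 'rV[R]_n -> R) :=
  [/\ C0c f, forall i x, derivable f x (delta_mx ord0 i) &
      forall i, continuous (partial i f)].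

Lemma C0c_bounded (n : nat) (f : 'rV[R]_n -> R) : C0c f ->
  exists2 K, 0 <= K & forall x, `|f x| <= K.
Proof.
move=> [cf [M fM]].
have := @continuous_compact _ _ f (cbox (const_mx (- M)) (const_mx M)).
move=> /(_ (continuous_subspaceT cf) (@cbox_compact _ _ _ _)) /compact_bounded.
move=> [K [Kr HK]]; exists (`|K| + 1) => [|x]; first by rewrite addr_ge0.
have [->|fx0] := eqVneq (f x) 0; first by rewrite normr0 addr_ge0.
apply: HK; first by rewrite (le_lt_trans (ler_norm K))// ltrDl.
by exists x => // i; rewrite !mxE -ler_norml; exact: fM.
Qed.

Lemma leb_bounded_support (n : nat) (M : R) :
  exists2 B, measurable B & (leb R n B < +oo)%E /\
    forall x : 'rV[R]_n, (forall i, `|x ord0 i| <= M) -> B x.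
Proof.
exists (obox (const_mx (- M - 1)) (const_mx (M + 1))); first exact: measurable_obox.
split; first exact: leb_obox_lty.
move=> x xM i; have := xM i; rewrite !mxE ler_norml; lra.
Qed.

Lemma C0c_integrable (n : nat) (f : 'rV[R]_n -> R) (D : set 'rV[R]_n) :
  measurable D -> C0c f -> (leb R n).-integrable D (EFin \o f).
Proof.
move=> mD cf; apply: (@integrableS _ _ _ _ setT) => //.
have [K K0 fK] := C0c_bounded cf; have [cf0 [M fM]] := cf.
have [B mB [Boo xB]] := leb_bounded_support n M.
apply: (@le_integrable _ _ _ _ _ _ _ (fun x => (K * \1_B x)%:E)) => //.
- by apply/measurable_EFinP; exact: continuous_measurable_rV.
- move=> x _; rewrite lee_fin [`|K * _|]ger0_norm ?mulr_ge0// indicE.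
  have [->|fx0] := eqVneq (f x) 0; first by rewrite normr0 mulr_ge0.
  by rewrite mem_set ?mulr1 ?fK//; apply: xB; exact: fM.
- under eq_fun do rewrite EFinM.
  apply: integrableZl => //; apply/integrableP; split.
    by apply/measurable_EFinP; exact: measurable_indic.
  under eq_integral => x _ do rewrite gee0_abs ?lee_fin//.
  by rewrite integral_indic ?setIT.
Qed.

Lemma C0c_cst_mul (n : nat) (c : R) (f : 'rV[R]_n -> R) :
  C0c f -> C0c (fun x => c * f x).
Proof.
move=> [cf [M fM]]; split; first by move=> x; apply: (@continuousM _ _ (cst c) f x); [exact: cst_continuous|exact: cf].
by exists M => x; rewrite mulf_eq0 negb_or => /andP[_]; exact: fM.
Qed.

Lemma C0cD (n : nat) (f g : 'rV[R]_n -> R) :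
  C0c f -> C0c g -> C0c (fun x => f x + g x).
Proof.
move=> [cf [M fM]] [cg [N gN]]; split.
  by move=> x; apply: continuousD; [exact: cf|exact: cg].
exists (Num.max M N) => x fgx i; rewrite le_max.
have [fx|/fM->//] := eqVneq (f x) 0; have [gx|/gN->//] := eqVneq (g x) 0.
  by rewrite fx gx addr0 eqxx in fgx.
by rewrite orbT.
Qed.

Lemma C0cM (n : nat) (f g : 'rV[R]_n -> R) :
  C0c f -> continuous g -> C0c (fun x => f x * g x).
Proof.
move=> [cf [M fM]] cg; split.
  by move=> x; apply: (@continuousM _ _ f g x); [exact: cf|exact: cg].
by exists M => x; rewrite mulf_eq0 negb_or => /andP[fx _]; exact: fM.
Qed.

Lemma C0cX (n k : nat) (f : 'rV[R]_n -> R) : C0c f -> C0c (fun x => f x ^+ k.+1).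
Proof.
move=> cf; elim: k => [//|k IH]; under eq_fun do rewrite exprS.
by apply: C0cM => //; case: IH.
Qed.

Lemma C0c_sum (n m : nat) (f : 'I_m -> 'rV[R]_n -> R) :
  (forall i, C0c (f i)) -> C0c (fun x => \sum_(i < m) f i x).
Proof.
elim: m f => [|m IH] f cf.
  under eq_fun do rewrite big_ord0.
  by split; [exact: cst_continuous|exists 0 => x; rewrite eqxx].
under eq_fun do rewrite big_ord_recl.
by apply: C0cD => //; apply: IH.
Qed.

Lemma C1c_partial (n : nat) (f : 'rV[R]_n -> R) i : C1c f -> C0c (partial i f).
Proof.
move=> [[cf [M fM]] df cdf]; split => //; exists M => x px j.
rewrite leNgt; apply: contraNN px => Mx; apply/eqP.
rewrite /partial (@near_eq_derive _ _ _ _ (cst 0)) ?derive_cst//.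
suff : \forall y \near x, M < `|(y : 'rV[R]_n) ord0 j|.
  by apply: filterS => y My; have [//|/fM/(_ j)] := eqVneq (f y) 0; lra.
have e0 : 0 < `|x ord0 j| - M by rewrite subr_gt0.
apply: filterS (nbhsx_ballx x _ e0) => y /(rV_ballP _ _ e0).1/(_ j).
have := lerB_dist (x ord0 j) (y ord0 j); lra.
Qed.

Lemma continuous_rV (T : topologicalType) (n : nat) (g : T -> 'rV[R]_n) :
  (forall i, continuous (fun x => g x ord0 i)) -> continuous g.
Proof.
move=> cg x A [P nP sPA].
have : \forall y \near x, forall i : 'I_n, P ord0 i (g y ord0 i).
  by apply: filter_forall => i; exact: cg (nP ord0 i).
by apply: filterS => y Py; apply: sPA => i j; rewrite (ord1 i).
Qed.

Lemma rV_cons_continuousr (n : nat) (t : R) :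
  continuous (fun y : 'rV[R]_n => rV_cons (t, y)).
Proof.
apply: continuous_rV => i; have [j ->|->] := unliftP ord0 i.
  by under eq_fun do rewrite rV_consS; exact: coord_continuous.
by under eq_fun do rewrite rV_cons0; exact: cst_continuous.
Qed.

Lemma rV_cons_continuousl (n : nat) (y : 'rV[R]_n) :
  continuous (fun t : R => rV_cons (t, y)).
Proof.
apply: continuous_rV => i; have [j ->|->] := unliftP ord0 i.
  by under eq_fun do rewrite rV_consS; exact: cst_continuous.
by under eq_fun do rewrite rV_cons0; move=> x; exact: cvg_id.
Qed.

Lemma rV_cons_shiftS (n : nat) (i : 'I_n) (h t : R) (y : 'rV[R]_n) :
  rV_cons (t, h *: delta_mx ord0 i + y) =
  h *: delta_mx ord0 (lift ord0 i) + rV_cons (t, y).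
Proof.
apply/rowP => k; have [j ->|->] := unliftP ord0 k.
  by rewrite [RHS]mxE !rV_consS !mxE !eqxx (inj_eq lift_inj).
by rewrite [RHS]mxE !rV_cons0 !mxE eqxx mulr0 add0r.
Qed.

Lemma rV_cons_shift0 (n : nat) (h t : R) (y : 'rV[R]_n) :
  rV_cons (h + t, y) = h *: delta_mx ord0 ord0 + rV_cons (t, y).
Proof.
apply/rowP => k; have [j ->|->] := unliftP ord0 k.
  by rewrite [RHS]mxE !rV_consS !mxE/= mulr0 add0r.
by rewrite [RHS]mxE !rV_cons0 !mxE !eqxx mulr1.
Qed.

Lemma C0c_slice (n : nat) (f : 'rV[R]_n.+1 -> R) (t : R) : C0c f ->
  C0c (fun y => f (rV_cons (t, y))).
Proof.
move=> [cf [M fM]]; split.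
  by move=> y; apply: continuous_comp; [exact: rV_cons_continuousr|exact: cf].
by exists M => y fy i; have := fM _ fy (lift ord0 i); rewrite rV_consS.
Qed.

Lemma partial_slice (n : nat) (f : 'rV[R]_n.+1 -> R) (t : R) i y : C1c f ->
  is_derive y (delta_mx ord0 i) (fun y => f (rV_cons (t, y)))
    (partial (lift ord0 i) f (rV_cons (t, y))).
Proof.
move=> [_ df _].
apply: (@is_derive_line _ _ i _ y (fun s => f (s *: delta_mx ord0 (lift ord0 i) + rV_cons (t, y))) 0).
  by move=> s; rewrite rV_cons_shiftS addr0.
apply: line_is_derive; last exact: derivableP.
by move=> s; rewrite addr0.
Qed.

Lemma partial_line (n : nat) (f : 'rV[R]_n.+1 -> R) y (t : R) : C1c f ->
  is_derive t 1 (fun t => f (rV_cons (t, y))) (partial ord0 f (rV_cons (t, y))).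
Proof.
move=> [_ df _].
apply: line_is_derive; last exact: derivableP.
by move=> s; rewrite rV_cons_shift0.
Qed.

Lemma partial_sliceE (n : nat) (f : 'rV[R]_n.+1 -> R) (t : R) i : C1c f ->
  partial i (fun y => f (rV_cons (t, y))) =
  (fun y => partial (lift ord0 i) f (rV_cons (t, y))).
Proof.
move=> cf; apply/funext => y.
exact: (@derive_val _ _ _ _ _ _ _ (partial_slice t i y cf)).
Qed.

(** Slicing keeps the class, which is what inductions on the dimension need. *)
Lemma C1c_slice (n : nat) (f : 'rV[R]_n.+1 -> R) (t : R) : C1c f ->
  C1c (fun y => f (rV_cons (t, y))).
Proof.
move=> cf; have [cf0 df cdf] := cf; split; first exact: C0c_slice.
  by move=> i y; apply: (@ex_derive _ _ _ _ _ _ _ (partial_slice t i y cf)).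
move=> i; rewrite partial_sliceE// => y.
by apply: continuous_comp; [exact: rV_cons_continuousr|exact: cdf].
Qed.

End compactly_supported.

(** * The inequalities of Sobolev and Poincare *)

Section sobolev.
Context (R : realType).
Notation J n f := (\int[leb R n]_x f x).
Notation leb1 := (@lebesgue_measure R).

Lemma C0c_fineK (n : nat) (f : 'rV[R]_n -> R) : C0c f ->
  ((J n f)%:E = \int[leb R n]_x (f x)%:E)%E.
Proof.
move=> cf; rewrite /Rintegral fineK//; apply: integrable_fin_num => //.
exact: C0c_integrable.
Qed.

Lemma C0c_measurable (n : nat) (f : 'rV[R]_n -> R) : C0c f ->
  measurable_fun setT (EFin \o f).
Proof.
by move=> [cf _]; apply/measurable_EFinP; exact: continuous_measurable_rV.
Qed.

(** Integrate first along the direction of differentiation. Since [leb] is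
    built by prepending coordinates, this is an induction on the dimension
    in which only the first coordinate needs the fundamental theorem of
    calculus. *)
Lemma integral_partial (n : nat) (f : 'rV[R]_n -> R) (i : 'I_n) : C1c f ->
  (\int[leb R n]_x (partial i f x)%:E = 0)%E.
Proof.
elim: n f i => [f []//|n IH f i cf].
have [E1 E2] := leb_fubini (C0c_integrable measurableT (C1c_partial i cf)).
have [j ji|i0] := unliftP ord0 i.
  rewrite E1 integral0_eq// => t _.
  by rewrite -[RHS](IH _ j (C1c_slice t cf)); rewrite (partial_sliceE _ _ cf) ji.
rewrite E2 integral0_eq// => y _; rewrite i0.
have [[cf0 [M fM]] _ cdf] := cf.
apply: (@line_integral_derive _ (fun t => f (rV_cons (t, y))) _ M).
- by move=> t; exact: partial_line.
- move=> t; apply: (@continuous_comp _ _ _ (fun t => rV_cons (t, y)) (partial ord0 f)).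
    exact: rV_cons_continuousl.
  exact: cdf.
- by move=> t ft; have := fM _ ft ord0; rewrite rV_cons0.
Qed.

(** [line_sup] integrated over the remaining coordinates. *)
Lemma slice_sup (n : nat) (f : 'rV[R]_n.+1 -> R) (lam t : R) : 0 < lam -> C1c f ->
  J n (fun y => f (rV_cons (t, y)) ^+ 2) <=
  lam * J n.+1 (fun x => f x ^+ 2) + lam^-1 * J n.+1 (fun x => partial ord0 f x ^+ 2).
Proof.
move=> l0 cf; have [[cf0 [M fM]] _ cdf] := cf.
have cf2 : C0c (fun x => f x ^+ 2) by apply: C0cX; case: cf.
have cp2 : C0c (fun x => partial ord0 f x ^+ 2) by apply: C0cX; exact: C1c_partial.
have cQ : C0c (fun x => lam * f x ^+ 2 + lam^-1 * partial ord0 f x ^+ 2).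
  by apply: C0cD; exact: C0c_cst_mul.
have Q0 x : 0 <= lam * f x ^+ 2 + lam^-1 * partial ord0 f x ^+ 2.
  by rewrite addr_ge0// mulr_ge0 ?sqr_ge0// ?invr_ge0 ltW.
rewrite -!RintegralZl//; [|exact: C0c_integrable..].
rewrite -RintegralD//; [|apply: C0c_integrable => //; exact: C0c_cst_mul..].
rewrite -lee_fin C0c_fineK; last exact: (@C0c_slice _ _ (fun x => f x ^+ 2)).
rewrite C0c_fineK// leb_tonelli_swap//; last exact: C0c_measurable.
apply: ge0_le_integral => //.
- by move=> y _; rewrite lee_fin sqr_ge0.
- exact: C0c_measurable (@C0c_slice _ _ (fun x => f x ^+ 2) t cf2).
- apply: (@measurable_line_integral _ _ (fun x => (lam * f x ^+ 2 + lam^-1 * partial ord0 f x ^+ 2)%:E)) => //.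
  exact: C0c_measurable.
- move=> y _; apply: (@line_sup _ (fun t => f (rV_cons (t, y))) (fun t => partial ord0 f (rV_cons (t, y))) M) => //.
  + by move=> s; exact: partial_line.
  + move=> s; apply: (@continuous_comp _ _ _ (fun t => rV_cons (t, y)) (partial ord0 f)).
      exact: rV_cons_continuousl.
    exact: cdf.
  + by move=> s fs; have := fM _ fs ord0; rewrite rV_cons0.
Qed.

Lemma C0c_tonelli (n : nat) (H : 'rV[R]_n.+1 -> R) : C0c H -> (forall x, 0 <= H x) ->
  ((J n.+1 H)%:E = \int[leb1]_t (J n (fun y => H (rV_cons (t, y))))%:E)%E /\
  measurable_fun setT (fun t => (J n (fun y => H (rV_cons (t, y))))%:E).
Proof.
move=> cH H0.
have E : (fun t => (J n (fun y => H (rV_cons (t, y))))%:E) =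
    (fun t => \int[leb R n]_y (H (rV_cons (t, y)))%:E)%E.
  by apply/funext => t; rewrite C0c_fineK//; exact: C0c_slice.
have mH := C0c_measurable cH.
split; last by rewrite E; exact: measurable_slice_integral mH _.
by rewrite E C0c_fineK// leb_tonelli.
Qed.

(** Each slice contributes at most its mass times the integral of [H] over
    it; bounding the masses uniformly by [slice_sup] leaves the integral of
    [H] over all slices. *)
Lemma sobolev_step (n : nat) (f H : 'rV[R]_n.+1 -> R) (lam : R) : 0 < lam ->
  C1c f -> C0c H -> (forall x, 0 <= H x) ->
  (forall t, J n (fun y => f (rV_cons (t, y)) ^+ 4) <=
     J n (fun y => f (rV_cons (t, y)) ^+ 2) * J n (fun y => H (rV_cons (t, y)))) ->
  J n.+1 (fun x => f x ^+ 4) <=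
  (lam * J n.+1 (fun x => f x ^+ 2) + lam^-1 * J n.+1 (fun x => partial ord0 f x ^+ 2))
    * J n.+1 H.
Proof.
move=> l0 cf cH H0 step; set S := _ + _.
have cf4 : C0c (fun x => f x ^+ 4) by apply: C0cX; case: cf.
have f40 x : 0 <= f x ^+ 4 by rewrite exprn_even_ge0.
have [E4 m4] := C0c_tonelli cf4 f40; have [EH mH] := C0c_tonelli cH H0.
have JH0 t : 0 <= J n (fun y => H (rV_cons (t, y))) by apply: Rintegral_ge0.
have S0 : 0 <= S.
  by rewrite addr_ge0// mulr_ge0 ?invr_ge0 ?(ltW l0)//; apply: Rintegral_ge0 => x _; rewrite sqr_ge0.
rewrite -lee_fin E4 EFinM EH -ge0_integralZl//; last by move=> t _; rewrite lee_fin.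
apply: ge0_le_integral => //.
- by move=> t _; rewrite lee_fin; apply: Rintegral_ge0 => x _; exact: f40.
- by apply: measurable_funeM.
- move=> t _; rewrite -EFinM lee_fin; apply: le_trans (step t) _.
  by apply: ler_wpM2r => //; exact: slice_sup.
Qed.

Lemma sobolev1 (f : 'rV[R]_1 -> R) (lam : R) : 0 < lam -> C1c f ->
  J 1 (fun x => f x ^+ 4) <=
  (lam * J 1 (fun x => f x ^+ 2) + lam^-1 * J 1 (fun x => partial ord0 f x ^+ 2))
    * J 1 (fun x => f x ^+ 2).
Proof.
move=> l0 cf; apply: sobolev_step => //.
- by apply: C0cX; case: cf.
- by move=> x; rewrite sqr_ge0.
move=> t; have [cf0 _ _] := cf; have cs k := C0c_measurable (C0c_slice t (C0cX k cf0)).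
rewrite /Rintegral /= !integral_dirac//=; [|exact: cs..].
by rewrite indicT /cst/= !mul1r -exprD.
Qed.

(** The optimal choice is lam^2 = B / A; adding [k] to both terms covers the
    cases where one of them vanishes. *)
Lemma amgm_opt (I A B : R) : 0 <= A -> 0 <= B ->
  (forall lam, 0 < lam -> I <= (lam * A + lam^-1 * B) ^+ 2) -> I <= 4 * A * B.
Proof.
move=> A0 B0 H; apply/ler_addgt0Pr => e e0.
pose k := e / (A + B + 1).
have AB1 : 0 < A + B + 1 by lra.
have k0 : 0 < k by rewrite divr_gt0.
pose r := (B + k) / (A + k).
have r0 : 0 < r by rewrite divr_gt0//; lra.
have := H (Num.sqrt r); rewrite sqrtr_gt0 => /(_ r0).
rewrite sqrrD !exprMn sqr_sqrtr ?(ltW r0)// exprVn sqr_sqrtr ?(ltW r0)//.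
have -> : Num.sqrt r * A * ((Num.sqrt r)^-1 * B) = A * B.
  by field; rewrite gt_eqF// sqrtr_gt0.
have h1 : r * A ^+ 2 <= (B + k) * A.
  rewrite /r expr2 mulrA ler_wpM2r// mulrAC ler_pdivrMr; last lra.
  by rewrite ler_wpM2l; lra.
have h2 : r^-1 * B ^+ 2 <= (A + k) * B.
  rewrite /r invf_div expr2 mulrA ler_wpM2r// mulrAC ler_pdivrMr; last lra.
  by rewrite ler_wpM2l; lra.
have h3 : k * (A + B) <= e.
  rewrite /k mulrAC ler_pdivrMr// ler_pM2l//; lra.
rewrite -mulr_natl; lra.
Qed.

Lemma sobolev2_step_arith (lam x y z : R) : 0 < lam -> 0 <= x -> 0 <= y -> 0 <= z ->
  (lam * x + lam^-1 * y) * (lam * x + lam^-1 * z) <= (lam * x + lam^-1 * (y + z)) ^+ 2.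
Proof.
move=> l0 x0 y0 z0; rewrite [lam^-1 * (_ + _)]mulrDr expr2.
have a0 := mulr_ge0 (ltW l0) x0.
have i0 : 0 <= lam^-1 by rewrite invr_ge0 ltW.
have b0 := mulr_ge0 i0 y0; have c0 := mulr_ge0 i0 z0.
by apply: ler_pM; rewrite ?addr_ge0// lerD2l ?lerDl ?lerDr.
Qed.

Lemma C0c_Rintegral_sum (n m : nat) (g : 'I_m -> 'rV[R]_n -> R) :
  (forall i, C0c (g i)) ->
  J n (fun x => \sum_i g i x) = \sum_i J n (fun x => g i x).
Proof.
by move=> cg; apply: (Rintegral_intble_sum measurableT) => i; exact: C0c_integrable.
Qed.

Lemma sobolev2 (f : 'rV[R]_2 -> R) : C1c f ->
  J 2 (fun x => f x ^+ 4) <= 4 * J 2 (fun x => f x ^+ 2) *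
   (\sum_i J 2 (fun x => partial i f x ^+ 2)).
Proof.
move=> cf; rewrite big_ord_recl big_ord1.
have p0 i : 0 <= J 2 (fun x => partial i f x ^+ 2).
  by apply: Rintegral_ge0 => x _; rewrite sqr_ge0.
have f20 : 0 <= J 2 (fun x => f x ^+ 2).
  by apply: Rintegral_ge0 => x _; rewrite sqr_ge0.
apply: amgm_opt => //; first by rewrite addr_ge0.
move=> lam l0.
have cf2 : C0c (fun x => f x ^+ 2) by apply: C0cX; case: cf.
have cp2 i : C0c (fun x => partial i f x ^+ 2) by apply: C0cX; exact: C1c_partial.
have := @sobolev_step _ f (fun x => lam * f x ^+ 2 + lam^-1 * partial (lift ord0 ord0) f x ^+ 2) _ l0 cf.
move=> /(_ _)/wrap[]; first by apply: C0cD; exact: C0c_cst_mul.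
move=> /(_ _)/wrap[].
  by move=> x; rewrite addr_ge0// mulr_ge0 ?sqr_ge0// ?invr_ge0 ltW.
move=> /(_ _)/wrap[].
  move=> t; have := sobolev1 l0 (C1c_slice t cf); rewrite mulrC.
  rewrite (partial_sliceE _ _ cf).
  rewrite RintegralD//; first by rewrite !RintegralZl//; apply: C0c_integrable => //;
     [exact: (@C0c_slice _ _ (fun x => partial (lift ord0 ord0) f x ^+ 2) t)|exact: (@C0c_slice _ _ (fun x => f x ^+ 2) t)].
  - by apply: C0c_integrable => //; apply: C0c_cst_mul; exact: (@C0c_slice _ _ (fun x => f x ^+ 2) t).
  - by apply: C0c_integrable => //; apply: C0c_cst_mul; exact: (@C0c_slice _ _ (fun x => partial (lift ord0 ord0) f x ^+ 2) t).
rewrite RintegralD//; [|apply: C0c_integrable => //; exact: C0c_cst_mul..].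
rewrite !RintegralZl//; [|exact: C0c_integrable..].
by move=> /le_trans; apply; exact: (sobolev2_step_arith l0 f20 (p0 _) (p0 _)).
Qed.

Lemma sobolev3_step_arith (I A B : R) : I <= 4 * A * B -> I <= A * (4 * B).
Proof. by rewrite mulrCA mulrA. Qed.

Lemma sobolev3_arith (a b c : R) : 0 <= a -> 0 <= b -> 0 <= c ->
  (1 * a + 1^-1 * b) * (4 * c) <= 4 * (a + (b + c)) ^+ 2.
Proof. by move=> a0 b0 c0; rewrite invr1 !mul1r; nra. Qed.

Lemma sobolev3 (f : 'rV[R]_3 -> R) : C1c f ->
  J 3 (fun x => f x ^+ 4) <=
  4 * (J 3 (fun x => f x ^+ 2) + \sum_i J 3 (fun x => partial i f x ^+ 2)) ^+ 2.
Proof.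
move=> cf.
have p0 i : 0 <= J 3 (fun x => partial i f x ^+ 2).
  by apply: Rintegral_ge0 => x _; rewrite sqr_ge0.
have f20 : 0 <= J 3 (fun x => f x ^+ 2).
  by apply: Rintegral_ge0 => x _; rewrite sqr_ge0.
have cp2 i : C0c (fun x => partial i f x ^+ 2) by apply: C0cX; exact: C1c_partial.
have cs : C0c (fun x => \sum_i partial (lift ord0 i : 'I_3) f x ^+ 2).
  by apply: C0c_sum => i; exact: cp2.
have := @sobolev_step _ f (fun x => 4 * \sum_i partial (lift ord0 i) f x ^+ 2) _ ltr01 cf.
move=> /(_ _)/wrap[]; first exact: C0c_cst_mul.
move=> /(_ _)/wrap[].
  by move=> x; rewrite mulr_ge0// sumr_ge0// => i _; rewrite sqr_ge0.
move=> /(_ _)/wrap[].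
  move=> t; have := sobolev2 (C1c_slice t cf).
  under eq_bigr do rewrite (partial_sliceE _ _ cf).
  rewrite RintegralZl//; last first.
    by apply: C0c_integrable => //; exact: (@C0c_slice _ _ (fun x => \sum_i partial (lift ord0 i) f x ^+ 2) t).
  rewrite C0c_Rintegral_sum => [|i]; first exact: sobolev3_step_arith.
  exact: (@C0c_slice _ _ (fun x => partial (lift ord0 i) f x ^+ 2) t).
rewrite RintegralZl//; last exact: C0c_integrable.
rewrite C0c_Rintegral_sum//.
move=> /le_trans; apply; rewrite [in leRHS]big_ord_recl.
by apply: sobolev3_arith => //; apply: sumr_ge0.
Qed.

Lemma sobolev1_arith (a b : R) : 0 <= a -> 0 <= b ->
  (1 * a + 1^-1 * b) * a <= 4 * (a + b) ^+ 2.
Proof. by move=> a0 b0; rewrite invr1 !mul1r; nra. Qed.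

Lemma sobolev2_arith (a b : R) : 0 <= a -> 0 <= b -> 4 * a * b <= 4 * (a + b) ^+ 2.
Proof. by move=> a0 b0; nra. Qed.

(** In dimension 1 the bound is A (lam A + B / lam); one more step gives
    (lam A + B / lam)^2 in dimension 2, which optimizes to 4 A B and so
    keeps the factor A that the step to dimension 3 requires. *)
Lemma sobolev (d : nat) (f : 'rV[R]_d -> R) : (1 <= d <= 3)%N -> C1c f ->
  J d (fun x => f x ^+ 4) <=
  4 * (J d (fun x => f x ^+ 2) + \sum_i J d (fun x => partial i f x ^+ 2)) ^+ 2.
Proof.
case: d f => [//|[|[|[|//]]]] f _ cf; last exact: sobolev3.
- have f20 : 0 <= J 1 (fun x => f x ^+ 2).
    by apply: Rintegral_ge0 => x _; rewrite sqr_ge0.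
  have p0 : 0 <= J 1 (fun x => partial ord0 f x ^+ 2).
    by apply: Rintegral_ge0 => x _; rewrite sqr_ge0.
  apply: le_trans (sobolev1 ltr01 cf) _; rewrite big_ord1.
  exact: sobolev1_arith.
- have f20 : 0 <= J 2 (fun x => f x ^+ 2).
    by apply: Rintegral_ge0 => x _; rewrite sqr_ge0.
  have p0 : 0 <= \sum_i J 2 (fun x => partial i f x ^+ 2).
    by apply: sumr_ge0 => i _; apply: Rintegral_ge0 => x _; rewrite sqr_ge0.
  apply: le_trans (sobolev2 cf) _; exact: sobolev2_arith.
Qed.

Lemma poincare_arith (a b M : R) : 0 < M ->
  a <= ((4 * M)^-1 * a + (4 * M)^-1^-1 * b) * (2 * M) -> a <= 16 * M ^+ 2 * b.
Proof.
move=> M0; rewrite invrK mulrDl.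
have -> : (4 * M)^-1 * a * (2 * M) = 2^-1 * a by field; rewrite gt_eqF.
rewrite expr2; lra.
Qed.

(** The mass is the integral of the slice masses over an interval of length
    2 M. For lam = 1 / (4 M) the bound of [slice_sup] returns half of the
    mass, which is absorbed. *)
Lemma poincare (n : nat) (f : 'rV[R]_n.+1 -> R) (M : R) : 0 < M -> C1c f ->
  (forall x, f x != 0 -> `|x ord0 ord0| <= M) ->
  J n.+1 (fun x => f x ^+ 2) <= 16 * M ^+ 2 * J n.+1 (fun x => partial ord0 f x ^+ 2).
Proof.
move=> M0 cf fM.
have cf2 : C0c (fun x => f x ^+ 2) by apply: C0cX; case: cf.
have l0 : 0 < (4 * M)^-1 by rewrite invr_gt0 mulr_gt0.
have p0 : 0 <= J n.+1 (fun x => partial ord0 f x ^+ 2).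
  by apply: Rintegral_ge0 => x _; rewrite sqr_ge0.
have f20 : 0 <= J n.+1 (fun x => f x ^+ 2).
  by apply: Rintegral_ge0 => x _; rewrite sqr_ge0.
set S := (4 * M)^-1 * J n.+1 (fun x => f x ^+ 2) +
   (4 * M)^-1^-1 * J n.+1 (fun x => partial ord0 f x ^+ 2).
suff : J n.+1 (fun x => f x ^+ 2) <= S * (2 * M).
  exact: poincare_arith.
have [E mE] := C0c_tonelli cf2 (fun x => sqr_ge0 _).
rewrite -lee_fin E.
have -> : (\int[leb1]_t (J n (fun y => f (rV_cons (t, y)) ^+ 2))%:E =
   \int[leb1]_(t in `[(- M)%R, M]) (J n (fun y => f (rV_cons (t, y)) ^+ 2))%:E)%E.
  rewrite [RHS]integral_mkcond; apply: eq_integral => t _; rewrite patchE.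
  case: ifPn => //; rewrite notin_setE/= in_itv/= -ler_norml => /negP tM.
  rewrite /Rintegral integral0_eq// => y _.
  have [->|/fM] := eqVneq (f (rV_cons (t, y))) 0; first by rewrite expr0n.
  by rewrite rV_cons0 (negbTE tM).
apply: (@le_trans _ _ (\int[leb1]_(t in `[(- M)%R, M]) S%:E)%E).
  apply: ge0_le_integral => //.
  - by move=> t _; rewrite lee_fin; apply: Rintegral_ge0 => x _; rewrite sqr_ge0.
  - exact: measurable_funTS.
  - by move=> t _; rewrite lee_fin; exact: slice_sup.
rewrite integral_cst//= lebesgue_measure_itv/= lte_fin ifT; last lra.
by rewrite -EFinD -EFinM lee_fin ler_wpM2l// /S ?addr_ge0 ?mulr_ge0 ?invr_ge0 ?(ltW l0)//; lra.
Qed.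

End sobolev.

(** * Riesz representation *)

Section riesz_representation.
Context (T : Type) (R : realType).
Implicit Types u v w z : T -> R.

(** The iterates are given as pointwise expressions, and their spaces as
    predicates on functions; closure under this one operation then expresses
    that such a predicate is a vector space. *)
Definition lc u (c : R) v : T -> R := fun x => u x + c * v x.

Lemma discriminant_le (a b c : R) : 0 <= c ->
  (forall t, 0 <= a + 2 * t * b + t ^+ 2 * c) -> b ^+ 2 <= a * c.
Proof.
move=> c0 H; have [c00|cn0] := eqVneq c 0.
  have [->|b0] := eqVneq b 0; first by rewrite c00 mulr0 expr0n.
  have := H (- (a + 1) / (2 * b)).
  have -> : 2 * (- (a + 1) / (2 * b)) * b = - (a + 1) by field.
  rewrite c00 mulr0; lra.
have cp : 0 < c by rewrite lt_neqAle eq_sym cn0.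
have := H (- b / c).
have -> : a + 2 * (- b / c) * b + (- b / c) ^+ 2 * c = (a * c - b ^+ 2) / c by field.
by rewrite pmulr_lge0 ?invr_gt0// subr_ge0.
Qed.

Variables (H : (T -> R) -> Prop) (A : (T -> R) -> (T -> R) -> R).
Hypothesis H_lc : forall u c v, H u -> H v -> H (lc u c v).
Hypothesis A_sym : forall u v, H u -> H v -> A u v = A v u.
Hypothesis A_lc : forall u c v w, H u -> H v -> H w -> A (lc u c v) w = A u w + c * A v w.
Hypothesis A_ge0 : forall u, H u -> 0 <= A u u.

Lemma form_lcr u c v w : H u -> H v -> H w -> A w (lc u c v) = A w u + c * A w v.
Proof.
move=> Hu Hv Hw; rewrite A_sym//; last exact: H_lc.
by rewrite A_lc// (A_sym Hu Hw) (A_sym Hv Hw).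
Qed.

Lemma form_lc_sqr u c v : H u -> H v ->
  A (lc u c v) (lc u c v) = A u u + 2 * c * A u v + c ^+ 2 * A v v.
Proof.
move=> Hu Hv; have Hw := H_lc c Hu Hv.
by rewrite A_lc// !form_lcr// (A_sym Hv Hu); ring.
Qed.

Lemma cauchy_schwarz u v : H u -> H v -> A u v ^+ 2 <= A u u * A v v.
Proof.
move=> Hu Hv; apply: discriminant_le; first exact: A_ge0.
by move=> t; rewrite -form_lc_sqr//; apply: A_ge0; exact: H_lc.
Qed.

Lemma form_lc_le u c v : H u -> H v ->
  A (lc u c v) (lc u c v) <= 2 * A u u + 2 * c ^+ 2 * A v v.
Proof.
move=> Hu Hv; have := A_ge0 (H_lc (- c) Hu Hv).
by rewrite !form_lc_sqr// sqrrN; lra.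
Qed.

Hypothesis A_complete : forall z : nat -> T -> R, (forall k, H (z k)) ->
  (forall e, 0 < e -> exists N, forall m n, (N <= m)%N -> (N <= n)%N ->
     A (lc (z m) (-1) (z n)) (lc (z m) (-1) (z n)) <= e) ->
  exists2 g, H g & forall e, 0 < e -> exists N, forall n, (N <= n)%N ->
     A (lc (z n) (-1) g) (lc (z n) (-1) g) <= e.

(** A minimizing sequence of A(z,z) - 2 l(z) is Cauchy by the parallelogram
    identity. At almost minimal points the first variation is almost 0,
    which in the limit is the required identity. *)
Lemma riesz (l : (T -> R) -> R) (C : R) : 0 <= C -> (exists z, H z) ->
  (forall u c v, H u -> H v -> l (lc u c v) = l u + c * l v) ->
  (forall z, H z -> l z ^+ 2 <= C * A z z) ->
  exists2 g, H g & forall z, H z -> A z g = l z.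
Proof.
move=> C0 [z0 Hz0] l_lc l_bd.
pose J z := A z z - 2 * l z.
have J_ge z : H z -> - C <= J z.
  move=> Hz; have := l_bd _ Hz; have := A_ge0 Hz.
  rewrite /J; move: (A z z) (l z) => a b a0 ab; rewrite leNgt; apply/negP => h.
  have : (a + C) ^+ 2 < (2 * b) ^+ 2 by rewrite ltr_sqr ?nnegrE; lra.
  have := sqr_ge0 (a - C); rewrite !expr2; rewrite expr2 in ab; lra.
pose S := [set J z | z in H].
have infS : has_inf S by split; [exists (J z0), z0|exists (- C) => _ [z Hz <-]; exact: J_ge].
pose m := inf S.
have mJ z : H z -> m <= J z.
  by move=> Hz; apply: ge_inf; [exact: infS.2|exists z].
have /choice[z zP] : forall k : nat, exists z, H z /\ J z <= m + k.+1%:R^-1.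
  move=> k; have e0 : 0 < (k.+1%:R^-1 : R) by rewrite invr_gt0.
  have [_ [z Hz <-] /ltW] := inf_adherent e0 infS.
  by exists z.
have Hz k : H (z k) by case: (zP k).
have zm k : J (z k) <= m + k.+1%:R^-1 by case: (zP k).
have J_lc u c v : H u -> H v -> J (lc u c v) = J u + 2 * c * (A u v - l v) + c ^+ 2 * A v v.
  by move=> Hu Hv; rewrite /J form_lc_sqr// l_lc//; ring.
have pyth k n : A (lc (z k) (-1) (z n)) (lc (z k) (-1) (z n)) <=
    2 * (k.+1%:R^-1 + n.+1%:R^-1).
  have Hd : H (lc (z n) (-1) (z k)) by exact: H_lc.
  (* The infimum is compared with the value at the midpoint of [z k] and [z
     n]. *)
  have := mJ _ (H_lc 2^-1 (Hz k) Hd).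
  rewrite J_lc// (form_lcr (-1) (Hz n) (Hz k) (Hz k)) l_lc// !form_lc_sqr//.
  have := zm k; have := zm n; rewrite /J (A_sym (Hz n) (Hz k)).
  by move: (k.+1%:R^-1 : R) (n.+1%:R^-1 : R) => ek en; rewrite !expr2; lra.
have inv_small (e : R) : 0 < e ->
    exists N : nat, forall n, (N <= n)%N -> n.+1%:R^-1 <= e.
  move=> e0; exists (Num.truncn e^-1) => n Nn.
  rewrite -[e]invrK lef_pV2 ?posrE ?invr_gt0//.
  by rewrite (le_trans (ltW (truncnS_gt _)))// ler_nat.
have [|g Hg gP] := A_complete Hz.
  move=> e e0; have e40 : 0 < e / 4 by rewrite divr_gt0.
  have [N NP] := inv_small _ e40; exists N => p n Np Nn.
  apply: le_trans (pyth p n) _; have := NP _ Np; have := NP _ Nn.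
  by move: (p.+1%:R^-1 : R) (n.+1%:R^-1 : R) => ek en; lra.
exists g => // w Hw.
(* The variations z k + t w stay above the infimum, so the discriminant of
   a nonnegative quadratic polynomial in [t] is bounded. *)
have near k : (A (z k) w - l w) ^+ 2 <= k.+1%:R^-1 * A w w.
  apply: discriminant_le; first exact: A_ge0.
  move=> t; have := mJ _ (H_lc t (Hz k) Hw); rewrite J_lc//.
  by have := zm k; move: (k.+1%:R^-1 : R) => ek; lra.
have Aww := A_ge0 Hw.
apply/eqP; rewrite -subr_eq0 -sqrf_eq0 eq_le sqr_ge0 andbT.
apply/ler_addgt0Pr => e e0; rewrite add0r.
pose e' := e / (4 * (A w w + 1)).
have e'0 : 0 < e' by rewrite divr_gt0// mulr_gt0//; lra.
have [N1 N1P] := gP _ e'0; have [N2 N2P] := inv_small _ e'0.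
pose k := maxn N1 N2.
have h1 := N1P k (leq_maxl _ _); have h2 := N2P k (leq_maxr _ _).
have h3 := near k.
have Hkg : H (lc (z k) (-1) g) by exact: H_lc.
have h4 := cauchy_schwarz Hkg Hw.
rewrite A_lc// in h4.
have h5 : A (lc (z k) (-1) g) (lc (z k) (-1) g) * A w w <= e' * A w w by rewrite ler_wpM2r.
have h6 : k.+1%:R^-1 * A w w <= e' * A w w by rewrite ler_wpM2r.
have h7 : e' * (A w w + 1) * 4 = e.
  by rewrite /e'; field; rewrite gt_eqF//; lra.
rewrite (A_sym Hw Hg).
move: h2 h6 h3 h4; move: (k.+1%:R^-1 : R) => ek h2 h6; set p := A (z k) w; set q := A g w => h3 h4.
have : (q - l w) ^+ 2 <= 2 * (p - l w) ^+ 2 + 2 * (p + -1 * q) ^+ 2.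
  have := sqr_ge0 ((p - l w) + (p + -1 * q)); rewrite !expr2; lra.
lra.
Qed.

End riesz_representation.

(** * Weak gradients *)

Section weak_gradients.
Context (R : realType) (d : nat) (Omega : set 'rV[R]_d).
Hypothesis oO : open Omega.
Hypothesis bO : bounded_set Omega.
Notation mu := (leb R d).
Notation I f := (\int[mu]_(x in Omega) f x).
Notation sq := (sqint mu Omega).
Notation L1 := (intble mu Omega).

Let mO : measurable Omega. Proof. exact: open_measurable_rV. Qed.

Lemma bounded_set_coord (B : set 'rV[R]_d) : bounded_set B ->
  exists2 M : R, 0 < M & forall x, B x -> forall i, `|x ord0 i| <= M.
Proof.
move=> [K [Kr HK]]; exists (`|K| + 1) => [|x Bx i]; first by rewrite ltr_wpDl.
apply: (@le_trans _ _ `|x|).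
  by rewrite [leRHS]mx_normrE (le_bigmax _ (fun j => `|x j.1 j.2|) (ord0, i)).
by apply: (HK (`|K| + 1)) => //; rewrite (le_lt_trans (ler_norm K))// ltrDl.
Qed.

Lemma leb_bounded_lty : (mu Omega < +oo)%E.
Proof.
have [M M0 OM] := bounded_set_coord bO.
have [B mB [Boo MB]] := leb_bounded_support d M.
apply: le_lt_trans Boo; apply: le_measure; rewrite ?inE//.
by move=> x /OM; exact: MB.
Qed.

Lemma L2_sqintP u : L2 Omega u <-> sq u.
Proof.
have mpow (f : 'rV[R]_d -> R) : ((fun x => `|f x| `^ 2) = (fun x => f x ^+ 2)).
  by apply/funext => x; rewrite powR_mulrn// real_normK ?num_real.
have restr : (fun x => (((u \_ Omega) x) ^+ 2)%:E) = ((fun x => (u x ^+ 2)%:E) \_ Omega).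
  by apply/funext => x; rewrite !patchE; case: ifP => // _; rewrite expr0n.
split=> [Lu|[mu_ Iu]].
  have mu_ : measurable_fun Omega u.
    apply/(measurable_restrictT _ mO).
    by move: Lu; rewrite /L2 inE => /andP[/[!inE]].
  split => //.
  have /Lfun2_integrable_sqr := Lu.
  rewrite (_ : EFin \o _ = ((fun x => (u x ^+ 2)%:E) \_ Omega)).
    by move=> H; apply/(integrable_mkcond _ mO).
  by rewrite -restr; apply/funext => x.
rewrite /L2 inE/=; apply/andP; split; rewrite inE/=.
  by apply/(measurable_restrictT _ mO).
rewrite /finite_norm unlock /Lnorm/=; apply: poweR_lty.
have := (integrableP _ _ _ Iu).2; rewrite integral_mkcond => H.
rewrite (_ : (fun x => _) = (fun x => (((u \_ Omega) x) ^+ 2)%:E)); last first.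
  by apply/funext => x; rewrite /= powR_mulrn// real_normK ?num_real.
rewrite restr; apply: le_lt_trans H; rewrite le_eqVlt; apply/orP; left; apply/eqP.
apply: eq_integral => x _; rewrite !patchE; case: ifP => // _.
by rewrite /= ger0_norm ?sqr_ge0.
Qed.

Lemma test_bounded_support phi : test_function Omega phi -> bounded_support phi.
Proof.
move=> [_ [/compact_bounded/bounded_set_coord[M M0 HM] _]]; exists M => x px i.
by apply: HM; exact: subset_closure.
Qed.

Lemma test_C1c phi : test_function Omega phi -> C1c phi.
Proof.
move=> tp; have bp := test_bounded_support tp; have [/(_ 1%N)/=[cp dp] _] := tp.
by split; [split|move=> i x; case: (dp i)|move=> i; case: (dp i)].
Qed.

Lemma test_out phi x : test_function Omega phi -> ~ Omega x ->
  phi x = 0 /\ forall i, partial i phi x = 0.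
Proof.
move=> [_ [_ sO]] nOx.
have nc : (~` closure [set x | phi x != 0]) x by move=> /sO.
have : \forall y \near x, phi y = 0.
  have oc : open (~` closure [set x | phi x != 0]) by exact/closed_openC/closed_closure.
  apply: filterS (open_nbhs_nbhs (conj oc nc)) => y ny.
  by apply/eqP; apply: contra_notT ny => py; exact: subset_closure.
move=> nx; split; first exact: nbhs_singleton nx.
by move=> i; rewrite /partial (@near_eq_derive _ _ _ _ (cst 0)) ?derive_cst.
Qed.

Lemma Rintegral_zero_outside (f : 'rV[R]_d -> R) : (forall x, ~ Omega x -> f x = 0) ->
  I f = \int[mu]_x f x.
Proof.
move=> f0; rewrite Rintegral_mkcond; congr Rintegral; apply/funext => x.
rewrite patchE; case: ifPn => //; rewrite notin_setE => /f0 //.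
Qed.

Lemma partialM (f g : 'rV[R]_d -> R) i : C1c f -> C1c g ->
  (forall x, is_derive x (delta_mx ord0 i) (fun x => f x * g x)
    (f x * partial i g x + partial i f x * g x)).
Proof.
move=> [_ df _] [_ dg _] x.
have := is_deriveM (derivableP (df i x)) (derivableP (dg i x)).
by rewrite [_ *: 'D__ f x]mulrC.
Qed.

Lemma C1cM (f g : 'rV[R]_d -> R) : C1c f -> C1c g -> C1c (fun x => f x * g x).
Proof.
move=> cf cg; have [cf0 df cdf] := cf; have [[cg0 bg] dg cdg] := cg; split.
- exact: C0cM.
- by move=> i x; apply: (@ex_derive _ _ _ _ _ _ _ (partialM i cf cg x)).
- move=> i; rewrite (_ : partial i _ = fun x => f x * partial i g x + partial i f x * g x).
    move=> x; apply: (@continuousD _ _ _ (fun x => f x * partial i g x) (fun x => partial i f x * g x)).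
      by apply: (@continuousM _ _ f (partial i g)); [exact: cf0.1|exact: cdg].
    by apply: (@continuousM _ _ (partial i f) g); [exact: cdf|exact: cg0].
  by apply/funext => x; apply: (@derive_val _ _ _ _ _ _ _ (partialM i cf cg x)).
Qed.

(** The product of two test functions has partial derivatives of integral 0. *)
Lemma test_ibp (phi psi : 'rV[R]_d -> R) i :
  test_function Omega phi -> test_function Omega psi ->
  L2_ip Omega phi (partial i psi) = - L2_ip Omega (partial i phi) psi.
Proof.
move=> tp ts; have cp := test_C1c tp; have cs := test_C1c ts.
apply/eqP; rewrite -addr_eq0 /L2_ip !Rintegral_zero_outside; last 2 first.
- by move=> x /(test_out ts)[-> _]; rewrite mulr0.
- by move=> x /(test_out tp)[-> _]; rewrite mul0r.
have i1 : C0c (fun x => phi x * partial i psi x).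
  by apply: C0cM; [case: cp|case: cs].
have i2 : C0c (fun x => partial i phi x * psi x).
  by apply: C0cM; [exact: C1c_partial|case: cs => -[]].
rewrite -RintegralD//; [|exact: C0c_integrable..].
rewrite /Rintegral.
have := integral_partial i (C1cM cp cs).
rewrite (_ : partial i _ = fun x => phi x * partial i psi x + partial i phi x * psi x).
  by move=> ->.
by apply/funext => x; apply: (@derive_val _ _ _ _ _ _ _ (partialM i cp cs x)).
Qed.

Lemma C0c_sqint (f : 'rV[R]_d -> R) : C0c f -> sq f.
Proof.
move=> cf; split; first by apply: measurable_funTS; apply: continuous_measurable_rV; case: cf.
by apply: (@C0c_integrable _ _ (fun x => f x ^+ 2)); [exact: mO|exact: C0cX].
Qed.

Lemma test_weak_gradient phi : test_function Omega phi ->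
  weak_gradient Omega phi (fun x => \row_i partial i phi x).
Proof.
move=> tp; have cp := test_C1c tp; split.
  move=> i; apply/L2_sqintP; rewrite (_ : (fun x => _) = partial i phi).
    by apply: C0c_sqint; exact: C1c_partial.
  by apply/funext => x; rewrite mxE.
move=> psi ts i; rewrite test_ibp//; congr (- L2_ip _ _ _).
by apply/funext => x; rewrite mxE.
Qed.

Lemma weak_gradient_unique u g h : weak_gradient Omega u g -> weak_gradient Omega u h ->
  {ae mu, forall x, Omega x -> g x = h x}.
Proof.
move=> [Lg gP] [Lh hP].
suff : {ae mu, forall x, forall i : 'I_d, Omega x -> g x ord0 i = h x ord0 i}.
  by apply: filterS => x Hx Ox; apply/rowP => i; exact: Hx.
apply: filter_forall => i.
have sg : sq (fun x => g x ord0 i) by exact/L2_sqintP.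
have sh : sq (fun x => h x ord0 i) by exact/L2_sqintP.
have sgh := sqintB mO sg sh.
have := @ae_eq0_test _ _ Omega _ oO (sqint_intble mO leb_bounded_lty sgh).
move=> /(_ _)/wrap[].
  move=> phi tp; rewrite /L2_ip.
  have sp : sq phi by apply: C0c_sqint; case: (test_C1c tp).
  under eq_Rintegral do rewrite mulrBl.
  rewrite RintegralB//; [|exact: (sqintM mO sg sp)|exact: (sqintM mO sh sp)].
  have := gP _ tp i; rewrite (hP _ tp i) /L2_ip => /oppr_inj ->.
  by rewrite subrr.
by apply: filterS => x Hx /Hx/eqP; rewrite subr_eq0 => /eqP.
Qed.

Lemma weak_gradient_lc u v c g h :
  sq u -> sq v -> weak_gradient Omega u g -> weak_gradient Omega v h ->
  weak_gradient Omega (lc u c v) (fun x => g x + c *: h x).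
Proof.
move=> su sv [Lg gP] [Lh hP]; split.
  move=> i; apply/L2_sqintP; under eq_fun do rewrite !mxE.
  by apply: (sqintD mO); [exact/L2_sqintP|apply: (sqintZ mO); exact/L2_sqintP].
move=> phi tp i; have cp := test_C1c tp.
have sp : sq phi by apply: C0c_sqint; case: cp.
have sdp : sq (partial i phi) by apply: C0c_sqint; exact: C1c_partial.
have := gP _ tp i; have := hP _ tp i; rewrite /L2_ip => h1 h2.
under eq_Rintegral do rewrite /lc mulrDl -mulrA.
rewrite (Rintegral_intbleD mO); [|exact: (sqintM mO su sdp)|apply: (intbleZ mO); exact: (sqintM mO sv sdp)].
rewrite (Rintegral_intbleZ mO); last exact: (sqintM mO sv sdp).
under [in RHS]eq_Rintegral do rewrite !mxE mulrDl -mulrA.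
have sg : sq (fun x => g x ord0 i) by exact/L2_sqintP.
have sh : sq (fun x => h x ord0 i) by exact/L2_sqintP.
rewrite (Rintegral_intbleD mO); [|exact: (sqintM mO sg sp)|apply: (intbleZ mO); exact: (sqintM mO sh sp)].
rewrite (Rintegral_intbleZ mO); last exact: (sqintM mO sh sp).
by rewrite h1 h2 mulrN opprD.
Qed.

End weak_gradients.

(** * The energy form on H^1 *)

Section energy_form.
Context (R : realType) (d : nat) (Omega : set 'rV[R]_d).
Hypothesis oO : open Omega.
Hypothesis bO : bounded_set Omega.
Notation mu := (leb R d).
Notation I f := (\int[mu]_(x in Omega) f x).
Notation sq := (sqint mu Omega).
Notation L1 := (intble mu Omega).
Notation H1 := (H1 Omega).
Let mO := open_measurable_rV oO.
Let fO := leb_bounded_lty oO bO.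

Lemma H1_sqint u : H1 u -> sq u. Proof. by case=> /(L2_sqintP oO). Qed.

Lemma H1_grad u : H1 u -> weak_gradient Omega u (grad Omega u).
Proof. by move=> [_ ug]; rewrite /grad; apply: xgetPex. Qed.

Lemma grad_sqint u i : H1 u -> sq (fun x => grad Omega u x ord0 i).
Proof. by move=> /H1_grad[/(_ i)/(L2_sqintP oO)]. Qed.

Lemma weak_gradient_H1 u g : sq u -> weak_gradient Omega u g -> H1 u.
Proof. by move=> /(L2_sqintP oO) Lu ug; split => //; exists g. Qed.

Lemma H1_lc u c v : H1 u -> H1 v -> H1 (lc u c v).
Proof.
move=> Hu Hv; have su := H1_sqint Hu; have sv := H1_sqint Hv.
apply: weak_gradient_H1 (weak_gradient_lc oO c su sv (H1_grad Hu) (H1_grad Hv)).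
exact: (sqintD mO su (sqintZ mO c sv)).
Qed.

Lemma grad_lc u c v : H1 u -> H1 v -> {ae mu, forall x, Omega x ->
  grad Omega (lc u c v) x = grad Omega u x + c *: grad Omega v x}.
Proof.
move=> Hu Hv; have su := H1_sqint Hu; have sv := H1_sqint Hv.
exact: (weak_gradient_unique oO bO (H1_grad (H1_lc c Hu Hv))
   (weak_gradient_lc oO c su sv (H1_grad Hu) (H1_grad Hv))).
Qed.

Lemma dotC (a b : 'rV[R]_d) : dot a b = dot b a.
Proof. by apply: eq_bigr => i _; rewrite mulrC. Qed.

Lemma dot_lc (a b e : 'rV[R]_d) c : dot (a + c *: b) e = dot a e + c * dot b e.
Proof.
rewrite /dot mulr_sumr -big_split/=; apply: eq_bigr => i _; rewrite !mxE; ring.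
Qed.

Lemma dot_ge0 (a : 'rV[R]_d) : 0 <= dot a a.
Proof. by apply: sumr_ge0 => i _; rewrite -expr2 sqr_ge0. Qed.

Lemma dot_intble u v : H1 u -> H1 v ->
  L1 (fun x => dot (grad Omega u x) (grad Omega v x)).
Proof.
move=> Hu Hv; apply: (intble_sum mO) => i.
exact: (sqintM mO (grad_sqint i Hu) (grad_sqint i Hv)).
Qed.

Section potential.
Context (V : 'rV[R]_d -> R).
Hypothesis hV : potential Omega V.

Lemma potential_bound : exists2 K, 0 <= K &
  {ae mu, forall x, Omega x -> 0 <= V x <= K}.
Proof.
have [_ [K VK]] := hV; exists `|K| => //; apply: filterS VK => x Vx /Vx/andP[-> h].
by rewrite (le_trans h)// ler_norm.
Qed.

(** The bounds on [V] hold almost everywhere only; truncating [V] makes them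
    hold everywhere. *)
Lemma potential_intble u v : sq u -> sq v -> L1 (fun x => V x * u x * v x).
Proof.
move=> su sv; have [K K0 VK] := potential_bound; have [mV _] := hV.
have mu_ := su.1; have mv := sv.1.
pose W x := Num.max 0 (Num.min (V x) K).
have mW : measurable_fun Omega W.
  by apply: measurable_maxr => //; apply: measurable_minr.
have WK x : `|W x| <= K.
  rewrite ger0_norm /W; last by rewrite le_max lexx.
  by rewrite ge_max K0 ge_min lexx orbT.
apply: (@intble_ae _ _ _ _ _ mO _ (fun x => W x * (u x * v x))).
- by apply: measurable_funM => //; exact: measurable_funM.
- have sW : sq (fun x => W x * u x).
    apply: (sqint_le mO _ (sqintZ mO K su)); first exact: measurable_funM.
    by move=> x _; rewrite !normrM ler_wpM2r// (ger0_norm K0).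
  by have := sqintM mO sW sv; congr intble; apply/funext => x; rewrite mulrA.
- apply: filterS VK => x Vx /Vx/andP[V0 VK']; rewrite /W.
  by rewrite (min_idPl VK') (max_idPr V0) mulrA.
Qed.

Lemma a0_intble u v : H1 u -> H1 v ->
  L1 (fun x => dot (grad Omega u x) (grad Omega v x) + V x * u x * v x).
Proof.
move=> Hu Hv; apply: (intbleD mO); first exact: dot_intble.
by apply: potential_intble; exact: H1_sqint.
Qed.

Lemma a0_sym u v : a0_ip Omega V u v = a0_ip Omega V v u.
Proof. by apply: eq_Rintegral => x _; rewrite dotC mulrAC. Qed.

Lemma a0_lc u c v w : H1 u -> H1 v -> H1 w ->
  a0_ip Omega V (lc u c v) w = a0_ip Omega V u w + c * a0_ip Omega V v w.
Proof.
move=> Hu Hv Hw; rewrite /a0_ip -(Rintegral_intbleZ mO); last exact: a0_intble.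
rewrite -(Rintegral_intbleD mO); [|exact: a0_intble|apply: (intbleZ mO); exact: a0_intble].
apply: (Rintegral_ae_eq mO).
- by apply: intble_measurable; apply: a0_intble => //; exact: H1_lc.
- apply: intble_measurable; apply: (intbleD mO); first exact: a0_intble.
  by apply: (intbleZ mO); exact: a0_intble.
- by apply: filterS (grad_lc c Hu Hv) => x Hx Ox; rewrite Hx// dot_lc /lc; ring.
Qed.

Lemma a0_ge0 u : H1 u -> 0 <= a0_ip Omega V u u.
Proof.
move=> Hu; have [K K0 VK] := potential_bound.
have -> : 0 = I (cst 0) :> R by rewrite Rintegral_cst ?mul0r.
apply: (Rintegral_le_ae mO); [exact: integrable0|exact: a0_intble|].
apply: filterS VK => x Vx /Vx/andP[V0 _]; rewrite addr_ge0 ?dot_ge0//.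
by rewrite -mulrA -expr2 mulr_ge0 ?sqr_ge0.
Qed.

End potential.

Lemma potential_cst (c : R) : 0 <= c -> potential Omega (cst c).
Proof.
move=> c0; split; first exact: measurable_cst.
by exists c; apply/aeW => x _; rewrite /= c0 lexx.
Qed.

(** Different potentials give comparable forms. The potentials 0 and 1 give
    the squared norms of the gradient and of H^1. *)
Lemma a0_mono V W u : potential Omega V -> potential Omega W ->
  {ae mu, forall x, Omega x -> V x <= W x} -> H1 u ->
  a0_ip Omega V u u <= a0_ip Omega W u u.
Proof.
move=> hV hW VW Hu; apply: (Rintegral_le_ae mO); [exact: a0_intble..|].
apply: filterS VW => x Vx /Vx h; rewrite lerD2l -!mulrA ler_wpM2r//.
by rewrite -expr2 sqr_ge0.
Qed.

Lemma a0_split V u : potential Omega V -> H1 u ->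
  a0_ip Omega V u u = a0_ip Omega (cst 0) u u + I (fun x => V x * u x * u x).
Proof.
move=> hV Hu; rewrite /a0_ip (Rintegral_intbleD mO); [|exact: dot_intble|].
  by congr (_ + _); apply: eq_Rintegral => x _; rewrite /= !mul0r addr0.
by apply: (potential_intble hV); exact: H1_sqint.
Qed.

End energy_form.

(** * The space H^1_0 *)

Lemma ltr_sqrt_le (R : realType) (a e : R) : 0 <= a -> 0 < e -> Num.sqrt a < Num.sqrt e -> a <= e.
Proof. by move=> a0 e0 h; apply: ltW; rewrite -ltr_sqrt. Qed.

Section sobolev_space.
Context (R : realType) (d : nat) (Omega : set 'rV[R]_d).
Hypothesis oO : open Omega.
Hypothesis bO : bounded_set Omega.
Notation mu := (leb R d).
Notation I f := (\int[mu]_(x in Omega) f x).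
Notation sq := (sqint mu Omega).
Notation L1 := (intble mu Omega).
Notation H1 := (H1 Omega).
Notation H10 := (H10 Omega).
Notation A0 := (a0_ip Omega (cst 0)).
Notation A1 := (a0_ip Omega (cst 1)).
Let mO := open_measurable_rV oO.
Let fO := leb_bounded_lty oO bO.

Let p0 : potential Omega (cst 0). Proof. exact: potential_cst. Qed.
Let p1 : potential Omega (cst 1). Proof. exact: potential_cst. Qed.

Lemma a0_quad V u c v : potential Omega V -> H1 u -> H1 v ->
  a0_ip Omega V (lc u c v) (lc u c v) =
  a0_ip Omega V u u + 2 * c * a0_ip Omega V u v + c ^+ 2 * a0_ip Omega V v v.
Proof.
move=> hV Hu Hv; apply: (@form_lc_sqr _ _ H1) => //; first exact: H1_lc.
- by move=> *; exact: a0_sym.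
- by move=> *; exact: a0_lc.
Qed.

Lemma a0_lc_le V u c v : potential Omega V -> H1 u -> H1 v ->
  a0_ip Omega V (lc u c v) (lc u c v) <=
  2 * a0_ip Omega V u u + 2 * c ^+ 2 * a0_ip Omega V v v.
Proof.
move=> hV Hu Hv; apply: (@form_lc_le _ _ H1) => //; first exact: H1_lc.
- by move=> *; exact: a0_sym.
- by move=> *; exact: a0_lc.
- by move=> *; exact: a0_ge0.
Qed.

Lemma a0_ip1E u : H1 u -> A1 u u = A0 u u + I (fun x => u x ^+ 2).
Proof.
move=> Hu; rewrite (a0_split oO p1 Hu); congr (_ + _).
by apply: eq_Rintegral => x _; rewrite /= mul1r expr2.
Qed.

Lemma H1_normE u : H1_norm Omega u = Num.sqrt (A1 u u).
Proof.
rewrite /H1_norm; congr Num.sqrt; apply: eq_Rintegral => x _ /=.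
by rewrite mul1r expr2 addrC.
Qed.

Lemma continuously_differentiable_lc k (phi psi : 'rV[R]_d -> R) c :
  continuously_differentiable k phi -> continuously_differentiable k psi ->
  continuously_differentiable k (lc phi c psi).
Proof.
have clc f g : continuous f -> continuous g -> continuous (lc f c g : 'rV[R]_d -> R).
  move=> cf cg x; apply: (@continuousD _ _ _ f (fun x => c * g x)); first exact: cf.
  by apply: (@continuousM _ _ (cst c) g); [exact: cst_continuous|exact: cg].
elim: k phi psi => [|k IH] phi psi /=; first exact: clc.
move=> [cp dp] [cs ds]; split; first exact: clc.
move=> i; have [dpi cpi] := dp i; have [dsi csi] := ds i.
have D x : is_derive x (delta_mx ord0 i) (lc phi c psi) (partial i phi x + c * partial i psi x).
  have := is_deriveD (derivableP (dpi x)) (is_deriveZ c (derivableP (dsi x))).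
  by [].
split; first by move=> x; apply: (@ex_derive _ _ _ _ _ _ _ (D x)).
rewrite (_ : partial i (lc phi c psi) = lc (partial i phi) c (partial i psi)); first exact: IH.
by apply/funext => x; apply: (@derive_val _ _ _ _ _ _ _ (D x)).
Qed.

Lemma test_lc (phi psi : 'rV[R]_d -> R) c :
  test_function Omega phi -> test_function Omega psi -> test_function Omega (lc phi c psi).
Proof.
move=> [dp [kp sp]] [ds [ks ss]]; split.
  by move=> k; exact: continuously_differentiable_lc.
have sub : closure [set x | lc phi c psi x != 0] `<=`
    closure [set x | phi x != 0] `|` closure [set x | psi x != 0].
  rewrite -closureU; apply: closureS => x /= h.
  have [px|] := eqVneq (phi x) 0; last by left.
  have [sx|] := eqVneq (psi x) 0; last by right.
  by move: h; rewrite /lc px sx mulr0 addr0 eqxx.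
split; last by move=> x /sub[/sp|/ss].
by apply: subclosed_compact sub; [exact: closed_closure|exact: compactU].
Qed.

Lemma test_H1 phi : test_function Omega phi -> H1 phi.
Proof.
move=> tp; apply: (weak_gradient_H1 oO) (test_weak_gradient oO tp).
by apply: (C0c_sqint oO); case: (test_C1c tp).
Qed.

Lemma a0_ip0_weak_gradient v h : H1 v -> weak_gradient Omega v h ->
  A0 v v = \sum_i I (fun x => h x ord0 i ^+ 2).
Proof.
move=> Hv vh.
have sh i : sq (fun x => h x ord0 i) by case: vh => /(_ i)/(L2_sqintP oO).
rewrite -(Rintegral_intble_sum mO (fun i => (sh i).2)); apply: (Rintegral_ae_eq mO).
- by apply: intble_measurable; exact: a0_intble.
- by apply: intble_measurable; apply: (intble_sum mO) => i; exact: (sh i).2.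
- apply: filterS (weak_gradient_unique oO bO (H1_grad Hv) vh).
  by move=> x Hx Ox; rewrite Hx// /= !mul0r addr0; apply: eq_bigr => i _; rewrite expr2.
Qed.

Lemma a0_ip0_test phi : test_function Omega phi ->
  A0 phi phi = \sum_i I (fun x => partial i phi x ^+ 2).
Proof.
move=> tp; rewrite (a0_ip0_weak_gradient (test_H1 tp) (test_weak_gradient oO tp)).
by apply: eq_bigr => i _; apply: eq_Rintegral => x _; rewrite mxE.
Qed.

(** Approximability by single test functions, in terms of the form of H^1,
    which dispenses with sequences and square roots. *)
Lemma H10P u : H10 u <-> H1 u /\ forall e, 0 < e ->
  exists2 phi, test_function Omega phi & A1 (lc u (-1) phi) (lc u (-1) phi) <= e.
Proof.
have E (phi : 'rV[R]_d -> R) : (fun x => u x - phi x) = lc u (-1) phi.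
  by apply/funext => x; rewrite /lc mulN1r.
split=> [[Hu [phi [tp cvp]]]|[Hu HP]]; split => //.
  move=> e e0; move/cvgrPdist_lt : cvp => /(_ (Num.sqrt e)).
  rewrite sqrtr_gt0 => /(_ e0)[N _ /(_ N (leqnn N))] /=.
  rewrite sub0r normrN E H1_normE ger0_norm ?sqrtr_ge0// => h.
  exists (phi N); first exact: tp.
  apply: ltr_sqrt_le h => //; apply: a0_ge0 => //.
  by apply: H1_lc => //; exact: test_H1.
have /choice[phi phiP] : forall k : nat, exists phi, test_function Omega phi /\
    A1 (lc u (-1) phi) (lc u (-1) phi) <= k.+1%:R^-1 ^+ 2.
  move=> k; have [|phi tp h] := HP (k.+1%:R^-1 ^+ 2); last by exists phi.
  by rewrite exprn_gt0.
exists phi; split; first by move=> k; case: (phiP k).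
apply: (@squeeze_cvgr _ _ _ _ (cst 0) (fun k : nat => k.+1%:R^-1)).
- apply: nearW => k; have [tp h] := phiP k; rewrite E H1_normE sqrtr_ge0/=.
  have i0 : 0 <= (k.+1%:R^-1 : R) by [].
  by rewrite -[leRHS](ger0_norm i0) -sqrtr_sqr ler_wsqrtr.
- exact: cvg_cst.
- exact: cvg_harmonic.
Qed.

Lemma H10_H1 u : H10 u -> H1 u. Proof. by case. Qed.

Lemma H10_lc u c v : H10 u -> H10 v -> H10 (lc u c v).
Proof.
move=> /H10P[Hu uP] /H10P[Hv vP]; apply/H10P; split; first exact: H1_lc.
move=> e e0; pose c2 := 2 * c ^+ 2 + 1.
have c20 : 0 < c2 by rewrite /c2; have := sqr_ge0 c; lra.
have [|phi tp hp] := uP (e / 4); first by rewrite divr_gt0.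
have [|psi ts hs] := vP (e / (2 * c2)); first by rewrite divr_gt0// mulr_gt0.
exists (lc phi c psi); first exact: test_lc.
have Hp := test_H1 tp; have Hs := test_H1 ts.
have -> : lc (lc u c v) (-1) (lc phi c psi) = lc (lc u (-1) phi) c (lc v (-1) psi).
  by apply/funext => x; rewrite /lc; ring.
have K := a0_lc_le c p1 (H1_lc oO (-1) Hu Hp) (H1_lc oO (-1) Hv Hs).
apply: (le_trans K).
set a := A1 _ _ in hp *; set b := A1 _ _ in hs *.
have h1 : 2 * c ^+ 2 * b <= c2 * (e / (2 * c2)).
  apply: (@le_trans _ _ (2 * c ^+ 2 * (e / (2 * c2)))).
    by rewrite ler_wpM2l// mulr_ge0// sqr_ge0.
  rewrite ler_wpM2r//; last by rewrite /c2; lra.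
  by rewrite divr_ge0 ?(ltW e0)// mulr_ge0// ltW.
have h2 : c2 * (e / (2 * c2)) = e / 2 by field; rewrite gt_eqF.
lra.
Qed.

End sobolev_space.

(** * Embeddings of H^1_0 *)

Lemma poincare_test (R : realType) (d : nat) (Omega : set 'rV[R]_d) :
  (0 < d)%N -> open Omega -> bounded_set Omega ->
  exists2 C : R, 0 <= C & forall phi, test_function Omega phi ->
    \int[leb R d]_(x in Omega) (phi x ^+ 2) <= C * a0_ip Omega (cst 0) phi phi.
Proof.
case: d Omega => [//|d] Omega _ oO bO.
have [M M0 OM] := bounded_set_coord bO.
exists (16 * M ^+ 2) => [|phi tp]; first by rewrite mulr_ge0// sqr_ge0.
have cp := test_C1c tp.
rewrite Rintegral_zero_outside; last by move=> x /(test_out tp)[-> _]; rewrite expr0n.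
have := @poincare _ _ phi M M0 cp.
move=> /(_ _)/wrap[].
  move=> x px; apply: OM; apply: contrapT => /(test_out tp)[p0 _].
  by rewrite p0 eqxx in px.
move=> /le_trans; apply; rewrite ler_wpM2l ?mulr_ge0 ?sqr_ge0 ?(ltW M0)// (a0_ip0_test oO bO tp).
rewrite (bigD1 ord0)//= [in leRHS]Rintegral_zero_outside.
  by rewrite lerDl; apply: sumr_ge0 => i _; apply: Rintegral_ge0 => x _; exact: sqr_ge0.
by move=> x /(test_out tp)[_ ->]; rewrite expr0n.
Qed.

Section embeddings.
Context (R : realType) (d : nat) (Omega : set 'rV[R]_d).
Hypothesis oO : open Omega.
Hypothesis bO : bounded_set Omega.
Hypothesis hd : (1 <= d <= 3)%N.
Notation mu := (leb R d).
Notation I f := (\int[mu]_(x in Omega) f x).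
Notation sq := (sqint mu Omega).
Notation L1 := (intble mu Omega).
Notation H1 := (H1 Omega).
Notation H10 := (H10 Omega).
Notation A0 := (a0_ip Omega (cst 0)).
Notation A1 := (a0_ip Omega (cst 1)).
Let mO := open_measurable_rV oO.
Let fO := leb_bounded_lty oO bO.
Let p0 : potential Omega (cst 0). Proof. exact: potential_cst. Qed.
Let p1 : potential Omega (cst 1). Proof. exact: potential_cst. Qed.

Lemma sobolev_test phi : test_function Omega phi ->
  I (fun x => phi x ^+ 4) <= 4 * (A1 phi phi) ^+ 2.
Proof.
move=> tp; have cp := test_C1c tp.
rewrite (a0_ip1E oO (test_H1 oO tp)) (a0_ip0_test oO bO tp) addrC.
rewrite Rintegral_zero_outside; last by move=> x /(test_out tp)[-> _]; rewrite expr0n.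
have -> : I (fun x => phi x ^+ 2) = \int[mu]_x (phi x ^+ 2).
  by apply: Rintegral_zero_outside => x /(test_out tp)[-> _]; rewrite expr0n.
have E i : I (fun x => partial i phi x ^+ 2) = \int[mu]_x (partial i phi x ^+ 2).
  by apply: Rintegral_zero_outside => x /(test_out tp)[_ ->]; rewrite expr0n.
rewrite (eq_bigr _ (fun i _ => E i)); exact: sobolev.
Qed.

Lemma sqr_le_a0_ip1 u : H1 u -> I (fun x => u x ^+ 2) <= A1 u u.
Proof. by move=> Hu; rewrite (a0_ip1E oO Hu) lerDr; exact: a0_ge0. Qed.

Lemma a0_ip0_le1 u : H1 u -> A0 u u <= A1 u u.
Proof.
move=> Hu; rewrite (a0_ip1E oO Hu) lerDl; apply: Rintegral_ge0 => x _; exact: sqr_ge0.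
Qed.

Lemma poincare_arith2 (C x a y b e : R) : 0 <= C -> 0 <= e ->
  x <= 2 * y + 2 * e -> y <= C * b -> b <= 2 * a + 2 * e ->
  x <= 4 * C * a + (4 * C + 2) * e.
Proof.
move=> C0 e0 h1 h2 h3; have : C * b <= C * (2 * a + 2 * e) by rewrite ler_wpM2l.
rewrite mulrDr; lra.
Qed.

Lemma sq_lc_le (u v : 'rV[R]_d -> R) c : sq u -> sq v ->
  I (fun x => lc u c v x ^+ 2) <=
  2 * I (fun x => u x ^+ 2) + 2 * c ^+ 2 * I (fun x => v x ^+ 2).
Proof.
move=> su sv; have slc := sqintD mO su (sqintZ mO c sv).
rewrite -!(Rintegral_intbleZ mO); [|exact: su.2|exact: sv.2].
rewrite -(Rintegral_intbleD mO); [|apply: (intbleZ mO); exact: su.2|apply: (intbleZ mO); exact: sv.2].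
apply: (Rintegral_intble_le mO); first exact: slc.2.
  by apply: (intbleD mO); apply: (intbleZ mO); [exact: su.2|exact: sv.2].
by move=> x _; rewrite /lc; have := sqr_ge0 (u x - c * v x); rewrite !expr2; lra.
Qed.

(** Passing from test functions to their limits costs constants only, since
    all norms involved are dominated by that of H^1. *)
Lemma poincare_H10 : exists2 C : R, 0 <= C &
  forall u, H10 u -> I (fun x => u x ^+ 2) <= C * A0 u u.
Proof.
have d0 : (0 < d)%N by case/andP: hd.
have [C C0 CP] := poincare_test d0 oO bO.
exists (4 * C) => [|u /(H10P oO)[Hu uP]]; first by rewrite mulr_ge0.
apply/ler_addgt0Pr => e e0.
have k0 : 0 < 4 * C + 2 by lra.
have e'0 : 0 < e / (4 * C + 2) by rewrite divr_gt0.
have [phi tp hp] := uP _ e'0.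
have Hp := test_H1 oO tp.
have Hd := H1_lc oO (-1) Hu Hp.
have uE : u = lc phi 1 (lc u (-1) phi) by apply/funext => x; rewrite /lc; ring.
have pE : phi = lc u (-1) (lc u (-1) phi) by apply/funext => x; rewrite /lc; ring.
have h1 := sq_lc_le 1 (H1_sqint oO Hp) (H1_sqint oO Hd); rewrite -uE in h1.
have h3 := a0_lc_le oO bO (-1) p0 Hu Hd; rewrite -pE in h3.
have h2 := CP _ tp.
have h4 := le_trans (sqr_le_a0_ip1 Hd) hp.
have h5 := le_trans (a0_ip0_le1 Hd) hp.
have := @poincare_arith2 C (I (fun x => u x ^+ 2)) (A0 u u)
   (I (fun x => phi x ^+ 2)) (A0 phi phi) (e / (4 * C + 2)) C0 (ltW e'0).
move=> /(_ _ h2 _)/wrap[].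
- apply: le_trans h1 _; rewrite expr1n mulr1 lerD2l; rewrite ler_wpM2l//.
- apply: le_trans h3 _; rewrite sqrrN expr1n mulr1 lerD2l; rewrite ler_wpM2l//.
by rewrite [(4 * C + 2) * _]mulrC divfK// gt_eqF.
Qed.

Lemma sobolev_limit_arith (x a : R) : 0 <= a ->
  (forall e, 0 < e -> x <= 4 * (2 * a + 2 * e) ^+ 2) -> x <= 16 * a ^+ 2.
Proof.
move=> a0 H; apply/ler_addgt0Pr => e e0.
pose k := 32 * a + 16.
have k0 : 0 < k by rewrite /k; lra.
pose t := Num.min 1 (e / k).
have t0 : 0 < t by rewrite lt_min ltr01 divr_gt0.
have t1 : t <= 1 by rewrite ge_min lexx.
have te : t <= e / k by rewrite ge_min lexx orbT.
have tk : t * k <= e by rewrite -ler_pdivlMr.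
apply: le_trans (H _ t0) _.
have : t * t <= t by rewrite ler_piMl// ltW.
move: tk; rewrite /k !expr2; lra.
Qed.

(** Approximating test functions that converge fast enough converge almost
    everywhere, and Fatou's lemma transfers the quartic bound. *)
Lemma sobolev_H10 u : H10 u ->
  L1 (fun x => u x ^+ 4) /\ I (fun x => u x ^+ 4) <= 16 * (A1 u u) ^+ 2.
Proof.
move=> /(H10P oO)[Hu uP].
have /choice[phi phiP] : forall k : nat, exists phi, test_function Omega phi /\
    A1 (lc u (-1) phi) (lc u (-1) phi) <= 2^-1 ^+ k.
  move=> k; have [|phi tp h] := uP (2^-1 ^+ k); last by exists phi.
  by rewrite exprn_gt0.
have tp k : test_function Omega (phi k) by case: (phiP k).
have su := H1_sqint oO Hu.
have sp k : sq (phi k) by apply: (H1_sqint oO); exact: test_H1.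
have Hp k := test_H1 oO (tp k).
have ae : {ae mu, forall x, Omega x -> (fun k => phi k x) @ \oo --> u x}.
  apply: (fast_ae_cvg mO sp su) => k; case: (phiP k) => _; apply: le_trans.
  apply: le_trans (sqr_le_a0_ip1 (H1_lc oO (-1) Hu (Hp k))).
  rewrite le_eqVlt; apply/orP; left; apply/eqP; apply: eq_Rintegral => x _.
  by rewrite /lc -sqrrN; congr (_ ^+ 2); ring.
have ip4 k : L1 (fun x => phi k x ^+ 4).
  have c4 : C0c (fun x => phi k x ^+ 4) by apply: C0cX; case: (test_C1c (tp k)).
  exact: (C0c_integrable mO c4).
have F e : 0 < e -> L1 (fun x => u x ^+ 4) /\
    I (fun x => u x ^+ 4) <= 4 * (2 * A1 u u + 2 * e) ^+ 2.
  move=> e0; apply: (@sq_fatou _ _ _ _ _ mO phi u _ 2) => //.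
  - by move=> k; case: (sp k).
  - by case: su.
  have [N NP] : exists N : nat, forall k, (N <= k)%N -> 2^-1 ^+ k <= e.
    have h : `|2^-1 : R| < 1 by rewrite ger0_norm// invf_lt1// ltr1n.
    have /cvgrPdist_lt/(_ e e0)[N _ NP] := cvg_geometric 1 h.
    exists N => k /NP/=; rewrite sub0r normrN mul1r ger0_norm ?exprn_ge0//.
    exact: ltW.
  exists N => k Nk; apply: le_trans (sobolev_test (tp k)) _.
  have Ap0 : 0 <= A1 (phi k) (phi k) by apply: a0_ge0.
  rewrite ler_wpM2l// ler_sqr ?nnegrE//; last first.
    by rewrite addr_ge0// mulr_ge0// ?(ltW e0)//; apply: a0_ge0.
  have Hd := H1_lc oO (-1) Hu (Hp k).
  have pE : phi k = lc u (-1) (lc u (-1) (phi k)) by apply/funext => x; rewrite /lc; ring.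
  rewrite {1 2}pE; apply: le_trans (a0_lc_le oO bO (-1) p1 Hu Hd) _.
  rewrite sqrrN expr1n mulr1 lerD2l ler_wpM2l//.
  by apply: le_trans (NP _ Nk); case: (phiP k).
split; first by case: (F _ ltr01).
apply: sobolev_limit_arith => [|e /F[]//]; exact: a0_ge0.
Qed.

End embeddings.

(** * Completeness of H^1_0 and Green's operator *)

Lemma weak_gradient_arith (R : realType) (a b p q e : R) :
  `|a - p| <= e / 2 -> `|b - q| <= e / 2 -> a = - b -> `|p + q| <= e.
Proof.
by move=> + + ab; rewrite ab !ler_norml => /andP[? ?] /andP[? ?]; apply/andP; split; lra.
Qed.

Lemma quarter_arith (R : realType) (a b e : R) : a <= e / 4 -> b <= e / 4 ->
  2 * a + 2 * b <= e.
Proof. lra. Qed.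

Section green_operator.
Context (R : realType) (d : nat) (Omega : set 'rV[R]_d).
Hypothesis oO : open Omega.
Hypothesis bO : bounded_set Omega.
Hypothesis hd : (1 <= d <= 3)%N.
Notation mu := (leb R d).
Notation I f := (\int[mu]_(x in Omega) f x).
Notation sq := (sqint mu Omega).
Notation L1 := (intble mu Omega).
Notation H1 := (H1 Omega).
Notation H10 := (H10 Omega).
Notation A0 := (a0_ip Omega (cst 0)).
Notation A1 := (a0_ip Omega (cst 1)).
Let mO := open_measurable_rV oO.
Let fO := leb_bounded_lty oO bO.
Let p0 : potential Omega (cst 0). Proof. exact: potential_cst. Qed.
Let p1 : potential Omega (cst 1). Proof. exact: potential_cst. Qed.

Lemma L2_cauchy_schwarz (f g : 'rV[R]_d -> R) : sq f -> sq g ->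
  I (fun x => f x * g x) ^+ 2 <= I (fun x => f x ^+ 2) * I (fun x => g x ^+ 2).
Proof.
move=> sf sg.
have := @cauchy_schwarz _ R sq (fun f g => I (fun x => f x * g x)).
move=> /(_ _ _ _ _ f g sf sg)/wrap[].
- by move=> u c v su sv; exact: (sqintD mO su (sqintZ mO c sv)).
- by move=> u v _ _; apply: eq_Rintegral => x _; rewrite mulrC.
- move=> u c v w su sv sw; rewrite -(Rintegral_intbleZ mO); last exact: (sqintM mO sv sw).
  rewrite -(Rintegral_intbleD mO); [|exact: (sqintM mO su sw)|apply: (intbleZ mO); exact: (sqintM mO sv sw)].
  by apply: eq_Rintegral => x _; rewrite /lc mulrDl mulrA.
- by move=> u _; apply: Rintegral_ge0 => x _; rewrite -expr2 sqr_ge0.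
by [].
Qed.

Lemma L2_weak_limit (f : nat -> 'rV[R]_d -> R) g psi :
  (forall n, sq (f n)) -> sq g -> sq psi ->
  (forall e, 0 < e -> exists N, forall n, (N <= n)%N ->
     I (fun x => (f n x - g x) ^+ 2) <= e) ->
  forall e, 0 < e -> exists N, forall n, (N <= n)%N ->
     `|I (fun x => f n x * psi x) - I (fun x => g x * psi x)| <= e.
Proof.
move=> sf sg sp fg e e0; pose P := I (fun x => psi x ^+ 2).
have P0 : 0 <= P by apply: Rintegral_ge0 => x _; exact: sqr_ge0.
have [|N NP] := fg (e ^+ 2 / (P + 1)); first by rewrite divr_gt0 ?exprn_gt0//; lra.
exists N => n Nn.
have sd := sqintB mO (sf n) sg.
have := L2_cauchy_schwarz sd sp.
have -> : I (fun x => (f n x - g x) * psi x) =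
    I (fun x => f n x * psi x) - I (fun x => g x * psi x).
  rewrite -RintegralB//; [|exact: (sqintM mO (sf n) sp)|exact: (sqintM mO sg sp)].
  by apply: eq_Rintegral => x _; rewrite mulrBl.
move=> h; rewrite -ler_sqr ?nnegrE ?normr_ge0 ?(ltW e0)// real_normK ?num_real//.
apply: le_trans h _; rewrite -/P.
apply: (@le_trans _ _ (e ^+ 2 / (P + 1) * P)); first by rewrite ler_wpM2r// NP.
rewrite mulrAC ler_pdivrMr; last lra.
by rewrite ler_wpM2l ?sqr_ge0//; lra.
Qed.

Lemma component_le_a0_ip0 v h i : H1 v -> weak_gradient Omega v h ->
  I (fun x => h x ord0 i ^+ 2) <= A0 v v.
Proof.
move=> Hv vh; rewrite (a0_ip0_weak_gradient oO bO Hv vh) (bigD1 i)//= lerDl.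
by apply: sumr_ge0 => j _; apply: Rintegral_ge0 => x _; exact: sqr_ge0.
Qed.

Lemma dist_le_a0_ip1 (u v : 'rV[R]_d -> R) : H1 u -> H1 v ->
  I (fun x => (u x - v x) ^+ 2) <= A1 (lc u (-1) v) (lc u (-1) v).
Proof.
move=> Hu Hv; apply: le_trans (sqr_le_a0_ip1 oO (H1_lc oO (-1) Hu Hv)).
rewrite le_eqVlt; apply/orP; left; apply/eqP; apply: eq_Rintegral => x _.
by rewrite /lc mulN1r.
Qed.

(** The functions and each component of their gradients converge in L^2; the
    identities that define weak gradients pass to the limit. *)
Lemma H1_complete (z : nat -> 'rV[R]_d -> R) : (forall k, H1 (z k)) ->
  (forall e, 0 < e -> exists N, forall m n, (N <= m)%N -> (N <= n)%N ->
     A1 (lc (z m) (-1) (z n)) (lc (z m) (-1) (z n)) <= e) ->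
  exists2 u, H1 u & forall e, 0 < e -> exists N, forall n, (N <= n)%N ->
     A1 (lc (z n) (-1) u) (lc (z n) (-1) u) <= e.
Proof.
move=> Hz cau.
have sz n : sq (z n) by exact: (H1_sqint oO (Hz n)).
have [|u su uP] := riesz_fischer mO fO sz.
  move=> e /cau[N NP]; exists N => m n Nm Nn.
  by apply: le_trans (NP _ _ Nm Nn); exact: dist_le_a0_ip1.
pose D n i x := grad Omega (z n) x ord0 i.
have sD i n : sq (D n i) by exact: (grad_sqint oO i (Hz n)).
have /choice[g gP] : forall i : 'I_d, exists g, sq g /\
    forall e, 0 < e -> exists N, forall n, (N <= n)%N ->
     I (fun x => (D n i x - g x) ^+ 2) <= e.
  move=> i; have [|g sg gP] := riesz_fischer mO fO (sD i); last by exists g.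
  move=> e /cau[N NP]; exists N => m n Nm Nn.
  apply: le_trans (NP _ _ Nm Nn).
  have Hd := H1_lc oO (-1) (Hz m) (Hz n).
  apply: le_trans (a0_ip0_le1 oO Hd).
  apply: le_trans (component_le_a0_ip0 i Hd (weak_gradient_lc oO (-1) (sz m) (sz n) (H1_grad (Hz m)) (H1_grad (Hz n)))).
  rewrite le_eqVlt; apply/orP; left; apply/eqP; apply: eq_Rintegral => x _.
  by rewrite !mxE mulN1r.
pose G x : 'rV[R]_d := \row_i g i x.
have GE i : (fun x => G x ord0 i) = g i by apply/funext => x; rewrite mxE.
have uG : weak_gradient Omega u G.
  split; first by move=> i; rewrite GE; apply/(L2_sqintP oO); exact: (gP i).1.
  move=> phi tp i; have cp := test_C1c tp.
  have sp : sq phi by apply: (C0c_sqint oO); case: cp.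
  have sdp : sq (partial i phi) by apply: (C0c_sqint oO); exact: C1c_partial.
  rewrite /L2_ip; apply/eqP; rewrite -addr_eq0 -normr_eq0 eq_le normr_ge0 andbT.
  apply/ler_addgt0Pr => e e0; rewrite add0r.
  have e20 : 0 < e / 2 by rewrite divr_gt0.
  have [N1 N1P] := L2_weak_limit sz su sdp uP e20.
  have [N2 N2P] := L2_weak_limit (sD i) (gP i).1 sp (gP i).2 e20.
  pose n := maxn N1 N2.
  have h1 := N1P n (leq_maxl _ _); have h2 := N2P n (leq_maxr _ _).
  have h3 := (H1_grad (Hz n)).2 _ tp i; rewrite /L2_ip in h3.
  under [X in _ + X]eq_Rintegral do rewrite mxE.
  exact: weak_gradient_arith h1 h2 h3.
have Hu := weak_gradient_H1 oO su uG.
exists u => // e e0.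
have ed0 : 0 < e / d.+1%:R by rewrite divr_gt0.
have [N NP] := uP _ ed0.
have /choice[M MP] : forall i : 'I_d, exists N, forall n, (N <= n)%N ->
     I (fun x => (D n i x - g i x) ^+ 2) <= e / d.+1%:R.
  by move=> i; exact: (gP i).2.
exists (maxn N (\max_i M i)) => n; rewrite geq_max => /andP[Nn Mn].
have Hd := H1_lc oO (-1) (Hz n) Hu.
rewrite (a0_ip1E oO Hd) (a0_ip0_weak_gradient oO bO Hd (weak_gradient_lc oO (-1) (sz n) su (H1_grad (Hz n)) uG)).
apply: (@le_trans _ _ (\sum_(i < d) e / d.+1%:R + e / d.+1%:R)).
  apply: lerD.
    apply: ler_sum => i _; apply: le_trans (MP i n _); last exact: leq_trans (leq_bigmax i) Mn.
    rewrite le_eqVlt; apply/orP; left; apply/eqP; apply: eq_Rintegral => x _.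
    by rewrite !mxE mulN1r.
  apply: le_trans (NP _ Nn).
  rewrite le_eqVlt; apply/orP; left; apply/eqP; apply: eq_Rintegral => x _.
  by rewrite /lc mulN1r.
by rewrite sumr_const card_ord -mulrSr -(mulr_natr (e / d.+1%:R)) divfK.
Qed.

Section potential.
Context (V : 'rV[R]_d -> R).
Hypothesis hV : potential Omega V.
Notation A := (a0_ip Omega V).

Lemma a0_ip0_le u : H1 u -> A0 u u <= A u u.
Proof.
move=> Hu; apply: (a0_mono oO) => //; have [K K0 VK] := potential_bound hV.
by apply: filterS VK => x Vx /Vx/andP[].
Qed.

Lemma a0_ip_le1 : exists2 K, 0 <= K & forall u, H1 u -> A u u <= K * A1 u u.
Proof.
have [K K0 VK] := potential_bound hV; exists (1 + K); first lra.
move=> u Hu; apply: (@le_trans _ _ (a0_ip Omega (cst K) u u)).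
  apply: (a0_mono oO) => //; first exact: potential_cst.
  by apply: filterS VK => x Vx /Vx/andP[].
rewrite (a0_split oO (potential_cst _ K0) Hu).
have -> : I (fun x => cst K x * u x * u x) = K * I (fun x => u x ^+ 2).
  rewrite -(Rintegral_intbleZ mO); last by case: (H1_sqint oO Hu).
  by apply: eq_Rintegral => x _; rewrite /= -mulrA expr2.
rewrite mulrDl mul1r lerD ?a0_ip0_le1// ler_wpM2l//; exact: sqr_le_a0_ip1.
Qed.

Lemma a0_ip1_le : exists2 K, 0 <= K & forall u, H10 u -> A1 u u <= K * A u u.
Proof.
have [C C0 CP] := poincare_H10 oO bO hd; exists (1 + C); first lra.
move=> u Hu; have H1u := H10_H1 Hu; rewrite (a0_ip1E oO H1u).
have h := a0_ip0_le H1u.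
rewrite mulrDl mul1r; apply: lerD => //; apply: le_trans (CP _ Hu) _.
by rewrite ler_wpM2l.
Qed.

Lemma H10_complete (z : nat -> 'rV[R]_d -> R) : (forall k, H10 (z k)) ->
  (forall e, 0 < e -> exists N, forall m n, (N <= m)%N -> (N <= n)%N ->
     A (lc (z m) (-1) (z n)) (lc (z m) (-1) (z n)) <= e) ->
  exists2 u, H10 u & forall e, 0 < e -> exists N, forall n, (N <= n)%N ->
     A (lc (z n) (-1) u) (lc (z n) (-1) u) <= e.
Proof.
move=> Hz cau.
have [K K0 KP] := a0_ip1_le; have [L L0 LP] := a0_ip_le1.
have Hz1 n := H10_H1 (Hz n).
have [|u Hu uP] := H1_complete Hz1.
  move=> e e0; have [|N NP] := cau (e / (K + 1)); first by rewrite divr_gt0//; lra.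
  exists N => m n Nm Nn; apply: le_trans (KP _ (H10_lc oO bO (-1) (Hz m) (Hz n))) _.
  apply: (@le_trans _ _ (K * (e / (K + 1)))); first by rewrite ler_wpM2l// NP.
  rewrite mulrA ler_pdivrMr; last lra.
  by rewrite mulrC ler_wpM2l ?(ltW e0)//; lra.
exists u.
  apply/(H10P oO); split => // e e0.
  have e40 : 0 < e / 4 by rewrite divr_gt0.
  have [N NP] := uP _ e40; have hN := NP N (leqnn N).
  have /(H10P oO)[_ /(_ _ e40)[phi tp hp]] := Hz N.
  exists phi => //.
  have Hp := test_H1 oO tp.
  have -> : lc u (-1) phi = lc (lc (z N) (-1) phi) (-1) (lc (z N) (-1) u).
    by apply/funext => x; rewrite /lc; ring.
  apply: (le_trans (a0_lc_le oO bO (-1) p1 (H1_lc oO (-1) (Hz1 N) Hp) (H1_lc oO (-1) (Hz1 N) Hu))).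
  by rewrite sqrrN expr1n mulr1; apply: quarter_arith.
move=> e e0; have [|N NP] := uP (e / (L + 1)); first by rewrite divr_gt0//; lra.
exists N => n Nn; apply: le_trans (LP _ (H1_lc oO (-1) (Hz1 n) Hu)) _.
apply: (@le_trans _ _ (L * (e / (L + 1)))); first by rewrite ler_wpM2l// NP.
rewrite mulrA ler_pdivrMr; last lra.
by rewrite mulrC ler_wpM2l ?(ltW e0)//; lra.
Qed.

Lemma green_spec (w : 'rV[R]_d -> R) (C : R) : 0 <= C -> (exists z, H10 z) ->
  (forall z, H10 z -> L1 (fun x => z x * w x)) ->
  (forall z, H10 z -> L2_ip Omega z w ^+ 2 <= C * A z z) ->
  H10 (green Omega V w) /\
  forall z, H10 z -> A z (green Omega V w) = L2_ip Omega z w.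
Proof.
move=> C0 H0 zw hC.
suff : exists g, [set g | H10 g /\ forall z, H10 z -> A z g = L2_ip Omega z w] g.
  by move=> /(xgetPex (cst 0)).
have [g Hg gP] : exists2 g, H10 g & forall z, H10 z -> A z g = L2_ip Omega z w.
  apply: (@riesz _ _ H10 A _ _ _ _ H10_complete (fun z => L2_ip Omega z w) C _ H0 _ hC).
  - by move=> u c v Hu Hv; exact: H10_lc.
  - by move=> u v _ _; exact: a0_sym.
  - by move=> u c v x Hu Hv Hx; apply: a0_lc => //; exact: H10_H1.
  - by move=> u Hu; apply: a0_ge0 => //; exact: H10_H1.
  - exact: C0.
  move=> u c v Hu Hv; rewrite /L2_ip -(Rintegral_intbleZ mO); last exact: zw.
  rewrite -(Rintegral_intbleD mO); [|exact: zw|apply: (intbleZ mO); exact: zw].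
  by apply: eq_Rintegral => x _; rewrite /lc mulrDl mulrA.
by exists g.
Qed.

End potential.

End green_operator.

(** * One step of the scheme *)

(** The difference of the two sides is a sum of two nonnegative terms,
    displayed in the proof: the square absorbs the cubic term - 4 t^3 u g^3
    of the expansion. *)
Lemma quartic_step (R : realType) (u g t : R) : 0 <= t -> t <= 1 ->
  (u + - t * g) ^+ 4 <=
  u ^+ 4 + - (4 * t) * (g * (u ^+ 2 * u)) + t ^+ 2 * (8 * (u ^+ 2 * g ^+ 2) + 3 * g ^+ 4).
Proof.
move=> t0 t1.
have t2 : 0 <= 1 - t ^+ 2 by rewrite subr_ge0 expr2 mulr_ile1.
have h1 : 0 <= t ^+ 2 * (2 * (u * g + t * g ^+ 2) ^+ 2).
  by rewrite mulr_ge0 ?sqr_ge0// mulr_ge0// sqr_ge0.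
have h2 : 0 <= 3 * t ^+ 2 * ((1 - t ^+ 2) * g ^+ 4).
  have g4 : 0 <= g ^+ 4 by rewrite exprn_even_ge0.
  have t3 : 0 <= 3 * t ^+ 2 by rewrite mulr_ge0// sqr_ge0.
  exact: mulr_ge0 t3 (mulr_ge0 t2 g4).
rewrite -subr_ge0.
rewrite (_ : _ - _ = t ^+ 2 * (2 * (u * g + t * g ^+ 2) ^+ 2) + 3 * t ^+ 2 * ((1 - t ^+ 2) * g ^+ 4)); last by ring.
exact: addr_ge0.
Qed.

Lemma cubic_arith (R : realType) (a b : R) : 0 <= a -> 0 <= b -> a ^+ 2 <= b * a -> a <= b.
Proof.
move=> a0 b0; have [->//|an0] := eqVneq a 0.
by rewrite expr2 ler_pM2r// lt_neqAle eq_sym an0.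
Qed.

Lemma quartic_arith (R : realType) (K U W a b p q : R) :
  p <= K * (a * b) -> q <= K * b ^+ 2 -> 0 <= K -> a <= U -> b <= W -> 0 <= b ->
  8 * p + 3 * q <= (8 * K * U + 3 * K * W) * b.
Proof.
move=> h1 h2 K0 aU bW b0.
have h3 : K * (a * b) <= K * (U * b) by rewrite ler_wpM2l// ler_wpM2r.
have h4 : K * b ^+ 2 <= K * (W * b) by rewrite expr2 ler_wpM2l// ler_wpM2r.
rewrite mulrDl -!mulrA; lra.
Qed.

Lemma descent_arith (R : realType) (beta t Q a p b c f f' : R) : 0 <= beta -> 0 <= t ->
  t * (1 + 2 * (beta / 4 * Q)) <= 1 -> 0 <= b -> p + beta * c = b ->
  f' <= f - 4 * t * c + t ^+ 2 * (Q * b) ->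
  2^-1 * (a + 2 * - t * p + (- t) ^+ 2 * b) + beta / 4 * f' <=
  2^-1 * a + beta / 4 * f - t / 2 * b.
Proof.
move=> be0 t0 tQ b0 pc hf.
have h1 : beta / 4 * f' <= beta / 4 * (f - 4 * t * c + t ^+ 2 * (Q * b)).
  by rewrite ler_wpM2l// divr_ge0.
have h2 : (t * b) * (t * (1 + 2 * (beta / 4 * Q))) <= (t * b) * 1.
  by rewrite ler_wpM2l// mulr_ge0.
rewrite -pc in h2 *; rewrite -pc in h1; rewrite !expr2 in h1 *; lra.
Qed.

Section descent.
Context (R : realType) (d : nat) (Omega : set 'rV[R]_d).
Hypothesis oO : open Omega.
Hypothesis bO : bounded_set Omega.
Hypothesis hd : (1 <= d <= 3)%N.
Context (V : 'rV[R]_d -> R) (beta : R).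
Hypothesis hV : potential Omega V.
Hypothesis hbeta : 0 <= beta.
Notation mu := (leb R d).
Notation I f := (\int[mu]_(x in Omega) f x).
Notation sq := (sqint mu Omega).
Notation L1 := (intble mu Omega).
Notation H1 := (H1 Omega).
Notation H10 := (H10 Omega).
Notation A := (a0_ip Omega V).
Let mO := open_measurable_rV oO.
Let fO := leb_bounded_lty oO bO.

Lemma H10_sqint u : H10 u -> sq u.
Proof. by move=> /H10_H1; exact: H1_sqint. Qed.

Lemma a0H_ge0 u : H10 u -> 0 <= A u u.
Proof. by move=> Hu; apply: a0_ge0 => //; exact: H10_H1. Qed.

Lemma a0H_lc u c v w : H10 u -> H10 v -> H10 w ->
  A (lc u c v) w = A u w + c * A v w.
Proof. by move=> Hu Hv Hw; apply: a0_lc => //; exact: H10_H1. Qed.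

Lemma a0H_lcr u c v w : H10 u -> H10 v -> H10 w ->
  A w (lc u c v) = A w u + c * A w v.
Proof.
by move=> Hu Hv Hw; rewrite a0_sym a0H_lc// (a0_sym _ _ u) (a0_sym _ _ v).
Qed.

Lemma a0H_quad u c v : H10 u -> H10 v ->
  A (lc u c v) (lc u c v) = A u u + 2 * c * A u v + c ^+ 2 * A v v.
Proof. by move=> Hu Hv; apply: a0_quad => //; exact: H10_H1. Qed.

Lemma a0H_cauchy_schwarz u v : H10 u -> H10 v -> A u v ^+ 2 <= A u u * A v v.
Proof.
move=> Hu Hv; apply: discriminant_le; first exact: a0H_ge0.
by move=> t; rewrite -a0H_quad//; apply: a0H_ge0; exact: H10_lc.
Qed.

Lemma a0_norm_sqr u : H10 u -> a0_norm Omega V u ^+ 2 = A u u.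
Proof. by move=> Hu; rewrite /a0_norm sqr_sqrtr//; exact: a0H_ge0. Qed.

Lemma H10_L4 u : H10 u -> L1 (fun x => u x ^+ 4).
Proof. by move=> Hu; case: (sobolev_H10 oO bO hd Hu). Qed.

Lemma H10_prod_sqint u v : H10 u -> H10 v -> sq (fun x => u x * v x).
Proof.
move=> Hu Hv; have su := H10_sqint Hu; have sv := H10_sqint Hv; split.
  by apply: measurable_funM; [exact: su.1|exact: sv.1].
apply: (intble_le mO _ (intbleD mO (H10_L4 Hu) (H10_L4 Hv))).
  by apply: measurable_funX; apply: measurable_funM; [exact: su.1|exact: sv.1].
move=> x _; rewrite ger0_norm ?sqr_ge0// exprMn.
have := sqr_ge0 (u x ^+ 2 - v x ^+ 2); rewrite sqrrB -!exprM.
have := sqr_ge0 (u x ^+ 2); have := sqr_ge0 (v x ^+ 2); rewrite -!exprM/=; lra.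
Qed.

Lemma H10_sqr_sqint u : H10 u -> sq (fun x => u x ^+ 2).
Proof. by move=> Hu; have := H10_prod_sqint Hu Hu; congr sqint. Qed.

Lemma H10_cubic_intble z u : H10 z -> H10 u -> L1 (fun x => z x * (u x ^+ 2 * u x)).
Proof.
move=> Hz Hu; have := sqintM mO (H10_prod_sqint Hz Hu) (H10_sqr_sqint Hu).
by congr intble; apply/funext => x; ring.
Qed.

(** The H^1 form is dominated by the a0 form on H^1_0, by the Poincare
    inequality. *)
Lemma sobolev_embedding : exists2 K, 0 <= K & forall u, H10 u ->
  I (fun x => u x ^+ 4) <= K * A u u ^+ 2.
Proof.
have [K K0 KP] := a0_ip1_le oO bO hd hV.
exists (16 * K ^+ 2) => [|u Hu]; first by rewrite mulr_ge0// sqr_ge0.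
have [_ le4] := sobolev_H10 oO bO hd Hu; apply: le_trans le4 _.
rewrite -mulrA ler_wpM2l// -exprMn.
have A1ge : 0 <= a0_ip Omega (cst 1) u u.
  by apply: a0_ge0 => //; [exact: potential_cst|exact: H10_H1].
by rewrite ler_sqr ?nnegrE ?KP// mulr_ge0// a0H_ge0.
Qed.

(** In this section [g] is the projection of [F] on the orthogonal
    complement of [G]. *)
Section projection.
Variables F G : 'rV[R]_d -> R.
Hypothesis HF : H10 F.
Hypothesis HG : H10 G.
Hypothesis G0 : 0 < A G G.
Notation g := (lc F (- (A F G / A G G)) G).

Let Hg : H10 g. Proof. exact: (H10_lc oO bO _ HF HG). Qed.

Lemma projection_orth : A g G = 0.
Proof. by rewrite (a0H_lc _ HF HG HG) mulNr divfK ?subrr// gt_eqF. Qed.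

Lemma projection_self : A g F = A g g.
Proof.
by rewrite [RHS](a0H_lcr _ HF HG Hg) projection_orth mulr0 addr0.
Qed.

Lemma projection_le : A g g <= A F F.
Proof.
have h := a0H_cauchy_schwarz Hg HF; rewrite projection_self in h.
apply: cubic_arith (a0H_ge0 Hg) (a0H_ge0 HF) _.
by rewrite [leRHS]mulrC.
Qed.

End projection.

Variable K : R.
Hypothesis K0 : 0 <= K.
Hypothesis KP : forall u, H10 u -> I (fun x => u x ^+ 4) <= K * A u u ^+ 2.

Lemma Rintegral_quartic_ge0 u : 0 <= I (fun x => u x ^+ 4).
Proof. by apply: Rintegral_ge0 => x _; rewrite exprn_even_ge0. Qed.

Lemma sobolev_cross_le u v : H10 u -> H10 v ->
  I (fun x => u x ^+ 2 * v x ^+ 2) <= K * (A u u * A v v).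
Proof.
move=> Hu Hv.
have := L2_cauchy_schwarz oO (H10_sqr_sqint Hu) (H10_sqr_sqint Hv).
have e4 (w : 'rV[R]_d -> R) : I (fun x => (w x ^+ 2) ^+ 2) = I (fun x => w x ^+ 4).
  by apply: eq_Rintegral => x _; rewrite -exprM.
rewrite !e4 => h.
have B0 : 0 <= K * (A u u * A v v) by rewrite !mulr_ge0// a0H_ge0.
rewrite -ler_sqr ?nnegrE//; last first.
  by apply: Rintegral_ge0 => x _; rewrite mulr_ge0// sqr_ge0.
apply: le_trans h _.
apply: (@le_trans _ _ ((K * A u u ^+ 2) * (K * A v v ^+ 2))).
  by apply: ler_pM; rewrite ?Rintegral_quartic_ge0// KP.
by rewrite le_eqVlt; apply/orP; left; apply/eqP; ring.
Qed.

(** Cauchy-Schwarz for the factors z u and u^2, then for z^2 and u^2: only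
    fourth powers of [z] and [u] are left to integrate. *)
Lemma cubic_bound z u : H10 z -> H10 u ->
  L2_ip Omega z (fun x => `|u x| ^+ 2 * u x) ^+ 2 <= K ^+ 2 * A u u ^+ 3 * A z z.
Proof.
move=> Hz Hu.
have -> : L2_ip Omega z (fun x => `|u x| ^+ 2 * u x) = I (fun x => (z x * u x) * (u x ^+ 2)).
  by apply: eq_Rintegral => x _; rewrite real_normK ?num_real//; ring.
apply: le_trans (L2_cauchy_schwarz oO (H10_prod_sqint Hz Hu) (H10_sqr_sqint Hu)) _.
have -> : I (fun x => (z x * u x) ^+ 2) = I (fun x => z x ^+ 2 * u x ^+ 2).
  by apply: eq_Rintegral => x _; rewrite exprMn.
have -> : I (fun x => (u x ^+ 2) ^+ 2) = I (fun x => u x ^+ 4).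
  by apply: eq_Rintegral => x _; rewrite -exprM.
apply: (@le_trans _ _ ((K * (A z z * A u u)) * (K * A u u ^+ 2))).
  apply: ler_pM; rewrite ?Rintegral_quartic_ge0 ?sobolev_cross_le ?KP//.
  by apply: Rintegral_ge0 => x _; rewrite mulr_ge0// sqr_ge0.
by rewrite le_eqVlt; apply/orP; left; apply/eqP; ring.
Qed.

(** The functional z |-> int z u^3 is bounded by [cubic_bound]. *)
Lemma green_cubic_spec u : H10 u -> H10 (green_cubic Omega V u) /\
  (forall z, H10 z -> A z (green_cubic Omega V u) = I (fun x => z x * (u x ^+ 2 * u x))).
Proof.
move=> Hu.
have nE (z : 'rV[R]_d -> R) : (fun x => z x * (`|u x| ^+ 2 * u x)) = (fun x => z x * (u x ^+ 2 * u x)).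
  by apply/funext => x; rewrite real_normK ?num_real.
have [|||z Hz|Hg gP] := @green_spec _ _ _ oO bO hd V hV (fun x => `|u x| ^+ 2 * u x) (K ^+ 2 * A u u ^+ 3).
- by rewrite mulr_ge0 ?sqr_ge0// exprn_ge0// a0H_ge0.
- by exists u.
- by move=> z Hz; rewrite nE; exact: H10_cubic_intble.
- exact: cubic_bound.
split=> // z Hz; rewrite gP// /L2_ip.
by rewrite (_ : (fun x => _) = (fun x => z x * (u x ^+ 2 * u x)))// -nE.
Qed.

Lemma green_L2_spec u : H10 u -> H10 (green Omega V u) /\
  (forall z, H10 z -> A z (green Omega V u) = I (fun x => z x * u x)).
Proof.
move=> Hu; have [C C0 CP] := poincare_H10 oO bO hd.
have I20 : 0 <= I (fun x => u x ^+ 2) by apply: Rintegral_ge0 => x _; exact: sqr_ge0.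
have [|||z Hz|Hg gP] := @green_spec _ _ _ oO bO hd V hV u (C * I (fun x => u x ^+ 2)).
- by rewrite mulr_ge0.
- by exists u.
- by move=> z Hz; exact: (sqintM mO (H10_sqint Hz) (H10_sqint Hu)).
- apply: le_trans (L2_cauchy_schwarz oO (H10_sqint Hz) (H10_sqint Hu)) _.
  rewrite mulrAC ler_wpM2r//; apply: le_trans (CP _ Hz) _; rewrite ler_wpM2l//.
  by apply: (a0_ip0_le oO hV); exact: H10_H1.
by split.
Qed.

Lemma energyE u : H10 u ->
  energy Omega V beta u = 2^-1 * A u u + beta / 4 * I (fun x => u x ^+ 4).
Proof.
move=> Hu; have H1u := H10_H1 Hu.
have iA := a0_intble oO hV H1u H1u.
rewrite -(Rintegral_intbleZ mO _ iA) -(Rintegral_intbleZ mO _ (H10_L4 Hu)).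
rewrite -(Rintegral_intbleD mO (intbleZ mO _ iA) (intbleZ mO _ (H10_L4 Hu))).
apply: eq_Rintegral => x _; rewrite real_normK ?num_real//.
have -> : `|u x| ^+ 4 = u x ^+ 4 by rewrite -[4%N]/(2 * 2)%N !exprM real_normK ?num_real.
by rewrite expr2; ring.
Qed.

(** All terms of the energy are nonnegative and homogeneous of degree 2 or
    4. *)
Lemma energy_scale u (s : R) : H10 u -> 0 <= s <= 1 ->
  energy Omega V beta (fun x => s * u x) <= energy Omega V beta u /\
  H10 (fun x => s * u x).
Proof.
move=> Hu /andP[s0 s1].
have E : (fun x => s * u x) = lc u (s - 1) u by apply/funext => x; rewrite /lc; ring.
have Hs : H10 (fun x => s * u x) by rewrite E; exact: H10_lc.
split=> //; rewrite !energyE// {1 2}E a0H_quad//.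
have -> : I (fun x => (s * u x) ^+ 4) = s ^+ 4 * I (fun x => u x ^+ 4).
  by rewrite -(Rintegral_intbleZ mO _ (H10_L4 Hu)); apply: eq_Rintegral => x _; rewrite exprMn.
have -> : A u u + 2 * (s - 1) * A u u + (s - 1) ^+ 2 * A u u = s ^+ 2 * A u u by ring.
apply: lerD; rewrite ler_wpM2l ?invr_ge0 ?divr_ge0//.
  by rewrite ler_piMl ?a0H_ge0// expr_le1.
by rewrite ler_piMl ?Rintegral_quartic_ge0// expr_le1.
Qed.

Variable u : 'rV[R]_d -> R.
Hypothesis Hu : H10 u.
Hypothesis u1 : I (fun x => u x ^+ 2) = 1.

Notation F := (a0_gradient Omega V beta u).
Notation g := (riemannian_gradient Omega V beta u).
Notation Gu := (green Omega V u).
Notation Gc := (green_cubic Omega V u).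

Let HGu : H10 Gu. Proof. by case: (green_L2_spec Hu). Qed.
Let HGc : H10 Gc. Proof. by case: (green_cubic_spec Hu). Qed.

Lemma a0_gradientE : F = lc u beta Gc.
Proof. by []. Qed.

Lemma H10_a0_gradient : H10 F.
Proof. by rewrite a0_gradientE; exact: H10_lc. Qed.

Lemma a0_green_gt0 : 0 < A Gu Gu.
Proof.
rewrite lt_neqAle a0H_ge0// andbT eq_sym; apply/eqP => G0.
have := a0H_cauchy_schwarz Hu HGu; rewrite G0 mulr0.
rewrite (green_L2_spec Hu).2//.
have -> : I (fun x => u x * u x) = I (fun x => u x ^+ 2).
  by apply: eq_Rintegral => x _; rewrite expr2.
by rewrite u1 expr1n ler10.
Qed.

Lemma a0_gradient_green : A F Gu = 1 + beta * L2_ip Omega Gc u.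
Proof.
rewrite a0_gradientE a0H_lc// !(green_L2_spec Hu).2//; congr (_ + _).
by rewrite -u1; apply: eq_Rintegral => x _; rewrite expr2.
Qed.

(** The coefficient in the definition of the Riemannian gradient is the one
    of an orthogonal projection. *)
Lemma riemannian_gradientE : g = lc F (- (A F Gu / A Gu Gu)) Gu.
Proof.
apply/funext => x; rewrite /riemannian_gradient a0_norm_sqr// -a0_gradient_green.
by rewrite /lc mulNr.
Qed.

Lemma H10_riemannian_gradient : H10 g.
Proof. by rewrite riemannian_gradientE; exact: (H10_lc oO bO _ H10_a0_gradient HGu). Qed.

Lemma riemannian_gradient_orth : A g Gu = 0.
Proof.
by rewrite riemannian_gradientE; exact: (projection_orth H10_a0_gradient HGu a0_green_gt0).
Qed.

Lemma riemannian_gradient_L2_orth : I (fun x => g x * u x) = 0.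
Proof.
rewrite -riemannian_gradient_orth; apply/esym.
exact: ((green_L2_spec Hu).2 _ H10_riemannian_gradient).
Qed.

Lemma riemannian_gradient_proj : A g F = A g g.
Proof.
by rewrite riemannian_gradientE; exact: (projection_self H10_a0_gradient HGu a0_green_gt0).
Qed.

Lemma riemannian_gradient_le : A g g <= A F F.
Proof.
by rewrite riemannian_gradientE; exact: (projection_le H10_a0_gradient HGu a0_green_gt0).
Qed.

(** [cubic_bound] applied to [z = Gc] itself, where its left side is
    A(Gc,Gc)^2. *)
Lemma green_cubic_le : A Gc Gc <= K ^+ 2 * A u u ^+ 3.
Proof.
have := cubic_bound HGc Hu.
rewrite (_ : L2_ip _ _ _ = A Gc Gc); last first.
  rewrite (green_cubic_spec Hu).2//; apply: eq_Rintegral => x _.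
  by rewrite real_normK ?num_real.
apply: cubic_arith; first exact: a0H_ge0.
by rewrite mulr_ge0 ?sqr_ge0// exprn_ge0// a0H_ge0.
Qed.

Lemma a0_gradient_le : A F F <= 2 * A u u + 2 * beta ^+ 2 * (K ^+ 2 * A u u ^+ 3).
Proof.
have H1u := H10_H1 Hu; have H1c := H10_H1 HGc.
apply: le_trans (a0_lc_le oO bO beta hV H1u H1c) _.
rewrite lerD2l; apply: ler_wpM2l; first by rewrite mulr_ge0// sqr_ge0.
exact: green_cubic_le.
Qed.

Variables (U W t : R).
Hypothesis AU : A u u <= U.
Hypothesis AW : A F F <= W.
Hypothesis t0 : 0 < t.
Hypothesis t1 : t * (1 + 2 * (beta / 4 * (8 * K * U + 3 * K * W))) <= 1.

Let U0 : 0 <= U. Proof. exact: le_trans (a0H_ge0 Hu) AU. Qed.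
Let W0 : 0 <= W. Proof. exact: le_trans (a0H_ge0 H10_a0_gradient) AW. Qed.

Let S0 : 0 <= beta / 4 * (8 * K * U + 3 * K * W).
Proof. by rewrite mulr_ge0 ?divr_ge0// addr_ge0// !mulr_ge0. Qed.

Let t_le1 : t <= 1.
Proof. by apply: le_trans t1; rewrite ler_peMr ?(ltW t0)// lerDl mulr_ge0. Qed.

Lemma quartic_decrease (h : 'rV[R]_d -> R) : H10 h -> A h h <= W ->
  I (fun x => lc u (- t) h x ^+ 4) <=
  I (fun x => u x ^+ 4) - 4 * t * I (fun x => h x * (u x ^+ 2 * u x)) +
  t ^+ 2 * ((8 * K * U + 3 * K * W) * A h h).
Proof.
move=> Hh AhW.
have Hv : H10 (lc u (- t) h) by exact: H10_lc.
have i1 := H10_L4 Hu; have i2 := H10_cubic_intble Hh Hu.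
have i3 := sqintM mO (H10_sqr_sqint Hu) (H10_sqr_sqint Hh); have i4 := H10_L4 Hh.
have i5 := intbleD mO (intbleZ mO 8 i3) (intbleZ mO 3 i4).
have i6 := intbleD mO (intbleD mO i1 (intbleZ mO (- (4 * t)) i2)) (intbleZ mO (t ^+ 2) i5).
apply: (@le_trans _ _ (I (fun x => u x ^+ 4) + - (4 * t) * I (fun x => h x * (u x ^+ 2 * u x)) +
   t ^+ 2 * (8 * I (fun x => u x ^+ 2 * h x ^+ 2) + 3 * I (fun x => h x ^+ 4)))).
  rewrite -(Rintegral_intbleZ mO _ i2) -(Rintegral_intbleZ mO _ i3) -(Rintegral_intbleZ mO _ i4).
  rewrite -(Rintegral_intbleD mO (intbleZ mO 8 i3) (intbleZ mO 3 i4)) -(Rintegral_intbleZ mO _ i5).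
  rewrite -(Rintegral_intbleD mO i1 (intbleZ mO (- (4 * t)) i2)).
  rewrite -(Rintegral_intbleD mO (intbleD mO i1 (intbleZ mO (- (4 * t)) i2)) (intbleZ mO (t ^+ 2) i5)).
  apply: (Rintegral_intble_le mO (H10_L4 Hv) i6) => x _.
  exact: (quartic_step _ _ (ltW t0) t_le1).
rewrite -[in leRHS]mulNr lerD2l; apply: ler_wpM2l; first exact: sqr_ge0.
have Ah0 := a0H_ge0 Hh.
exact: (quartic_arith (sobolev_cross_le Hu Hh) (KP Hh) K0 AU AhW Ah0).
Qed.

(** The linear term of the expansion is - t A(g,F) = - t A(g,g), by
    [riemannian_gradient_proj]. *)
Lemma gradient_descent : 
  energy Omega V beta (lc u (- t) g) <= energy Omega V beta u - t / 2 * A g g.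
Proof.
have Hg := H10_riemannian_gradient.
have Hv : H10 (lc u (- t) g) by exact: (H10_lc oO bO _ Hu Hg).
have AgW : A g g <= W by exact: le_trans riemannian_gradient_le AW.
have Q := quartic_decrease Hg AgW.
have P : A g u + beta * I (fun x => g x * (u x ^+ 2 * u x)) = A g g.
  rewrite -riemannian_gradient_proj a0_gradientE.
  by rewrite (a0H_lcr _ Hu HGc Hg) (green_cubic_spec Hu).2.
rewrite (energyE Hv) (energyE Hu) (a0H_quad _ Hu Hg) (a0_sym _ _ u g).
exact: (descent_arith (A u u) hbeta (ltW t0) t1 (a0H_ge0 Hg) P Q).
Qed.

(** As [g] is orthogonal to [u] in L^2, the norm of u - t g is at least 1,
    and dividing by it decreases the energy. *)
Lemma retraction_descent :
  let v := retraction Omega (fun x => u x - t * g x) in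
  [/\ H10 v, L2_norm Omega v = 1 &
      energy Omega V beta v <= energy Omega V beta u - t / 2 * A g g].
Proof.
have Hg := H10_riemannian_gradient.
have Hv : H10 (lc u (- t) g) by exact: (H10_lc oO bO _ Hu Hg).
have E : (fun x => u x - t * g x) = lc u (- t) g by apply/funext => x; rewrite /lc mulNr.
rewrite E; set v := lc u (- t) g in Hv *.
have n2 : 1 <= I (fun x => v x * v x).
  have sg := H10_sqint Hg; have su := H10_sqint Hu.
  have i1 := su.2; have i2 := sqintM mO sg su; have i3 := sg.2.
  have i4 := intbleD mO i1 (intbleZ mO (- (2 * t)) i2).
  have -> : I (fun x => v x * v x) =
      I (fun x => (u x ^+ 2 + - (2 * t) * (g x * u x)) + t ^+ 2 * g x ^+ 2).
    by apply: eq_Rintegral => x _; rewrite /v /lc; ring.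
  rewrite (Rintegral_intbleD mO i4 (intbleZ mO _ i3)) (Rintegral_intbleD mO i1 (intbleZ mO _ i2)).
  rewrite (Rintegral_intbleZ mO _ i2) (Rintegral_intbleZ mO _ i3) u1 riemannian_gradient_L2_orth mulr0 addr0.
  by rewrite lerDl mulr_ge0 ?sqr_ge0//; apply: Rintegral_ge0 => x _; exact: sqr_ge0.
pose n := L2_norm Omega v.
have n1 : 1 <= n.
  by rewrite /n /L2_norm /L2_ip -(@sqrtr1 R) ler_wsqrtr.
have n0 : 0 < n by exact: lt_le_trans n1.
have s01 : 0 <= n^-1 <= 1.
  by rewrite invr_ge0 (ltW n0) invf_le1.
have rE : retraction Omega v = (fun x => n^-1 * v x).
  by apply/funext => x; rewrite /retraction mulrC.
have [Es Hs] := energy_scale Hv s01.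
rewrite rE; split => //; last first.
  by apply: le_trans Es _; exact: gradient_descent.
rewrite /L2_norm /L2_ip.
have -> : I (fun x => n^-1 * v x * (n^-1 * v x)) = (n^-1) ^+ 2 * I (fun x => v x * v x).
  rewrite -(Rintegral_intbleZ mO _ (sqintM mO (H10_sqint Hv) (H10_sqint Hv))).
  by apply: eq_Rintegral => x _; ring.
have -> : I (fun x => v x * v x) = n ^+ 2.
  by rewrite /n /L2_norm sqr_sqrtr// (le_trans _ n2).
by rewrite exprVn mulVf ?sqrtr1// expf_neq0// gt_eqF.
Qed.

End descent.

(** * All steps of the scheme *)

(** The L^2 part of the a0 norm is bounded on the manifold, where the L^2
    norm is 1. *)
Lemma a0_le_grad (R : realType) (d : nat) (Omega : set 'rV[R]_d)
    (V : 'rV[R]_d -> R) : open Omega -> bounded_set Omega -> potential Omega V ->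
  exists2 k, 0 <= k & forall u, H1 Omega u -> L2_norm Omega u = 1 ->
    a0_ip Omega V u u <= H10_norm Omega u ^+ 2 + k.
Proof.
move=> oO bO hV; have [k k0 VK] := potential_bound hV; exists k => // u Hu u1.
have A00 : 0 <= a0_ip Omega (cst 0) u u by apply: a0_ge0 => //; exact: potential_cst.
have -> : H10_norm Omega u ^+ 2 = a0_ip Omega (cst 0) u u.
  rewrite /H10_norm.
  have -> : \int[leb R d]_(x in Omega) dot (grad Omega u x) (grad Omega u x) =
      a0_ip Omega (cst 0) u u.
    by apply: eq_Rintegral => x _; rewrite /= !mul0r addr0.
  by rewrite sqr_sqrtr.
apply: (@le_trans _ _ (a0_ip Omega (cst k) u u)).
  apply: (a0_mono oO) => //; first exact: potential_cst.
  by apply: filterS VK => x Vx /Vx/andP[].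
rewrite (a0_split oO (potential_cst _ k0) Hu) lerD2l.
have -> : \int[leb R d]_(x in Omega) (cst k x * u x * u x) = k * L2_ip Omega u u.
  rewrite -(Rintegral_intbleZ (open_measurable_rV oO)); last exact: (sqintM (open_measurable_rV oO) (H1_sqint oO Hu) (H1_sqint oO Hu)).
  by apply: eq_Rintegral => x _; rewrite /= -mulrA.
have -> : L2_ip Omega u u = 1.
  have i0 : 0 <= L2_ip Omega u u.
    by apply: Rintegral_ge0 => x _; rewrite -expr2 sqr_ge0.
  by rewrite -(sqr_sqrtr i0) -/(L2_norm Omega u) u1 expr1n.
by rewrite mulr1.
Qed.

Lemma energy_bound_arith (R : realType) (a q K b M : R) : 0 <= b -> 0 <= K -> 0 <= a ->
  a <= M -> q <= K * a ^+ 2 -> 2^-1 * a + b / 4 * q <= 2^-1 * (M + b / 2 * (K * M ^+ 2)).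
Proof.
move=> b0 K0 a0 aM qK.
have h1 : a ^+ 2 <= M ^+ 2 by rewrite ler_sqr ?nnegrE// (le_trans a0).
have h2 : b / 4 * q <= b / 4 * (K * M ^+ 2).
  rewrite ler_wpM2l ?divr_ge0//; apply: le_trans qK _; exact: ler_wpM2l.
lra.
Qed.

Lemma energy_coercive_arith (R : realType) (a q U : R) : 2^-1 * a + q <= 2^-1 * U -> 0 <= q -> a <= U.
Proof. lra. Qed.

Lemma decrease_arith (R : realType) (s t a e f : R) : s <= t -> 0 <= a ->
  f <= e - t / 2 * a -> s / 2 * a <= e - f.
Proof.
move=> st a0 h; have : s / 2 * a <= t / 2 * a by rewrite ler_wpM2r// ler_wpM2r.
lra.
Qed.

Unset Implicit Arguments.
Set Strict Implicit.
Set Printing Implicit Defensive.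

Theorem theorem3p2 (R : realType) (d : nat) (hd : (1 <= d <= 3)%N)
    (Omega : set 'rV[R]_d) (hOmega : lipschitz_domain Omega)
    (hbounded : bounded_set Omega)
    (V : 'rV[R]_d -> R) (hV : potential Omega V)
    (beta : R) (hbeta : 0 <= beta) (r0 : R) :
  exists Cu Cg Calpha : R,
    [/\ 0 < Cu, 0 < Cg, 0 < Calpha <= 1 &
    forall u0 : 'rV[R]_d -> R,
      manifold Omega u0 -> H10_norm Omega u0 = r0 ->
    forall (alpha : nat -> R) (alpha_min alpha_max : R),
      0 < alpha_min ->
      (forall n, alpha_min <= alpha n <= alpha_max) ->
      alpha_max <= Calpha ->
    forall n : nat,
      let u := a0_scheme Omega V beta alpha u0 in
      [/\ manifold Omega (u n),
          a0_norm Omega V (u n) <= Cu,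
          a0_norm Omega V (riemannian_gradient Omega V beta (u n)) <=
            a0_norm Omega V (a0_gradient Omega V beta (u n)) <= Cg &
          alpha_min / 2 *
            a0_norm Omega V (riemannian_gradient Omega V beta (u n)) ^+ 2 <=
          energy Omega V beta (u n) - energy Omega V beta (u n.+1)]].
Proof.
have [_ oO _ _] := hOmega; have bO := hbounded.
have [K K0 KP] := sobolev_embedding oO bO hd hV.
have [k k0 kP] := a0_le_grad oO bO hV.
(* [M] bounds A(u0,u0), [U] twice the energy of [u0] and hence A(u,u) for
   all iterates, [W] the squared norm of their a0-gradients; [S] is the
   coefficient of the quartic remainder of one step. *)
pose M := r0 ^+ 2 + k.
pose U := M + beta / 2 * (K * M ^+ 2).
pose W := 2 * U + 2 * beta ^+ 2 * (K ^+ 2 * U ^+ 3).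
pose S := beta / 4 * (8 * K * U + 3 * K * W).
have M0 : 0 <= M by rewrite addr_ge0 ?sqr_ge0.
have U0 : 0 <= U by rewrite addr_ge0// mulr_ge0 ?divr_ge0// mulr_ge0 ?sqr_ge0.
have W0 : 0 <= W.
  have ? : 0 <= 2 * beta ^+ 2 * (K ^+ 2 * U ^+ 3).
    apply: mulr_ge0; first by rewrite mulr_ge0 ?sqr_ge0.
    by rewrite mulr_ge0 ?sqr_ge0 ?exprn_ge0.
  by rewrite addr_ge0// mulr_ge0.
have S0 : 0 <= S.
  apply: mulr_ge0; first by rewrite divr_ge0.
  by apply: addr_ge0; apply: mulr_ge0 => //; apply: mulr_ge0.
have S1 : 0 < 1 + 2 * S by lra.
exists (Num.sqrt U + 1), (Num.sqrt W + 1), (1 + 2 * S)^-1; split.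
- by rewrite ltr_wpDl ?sqrtr_ge0.
- by rewrite ltr_wpDl ?sqrtr_ge0.
- by rewrite invr_gt0 S1/= invf_le1//; lra.
move=> u0 [Hu0 u01] u0r alpha amin amax amin0 ha hamax n u.
pose ok w := [/\ H10 Omega w, \int[leb R d]_(x in Omega) (w x ^+ 2) = 1 &
  energy Omega V beta w <= 2^-1 * U].
have okA w : ok w -> a0_ip Omega V w w <= U.
  move=> [Hw _]; rewrite (energyE oO bO hd beta hV Hw) => h.
  have h4 : 0 <= beta / 4 * \int[leb R d]_(x in Omega) (w x ^+ 4).
    by rewrite mulr_ge0 ?divr_ge0//; exact: Rintegral_quartic_ge0.
  move: h h4; exact: energy_coercive_arith.
have okF w : ok w -> a0_ip Omega V (a0_gradient Omega V beta w) (a0_gradient Omega V beta w) <= W.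
  move=> okw; have AU := okA _ okw; have [Hw _ _] := okw.
  apply: le_trans (a0_gradient_le oO bO hd beta hV K0 KP Hw) _.
  have A0 : 0 <= a0_ip Omega V w w by exact: (a0H_ge0 oO hV Hw).
  apply: lerD; first by rewrite ler_wpM2l.
  apply: ler_wpM2l; first by rewrite mulr_ge0 ?sqr_ge0.
  by apply: ler_wpM2l; [exact: sqr_ge0|rewrite lerXn2r ?nnegrE].
have L2E w : \int[leb R d]_(x in Omega) (w x ^+ 2) = 1 <-> L2_norm Omega w = 1.
  have -> : \int[leb R d]_(x in Omega) (w x ^+ 2) = L2_ip Omega w w.
    by apply: eq_Rintegral => x _; rewrite expr2.
  have i0 : 0 <= L2_ip Omega w w.
    by apply: Rintegral_ge0 => x _; rewrite -expr2 sqr_ge0.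
  split=> [h|h]; first by rewrite /L2_norm h sqrtr1.
  by rewrite -(sqr_sqrtr i0) -/(L2_norm Omega w) h expr1n.
have aP m : 0 < alpha m /\ alpha m * (1 + 2 * S) <= 1.
  have /andP[h1 h2] := ha m; split; first exact: lt_le_trans h1.
  by rewrite -ler_pdivlMr// mul1r (le_trans h2).
have step m : ok (u m) ->
    ok (u m.+1) /\ energy Omega V beta (u m.+1) <= energy Omega V beta (u m) -
      alpha m / 2 * a0_ip Omega V (riemannian_gradient Omega V beta (u m))
        (riemannian_gradient Omega V beta (u m)).
  move=> okm; have [Hm m1 Em] := okm; have [a0 a1] := aP m.
  have [Hv v1 Ev] := retraction_descent oO bO hd hV hbeta K0 KP Hm m1
     (okA _ okm) (okF _ okm) a0 a1.
  have Hg := H10_riemannian_gradient oO bO hd beta hV K0 KP Hm m1.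
  have g0 := a0H_ge0 oO hV Hg.
  split; last exact: Ev.
  split; [exact: Hv|exact: ((L2E _).2 v1)|].
  apply: (le_trans Ev); apply: (le_trans _ Em).
  rewrite gerBl; apply: mulr_ge0 g0; apply: divr_ge0; [exact: ltW|exact: ler0n].
have okn : ok (u n).
  elim: n => [|m /step[okm _]]; last exact: okm.
  split; [exact: Hu0|exact: ((L2E _).2 u01)|].
  have Hu1 := H10_H1 Hu0.
  rewrite (energyE oO bO hd beta hV Hu0).
  have aM : a0_ip Omega V u0 u0 <= M by rewrite /M -u0r; exact: kP Hu1 u01.
  exact: (energy_bound_arith hbeta K0 (a0H_ge0 oO hV Hu0) aM (KP _ Hu0)).
have [Hn n1 En] := okn; have [_ dec] := step _ okn.
have Hg := H10_riemannian_gradient oO bO hd beta hV K0 KP Hn n1.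
have HF := H10_a0_gradient oO bO hd beta hV K0 KP Hn.
split.
- by split; [exact: Hn|exact: ((L2E _).1 n1)].
- apply: (@le_trans _ _ (Num.sqrt U)); last by rewrite lerDl.
  by apply: ler_wsqrtr; exact: okA.
- apply/andP; split.
    apply: ler_wsqrtr; exact: (riemannian_gradient_le oO bO hd beta hV K0 KP Hn n1).
  apply: (@le_trans _ _ (Num.sqrt W)); last by rewrite lerDl.
  by apply: ler_wsqrtr; exact: okF.
- rewrite (a0_norm_sqr oO hV Hg).
  have /andP[amn _] := ha n.
  exact: decrease_arith amn (a0H_ge0 oO hV Hg) dec.
Qed.
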